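(* Let $E$ be a metrizable locally convex space over $\mathbb{K}$ of infinite countable algebraic dimension. Then $E$ does not have the invariant subset property. That is, there is a continuous linear operator $T:E\to E$ whose only closed invariant subsets are among $\varnothing$, $\{0\}$ and $E$.
   Context: $\mathbb{K}$ is either $\mathbb{R}$ or $\mathbb{C}$. All topological spaces are Hausdorff. For a topological vector space $X$, $L(X)$ is the algebra of continuous linear operators on $X$. $X$ has the invariant subset property if every $T\in L(X)$ has a closed invariant subset (a closed set $A\subseteq X$ with $T(A)\subseteq A$) different from $\varnothing$, $\{0\}$ and $X$. *)

(* Defs.v *)
From HB Require Import structures.
From mathcomp Require Import all_boot all_order all_algebra finmap complex.
From mathcomp Require Import all_classical all_reals all_analysis.

Set Implicit Arguments.
Unset Strict Implicit.
Unset Printing Implicit Defensive.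

Import Order.TTheory GRing.Theory Num.Theory.
Import numFieldNormedType.Exports.

Local Open Scope classical_set_scope.
Local Open Scope ring_scope.
Local Open Scope complex_scope.

Variant real_or_complex (R : realType) : numFieldType -> Prop :=
| RealScalars : real_or_complex R R
| ComplexScalars : real_or_complex R R[i].

Definition is_metric (R : realType) (T : Type) (d : T -> T -> R) : Prop :=
  [/\ forall x y, 0 <= d x y,
      forall x y, d x y = 0 <-> x = y,
      forall x y, d x y = d y x &
      forall x y z, d x z <= d x y + d y z].

(* Only the topology is compared with [d], so for a [tvsType] no compatibility
   with its uniform structure is required. Metrizable implies Hausdorff. *)
Definition metrizable (R : realType) (T : topologicalType) : Prop :=
  exists2 d : T -> T -> R, is_metric d &
    forall x : T,
      nbhs x = filter_from [set e : R | 0 < e] (fun e => [set y | d x y < e]).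

Definition linearly_independent (K : numFieldType) (E : lmodType K)
    (B : set E) : Prop :=
  forall (F : {fset E}) (a : E -> K), [set` F] `<=` B ->
    \sum_(v <- F) a v *: v = 0 -> forall v, v \in F -> a v = 0.

Definition spanning (K : numFieldType) (E : lmodType K) (B : set E) : Prop :=
  forall x : E, exists (F : {fset E}) (a : E -> K),
    [set` F] `<=` B /\ x = \sum_(v <- F) a v *: v.

Definition hamel_basis (K : numFieldType) (E : lmodType K) (B : set E) : Prop :=
  linearly_independent B /\ spanning B.

(* Countable algebraic dimension in the strict sense: [countable] alone would
   allow finite Hamel bases. *)
Definition countably_infinite_dimensional (K : numFieldType)
    (E : lmodType K) : Prop :=
  exists B : set E, [/\ hamel_basis B, infinite_set B & countable B].

Definition closed_invariant (K : numFieldType) (E : topologicalLmodType K)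
    (T : {linear E -> E}) (A : set E) : Prop :=
  closed A /\ T @` A `<=` A.

Definition invariant_subset_property (K : numFieldType)
    (E : topologicalLmodType K) : Prop :=
  forall T : {linear E -> E}, continuous T ->
    exists A : set E,
      [/\ closed_invariant T A, A <> set0, A <> [set 0] & A <> [set: E]].

(* Main.v *)
(* Pulling the topology back along a Hamel basis, E becomes K[X] with an increasing separating
   sequence of seminorms q_k, and it suffices to find a continuous operator for which every nonzero
   vector has a dense orbit.

   Hahn-Banach and Gram-Schmidt give a biorthogonal Hamel basis (e_r, f_r) and types t_r such that
   q_k (e_r) = 0 for k < t_r and f_r is bounded by q_{t_r}.  Starting from an operator T_0, one
   conjugates repeatedly by finite-rank perturbations of the identity; the step number n fixes a
   longer initial part of the orbit of a vector u and brings a later iterate close to the n-th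
   element of a countable dense set.  In the limit the iterates of u form a Hamel basis with dense
   range.  Then K[T]u = E, and every nonzero P(T)u has a dense orbit too: the ideal P K[X] is dense
   for the seminorms p |-> q_k (p(T)u), because the scalars 0 and 2 are limits of powers of X.

   The types decide which T_0 is available, in a suitably rescaled and reordered basis.  For
   bounded types T_0 is p(X) |-> p(X + 1).  If the basis can be ordered so that each q_k vanishes
   on long windows of basis vectors, T_0 is p |-> p + (p - p(0)) / X.  In the remaining case E is
   the product of a space Y of bounded types and of the space of finite sequences with the
   coordinatewise topology; there a minimal operator of Y is coupled with the backward shift. *)
Require Import Defs.
From HB Require Import structures.
From mathcomp Require Import all_boot all_order all_algebra finmap.
From mathcomp Require Import complex boolp classical_sets reals.
From mathcomp Require Import ring lra zify.

Set Implicit Arguments.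
Unset Strict Implicit.
Unset Printing Implicit Defensive.

Import Order.TTheory GRing.Theory Num.Theory.

Local Open Scope classical_set_scope.
Local Open Scope ring_scope.

(** * Seminorms and polynomials of an operator *)

(** A metrizable space of infinite countable dimension is never complete, so neither Baire category
    nor convergent series of operators are at hand. Exactness replaces them: a perturbation leaves
    the iterates of u fixed so far untouched, and since these iterates finally exhaust the space,
    the successive operators are eventually constant on each vector. Only the continuity of the
    limit needs estimates. These estimates shape the case distinction. Fixing finitely many iterates
    requires functionals dual to them, and each of these is only bounded by some seminorm q_N. If
    one seminorm bounds them all, perturbations that are merely small suffice. Otherwise N grows
    with the steps, and the perturbation must be invisible to the seminorms already under control;
    the windows make room for it. In the remaining case there are infinitely many vectors of type at
    most some k_0, but for each l only finitely many with type in ]k_0, l]: continuity then forbids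
    the order of the basis to pass from visible vectors to windows again and again. *)

Section Seminorms.
Context {R : realType} {K : numFieldType}.
Implicit Types (nrm : K -> R).

(** The norm of a [numFieldType] takes its values in the field itself; an R-valued absolute value
    lets all seminorms and estimates live in R, for complex scalars too. The last clause makes it
    archimedean and gives |2 - c| >= 1 for |c| <= 1. *)
Record absval nrm : Prop := Absval {
  absval_ge0 : forall x, 0 <= nrm x;
  absval_eq0 : forall x, nrm x = 0 -> x = 0;
  absvalM : forall x y, nrm (x * y) = nrm x * nrm y;
  absvalD : forall x y, nrm (x + y) <= nrm x + nrm y;
  absval_nat : forall n, nrm n%:R = n%:R }.

Definition seminorm nrm (V : lmodType K) (q : V -> R) : Prop :=
  (forall x y, q (x + y) <= q x + q y) /\
  (forall a x, q (a *: x) = nrm a * q x).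

Section Absval.
Variables (nrm : K -> R) (hn : absval nrm).

Lemma absval0 : nrm 0 = 0. Proof. exact: (absval_nat hn 0). Qed.
Lemma absval1 : nrm 1 = 1. Proof. exact: (absval_nat hn 1). Qed.

Lemma absvalN x : nrm (- x) = nrm x.
Proof.
have N1 : nrm (-1) = 1.
  have : (nrm (-1) - 1) * (nrm (-1) + 1) = 0.
    rewrite -subr_sqr expr2 -absvalM // mulrNN mulr1 absval1 expr1n; ring.
  move/eqP; rewrite mulf_eq0 => /orP[/eqP H|/eqP H].
    by apply/eqP; rewrite -subr_eq0 H.
  by have := absval_ge0 hn (-1); lra.
by rewrite -mulN1r absvalM // N1 mul1r.
Qed.

Lemma absval_gt0 x : x != 0 -> 0 < nrm x.
Proof.
move=> x0; rewrite lt_neqAle absval_ge0 // andbT eq_sym.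
by apply: contra x0 => /eqP /(absval_eq0 hn) ->.
Qed.

Lemma absvalX x n : nrm (x ^+ n) = nrm x ^+ n.
Proof. by elim: n => [|n IH]; rewrite ?expr0 ?absval1 // !exprS absvalM // IH. Qed.

Lemma absvalV x : nrm x^-1 = (nrm x)^-1.
Proof.
have [->|x0] := eqVneq x 0; first by rewrite invr0 absval0 invr0.
have nx := absval_gt0 x0; apply: (mulfI (lt0r_neq0 nx)).
by rewrite -absvalM // !divff ?absval1 // lt0r_neq0.
Qed.

Lemma absval_sum I (r : seq I) (P : pred I) (F : I -> K) :
  nrm (\sum_(i <- r | P i) F i) <= \sum_(i <- r | P i) nrm (F i).
Proof.
elim/big_ind2: _ => [|x1 x2 y1 y2 h1 h2|//]; first by rewrite absval0.
by apply: le_trans (absvalD hn _ _) _; apply: lerD.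
Qed.

Variables (V : lmodType K) (q : V -> R) (hq : seminorm nrm q).

Lemma semi0 : q 0 = 0.
Proof. by rewrite -(scale0r (0 : V)) hq.2 absval0 mul0r. Qed.

Lemma semiN x : q (- x) = q x.
Proof. by rewrite -scaleN1r hq.2 absvalN absval1 mul1r. Qed.

Lemma semi_ge0 x : 0 <= q x.
Proof. by have := hq.1 x (- x); rewrite subrr semi0 semiN; lra. Qed.

Lemma semi_sum I (r : seq I) (P : pred I) (F : I -> V) :
  q (\sum_(i <- r | P i) F i) <= \sum_(i <- r | P i) q (F i).
Proof.
elim/big_ind2: _ => [|x1 x2 y1 y2 h1 h2|//]; first by rewrite semi0.
by apply: le_trans (hq.1 _ _) _; apply: lerD.
Qed.

Lemma semiB x y : q (x - y) <= q x + q y.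
Proof. by have := hq.1 x (- y); rewrite semiN. Qed.

Lemma semi_lincomb I (r : seq I) (P : pred I) (c : I -> K) (F : I -> V) :
  q (\sum_(i <- r | P i) c i *: F i) <= \sum_(i <- r | P i) nrm (c i) * q (F i).
Proof.
by apply: le_trans (semi_sum _ _ _) _; apply: ler_sum => i _; rewrite hq.2.
Qed.

End Absval.
End Seminorms.

Section PolynomialAction.
Context {K : numFieldType} {V : lmodType K}.
Implicit Types (T F G : {linear V -> V}) (u : V) (c : {poly K}).

(** The vector c(T) u. With [u] fixed and [c] variable, the orbit of [u] is the image of the powers
    of X, and questions about K[T] u become questions about polynomials. *)
Definition act T u c : V := \sum_(i < size c) c`_i *: iter i T u.

Lemma actE T u c n : (size c <= n)%N -> act T u c = \sum_(i < n) c`_i *: iter i T u.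
Proof.
move=> h; rewrite /act (big_ord_widen _ (fun i => c`_i *: iter i T u) h) big_mkcond /=.
apply: eq_bigr => i _; case: ifP => // /negbT; rewrite -leqNgt => hi.
by rewrite nth_default // scale0r.
Qed.

Lemma act_linear T u : linear (act T u).
Proof.
move=> a c d; set n := maxn (size c) (size d).
have hn : (size (a *: c + d)%R <= n)%N.
  apply: leq_trans (size_polyD _ _) _; rewrite geq_max; apply/andP; split.
    exact: leq_trans (size_scale_leq _ _) (leq_maxl _ _).
  exact: leq_maxr.
rewrite !(@actE _ _ _ n) ?leq_maxl ?leq_maxr // scaler_sumr -big_split /=.
by apply: eq_bigr => i _; rewrite coefD coefZ scalerDl scalerA.
Qed.

HB.instance Definition _ T u :=
  GRing.isLinear.Build K {poly K} V _ (act T u) (act_linear T u).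

Lemma act_Xn T u n : act T u 'X^n = iter n T u.
Proof.
rewrite /act size_polyXn big_ord_recr /= coefXn eqxx scale1r.
by rewrite big1 ?add0r // => i _; rewrite coefXn ltn_eqF // scale0r.
Qed.

Lemma act_X T u : act T u 'X = T u. Proof. exact: (act_Xn T u 1). Qed.

Lemma act_1 T u : act T u 1 = u.
Proof. by rewrite -(expr0 'X) act_Xn. Qed.

Lemma act_MX T u c : act T u (c * 'X) = T (act T u c).
Proof.
rewrite (@actE _ _ _ (size c).+1); last by rewrite (leq_trans (size_polyMleq _ _)) // size_polyX addn2.
rewrite big_ord_recl coefMX /= scale0r add0r linear_sum.
by apply: eq_bigr => i _; rewrite coefMX /= linearZ.
Qed.

Lemma act_XM T u c : act T u ('X * c) = T (act T u c).
Proof. by rewrite mulrC act_MX. Qed.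

Lemma act_XnM T u c n : act T u ('X^n * c) = iter n T (act T u c).
Proof.
by elim: n => [|n IH]; rewrite ?expr0 ?mul1r // exprS -mulrA act_XM IH.
Qed.

Lemma act_mul T u c d : act T u (c * d) = act T (act T u d) c.
Proof.
rewrite -{1}[c]coefK poly_def mulr_suml linear_sum /act.
by apply: eq_bigr => i _; rewrite -scalerAl linearZ /= act_XnM.
Qed.

Lemma iter_lin T n : linear (iter n T).
Proof.
move=> a x y; elim: n => //= n ->; exact: linearP.
Qed.

HB.instance Definition _ T n := GRing.isLinear.Build K V V _ (iter n T) (iter_lin T n).

End PolynomialAction.

(** * Sequences built by successive extension *)

Section SequenceByExtension.
Variable D : Type.

Definition update (S : nat -> D) n d : nat -> D := fun j => if j == n then d else S j.

(** Dependent choice for invariants that read the whole past: since [Inv n] only looks at the first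
    n values, the diagonal of the successive extensions satisfies each of them. *)
Lemma sequence_by_extension (Inv : nat -> (nat -> D) -> Prop) (S0 : nat -> D) :
  (forall n S S', (forall j, (j < n)%N -> S j = S' j) -> Inv n S -> Inv n S') ->
  Inv 0%N S0 -> (forall n S, Inv n S -> exists d, Inv n.+1 (update S n d)) ->
  exists S, forall n, Inv n S.
Proof.
move=> hloc h0 hext.
have hex (p : nat * (nat -> D)) : exists d, Inv p.1 p.2 -> Inv p.1.+1 (update p.2 p.1 d).
  case: (pselect (Inv p.1 p.2)) => [/hext[d hd]|hN]; first by exists d.
  by exists (S0 0%N) => /hN.
have [ext hE] := choice hex.
pose st := fix st n := if n is m.+1 then update (st m) m (ext (m, st m)) else S0.
have Ist n : Inv n (st n) by elim: n => //= n IH; exact: (hE (n, st n)).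
exists (fun j => st j.+1 j) => n; apply: hloc (Ist n) => j.
elim: n => // n IH jn; rewrite /= {1}/update; case: eqP => [->|/eqP ne].
  by rewrite /update eqxx.
by apply: IH; move: jn; rewrite ltnS leq_eqVlt (negbTE ne).
Qed.

End SequenceByExtension.

Definition mk_linear {K : numFieldType} {V W : lmodType K} (f : V -> W)
  (lf : linear f) : {linear V -> W} := HB.pack f (GRing.isLinear.Build K V W _ f lf).

Definition mk_scalar {K : numFieldType} {V : lmodType K} (f : V -> K)
  (lf : scalar f) : {scalar V} := HB.pack f (GRing.isLinear.Build K V K _ f lf).

(** * Inverting a finite-rank perturbation of the identity *)

Section FiniteRankPerturbation.
Context {R : realType} {K : numFieldType} {V : lmodType K}.
Variables (nrm : K -> R) (hn : absval nrm).
Variables (d : nat) (h : 'I_d -> {scalar V}) (a : 'I_d -> V).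

Lemma lincomb_linear (g : 'I_d -> {scalar V}) : linear (fun z => \sum_i g i z *: a i).
Proof.
move=> c x y; rewrite scaler_sumr -big_split /=; apply: eq_bigr => i _.
by rewrite scalarP scalerDl scalerA.
Qed.

Variables (q : V -> R) (hq : seminorm nrm q).

(** The map is inverted through the d x d matrix 1 + A with A_ij = h_j (a_i), so no Neumann series
    is summed. For a row v in the kernel of 1 + A, the vector z = \sum_i v_i a_i satisfies z = -
    \sum_i h_i (z) a_i; the contraction gives q z = 0, the second hypothesis h_i (z) = 0, and so v =
    0. The factor 2 comes from q y <= q z + q y / 2 for y = G z. *)
Lemma finite_rank_inverse :
  (forall z, \sum_i nrm (h i z) * q (a i) <= q z / 2) ->
  (forall z, q z = 0 -> forall i, h i z = 0) ->
  exists F G : {linear V -> V},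
    [/\ forall z, F z = z + \sum_i h i z *: a i, cancel F G, cancel G F &
        forall z, q (G z) <= 2 * q z].
Proof.
move=> hsmall hker.
pose hv z : 'rV[K]_d := \row_i h i z.
pose A : 'M[K]_d := \matrix_(i, j) h j (a i).
have hvlin c x y : hv (c *: x + y) = c *: hv x + hv y.
  by apply/rowP => i; rewrite !mxE scalarP.
have hvD x y : hv (x + y) = hv x + hv y by rewrite -[x in LHS]scale1r hvlin scale1r.
have hvA (v : 'rV[K]_d) : hv (\sum_i v 0 i *: a i) = v *m A.
  apply/rowP => j; rewrite !mxE linear_sum; apply: eq_bigr => i _.
  by rewrite !mxE linearZ.
have qQ z : q (\sum_i h i z *: a i) <= q z / 2.
  exact: le_trans (semi_lincomb hn hq _ _ _ _) (hsmall z).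
have unitB : 1%:M + A \in unitmx.
  rewrite -row_free_unit; apply: inj_row_free => v.
  rewrite mulmxDr mulmx1 -hvA => /eqP; rewrite addr_eq0 => /eqP hv0.
  have vE : v = - hv (\sum_i v 0 i *: a i) by [].
  set z := \sum_i v 0 i *: a i in vE *.
  have zE : z = - \sum_i h i z *: a i.
    rewrite {1}/z {1}vE -sumrN; apply: eq_bigr => i _.
    by rewrite !mxE scaleNr.
  have q0 : q z = 0.
    have qE : q z = q (\sum_i h i z *: a i) by rewrite {1}zE (semiN hn hq).
    by have := qQ z; have := semi_ge0 hn hq z; lra.
  rewrite vE; apply/rowP => i; rewrite !mxE hker //; exact: oppr0.
pose g i z : K := (hv z *m invmx (1%:M + A)) 0 i.
have glin i : scalar (g i).
  by move=> c x y; rewrite /g hvlin mulmxDl -scalemxAl !mxE.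
pose gs i := mk_scalar (glin i).
have linF : linear (fun z => z + \sum_i h i z *: a i).
  by move=> c x y; rewrite lincomb_linear scalerDr addrACA.
have linG : linear (fun z => z - \sum_i g i z *: a i).
  move=> c x y; have /= -> := lincomb_linear gs c x y.
  by rewrite scalerBr opprD addrACA.
have hvF z : hv (z + \sum_i h i z *: a i) = hv z *m (1%:M + A).
  rewrite hvD mulmxDr mulmx1 -hvA; congr (_ + hv _).
  by apply: eq_bigr => i _; rewrite mxE.
have hvG z : hv (z - \sum_i g i z *: a i) = hv z *m invmx (1%:M + A).
  have -> : \sum_i g i z *: a i = \sum_i (hv z *m invmx (1%:M + A)) 0 i *: a i by [].
  rewrite addrC -[- _]scaleN1r hvlin hvA scaleN1r addrC.
  rewrite -{1}(mulmxKV unitB (hv z)) mulmxDr mulmx1 addrK //.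
exists (mk_linear linF), (mk_linear linG).
have FK : cancel (mk_linear linF) (mk_linear linG).
  move=> z /=; rewrite /g hvF mulmxK //.
  by under [X in _ - X]eq_bigr do rewrite mxE; rewrite addrK.
have GK : cancel (mk_linear linG) (mk_linear linF).
  move=> z /=; under [X in _ + X]eq_bigr => i _.
    have -> : h i (z - \sum_i g i z *: a i) = g i z.
      by rewrite [RHS]/g -hvG mxE.
    over.
  by rewrite subrK.
split => // z.
set y := mk_linear linG z.
have yE : y = z - \sum_i h i y *: a i by rewrite -[in RHS](GK z) /= addrK.
have := semiB hn hq z (\sum_i h i y *: a i); rewrite -yE => h1.
by have := qQ y; lra.
Qed.

End FiniteRankPerturbation.

(** * Conjugation by finite-rank perturbations of the identity *)

Section Scheme.
Context {R : realType} {K : numFieldType} {V : lmodType K}.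
Variables (nrm : K -> R) (hn : absval nrm).
Variables (q : nat -> V -> R) (hq : forall k, seminorm nrm (q k)).
Hypothesis (hmono : forall k x, q k x <= q k.+1 x).

Definition qcont (T : V -> V) : Prop :=
  forall k, exists l C, forall x, q k (T x) <= C * q l x.

(** Linear independence of u, T u, ..., T^D u: size at most D + 1 means degree at most D. *)
Definition orbit_free (T : {linear V -> V}) (u : V) (D : nat) : Prop :=
  forall c : {poly K}, (size c <= D.+1)%N -> act T u c = 0 -> c = 0.

Lemma q_le k l x : (k <= l)%N -> q k x <= q l x.
Proof.
elim: l => [|l IH]; first by rewrite leqn0 => /eqP ->.
rewrite leq_eqVlt => /orP[/eqP -> //|]; rewrite ltnS => /IH h.
exact: le_trans h (hmono _ _).
Qed.

Lemma q_ge0 k x : 0 <= q k x. Proof. exact: (semi_ge0 hn (hq k)). Qed.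

Lemma qcontP (T : V -> V) : qcont T ->
  forall k, exists l C, [/\ 0 < C, (k <= l)%N & forall x, q k (T x) <= C * q l x].
Proof.
move=> hT k; have [l [C hC]] := hT k.
exists (maxn k l), (1 + `|C|); split; rewrite ?leq_maxl //.
  by have := normr_ge0 C; lra.
move=> x; apply: le_trans (hC x) _.
apply: (@le_trans _ _ ((1 + `|C|) * q l x)).
  by apply: ler_wpM2r; [exact: q_ge0|have := ler_norm C; lra].
by apply: ler_wpM2l; [have := normr_ge0 C; lra|exact: q_le (leq_maxr _ _)].
Qed.

Lemma qcont_comp (T S : V -> V) : qcont T -> qcont S -> qcont (T \o S).
Proof.
move=> /qcontP hT /qcontP hS k; have [l [C [C0 _ hC]]] := hT k.
have [l' [C' [C'0 _ hC']]] := hS l; exists l', (C * C') => x /=.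
by apply: le_trans (hC _) _; rewrite -mulrA ler_pM2l.
Qed.

Lemma qcont_finite_rank d (h : 'I_d -> {scalar V}) (a : 'I_d -> V) (G : V -> V) N C :
  (forall i z, nrm (h i z) <= C * q N z) -> (forall z, q N (G z) <= 2 * q N z) ->
  (forall z, G z = z - \sum_i h i (G z) *: a i) -> qcont G.
Proof.
move=> hC hG GE k; exists (maxn k N), (1 + \sum_i `|C| * 2 * q k (a i)) => z.
rewrite {1}GE; apply: le_trans (semiB hn (hq k) _ _) _; rewrite mulrDl mul1r.
apply: lerD; first exact: q_le (leq_maxl _ _).
apply: le_trans (semi_lincomb hn (hq k) _ _ _ _) _.
rewrite mulr_suml; apply: ler_sum => i _.
rewrite mulrAC; apply: ler_wpM2r; first exact: q_ge0.
apply: le_trans (hC _ _) _; rewrite -mulrA.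
have h1 := hG z; have h2 := q_le z (leq_maxr k N); have h3 := q_ge0 N (G z).
apply: (@le_trans _ _ (`|C| * q N (G z))).
  by apply: ler_wpM2r => //; exact: ler_norm.
by apply: ler_wpM2l => //; lra.
Qed.

Lemma qcont_add_finite_rank d (h : 'I_d -> {scalar V}) (a : 'I_d -> V) (F : V -> V) N C :
  (forall i z, nrm (h i z) <= C * q N z) ->
  (forall z, F z = z + \sum_i h i z *: a i) -> qcont F.
Proof.
move=> hC FE k; exists (maxn k N), (1 + \sum_i `|C| * q k (a i)) => z.
rewrite FE; apply: le_trans ((hq k).1 _ _) _; rewrite mulrDl mul1r.
apply: lerD; first exact: q_le (leq_maxl _ _).
apply: le_trans (semi_lincomb hn (hq k) _ _ _ _) _.
rewrite mulr_suml; apply: ler_sum => i _.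
rewrite mulrAC; apply: ler_wpM2r; first exact: q_ge0.
have h2 := q_le z (leq_maxr k N); have h3 := q_ge0 N z.
apply: le_trans (hC _ _) _; apply: (@le_trans _ _ (`|C| * q N z)).
  by apply: ler_wpM2r => //; exact: ler_norm.
exact: ler_wpM2l.
Qed.

Variable b : bool.

(** In the regime [b] the dual functionals are bounded by [q 0]. A conjugation step also evaluates
    them at [T x], which has to be controlled by [q 0 x] again. *)
Definition bounded0 (T : V -> V) : Prop := b -> exists C, forall x, q 0 (T x) <= C * q 0 x.

(* The perturbation [w] moves the orbit of [x] to the target [y]. The flag [b] selects the regime:
   [w] has small seminorms when [b] holds, and vanishing ones otherwise. The last three
   clauses keep the orbit of [x + w] finite dimensional, free, and spanning [x] and [z]. *)
Definition transitive_ext (T : {linear V -> V}) : Prop :=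
  forall n e x y z D0, 0 < e -> exists w m D,
  [/\ forall l, (l <= n)%N -> q n (iter l T w) <= b%:R * e,
      q n (iter m T (x + w) - y) <= e,
      (m <= D)%N && (D0 <= D)%N,
      orbit_free T (x + w) D /\ act T (x + w) (('X - 1) ^+ D.+1) = 0 &
      (exists c, x = act T (x + w) c) /\ (exists c, z = act T (x + w) c)].

Section Conjugation.
Variables (T F G : {linear V -> V}) (FK : cancel F G) (GK : cancel G F).
Let T' : {linear V -> V} := G \o (T \o F).

Lemma iter_conj m x : iter m T' x = G (iter m T (F x)).
Proof. by elim: m => [|m IH] /=; rewrite ?FK // IH GK. Qed.

Lemma act_conj x c : act T' x c = G (act T (F x) c).
Proof.
rewrite /act linear_sum; apply: eq_bigr => i _.
by rewrite iter_conj linearZ.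
Qed.

(** The perturbation is found for [T] at a level l and with a tolerance e / C that the continuity of
    [G] brings back to n and e. The polynomial clauses are invariant under conjugation. *)
Lemma transitive_ext_conj : qcont G -> transitive_ext T -> transitive_ext T'.
Proof.
move=> /qcontP hG hT n e x y z D0 e0.
have [l [C [C0 nl hC]]] := hG n.
have [w [m [D [hw hm hD [hfree hkill] [[c1 hc1] [c2 hc2]]]]]] :=
  hT l (e / C) (F x) (F y) (F z) D0 (divr_gt0 e0 C0).
have FxE : F (x + G w) = F x + w by rewrite linearD GK.
have qG v a : q l v <= a * (e / C) -> q n (G v) <= a * e.
  move=> h; apply: le_trans (hC v) _.
  have -> : a * e = C * (a * (e / C)) by field; exact: lt0r_neq0.
  by rewrite ler_pM2l.
exists (G w), m, D; split => //.
- move=> j hj; rewrite iter_conj GK; apply: qG; apply: hw.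
  exact: leq_trans hj nl.
- rewrite iter_conj FxE -[y]FK -linearB -[e]mul1r; apply: qG; by rewrite mul1r.
- split; last by rewrite act_conj FxE hkill linear0.
  move=> c hc; rewrite act_conj FxE => h0; apply: hfree => //.
  by rewrite -[LHS]GK h0 linear0.
- by split; [exists c1; rewrite act_conj FxE -hc1 FK|exists c2; rewrite act_conj FxE -hc2 FK].
Qed.
End Conjugation.

Hypothesis hdual : forall d (u : 'I_d -> V),
  (forall c : 'I_d -> K, \sum_i c i *: u i = 0 -> forall i, c i = 0) ->
  exists N C (h : 'I_d -> {scalar V}),
    [/\ b -> N = 0%N, forall i j, h i (u j) = (i == j)%:R &
        forall i z, nrm (h i z) <= C * q N z].

Lemma orbit_free_family (T : {linear V -> V}) u d : orbit_free T u d ->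
  forall c : 'I_d.+1 -> K, \sum_i c i *: iter i T u = 0 -> forall i, c i = 0.
Proof.
move=> hf c hc i.
have h0 : \poly_(i < d.+1) c (inord i) = 0.
  apply: hf; first exact: size_poly.
  rewrite (actE _ _ (size_poly _ _)) -[RHS]hc; apply: eq_bigr => j _.
  by rewrite coef_poly ltn_ord inord_val.
by have := congr1 (fun p : {poly K} => p`_i) h0; rewrite coef_poly ltn_ord inord_val coef0.
Qed.

(* [T'] is the conjugate [F^-1 T F] with [F = 1 + \sum_i h_i (x) T^i w] and [h_i] dual to the
   [T^i u0]: since [F (T^i u0) = T^i (u0 + w)], the first iterates of [u0] do not change, and
   the later ones follow the orbit of [u0 + w]. *)
Lemma scheme_step (T : {linear V -> V}) d u0 n e z y :
  qcont T -> bounded0 T -> transitive_ext T -> orbit_free T u0 d -> 0 < e ->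
  exists (T' : {linear V -> V}) d',
  [/\ [/\ qcont T', bounded0 T', transitive_ext T' & orbit_free T' u0 d'],
      forall i, (i <= d)%N -> iter i T' u0 = iter i T u0, (d < d')%N,
      (exists2 c : {poly K}, (size c <= d'.+1)%N & z = act T' u0 c) /\
      (exists2 m, (m <= d')%N & q n (iter m T' u0 - y) <= e) &
      forall k x, (k <= n)%N -> q k (T' x - T x) <= b%:R * e * q 0 x].
Proof.
move=> contT bT trT freeT e0.
have [N [C [h [bN hdelta hC']]]] := hdual (orbit_free_family freeT).
have {C hC'} [C C0 hC] : exists2 C, 0 <= C & forall i z, nrm (h i z) <= C * q N z.
  exists `|C| => // i v; apply: le_trans (hC' i v) _.
  by apply: ler_wpM2r; [exact: q_ge0|exact: ler_norm].
have [C2 C20 hC2] : exists2 C2, 0 <= C2 & b -> forall x, q 0 (T x) <= C2 * q 0 x.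
  case: (boolP b) => [/bT[C2 h2]|_]; last by exists 0.
  exists `|C2| => // _ v; apply: le_trans (h2 v) _.
  by apply: ler_wpM2r; [exact: q_ge0|exact: ler_norm].
(* [n'] dominates the level to be controlled, the level bounding the functionals, and the up to d +
   1 iterations applied to [w]. *)
pose n' := maxn n (maxn N d.+1).
have nn' : (n <= n')%N by rewrite leq_maxl.
have Nn' : (N <= n')%N by rewrite leq_max leq_maxl orbT.
have dn' : (d.+1 <= n')%N by rewrite leq_max leq_maxr !orbT.
pose M := d.+1%:R * C; have M0 : 0 <= M by rewrite mulr_ge0.
(* The bound on [e' * M] makes [F] invertible, [e' <= e / 4] serves the new iterate near [y], and
   the last two control [G y - y] and [T' - T]. *)
have [e' [e'0 eM e1 eMy eM2]] : exists e', [/\ 0 < e', e' * M <= 1 / 4, e' <= e / 4,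
    e' * (M * q n' y) <= e / 4 & e' * (M * (1 + C2)) <= e / 4].
  pose X := 1 + M + M * q n' y + M * (1 + C2).
  have t1 : 0 <= M * q n' y by rewrite mulr_ge0 ?q_ge0.
  have t2 : 0 <= M * (1 + C2) by rewrite mulr_ge0 // addr_ge0.
  have X1 : 1 <= X by rewrite /X; lra.
  have X0 : 0 < X by lra.
  pose ee := Num.min 1 e; have ee0 : 0 < ee by rewrite lt_min ltr01 e0.
  have ee1 : ee <= 1 by rewrite ge_min lexx.
  have eee : ee <= e by rewrite ge_min lexx orbT.
  have key t : 0 <= t -> t <= X -> ee / 4 / X * t <= ee / 4.
    move=> t0 tX; rewrite mulrAC ler_pdivrMr // ler_wpM2l //; lra.
  exists (ee / 4 / X); split.
  - by rewrite !divr_gt0.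
  - by apply: le_trans (key _ M0 _) _; rewrite /X; lra.
  - by have := key 1 ler01 X1; lra.
  - by apply: le_trans (key _ t1 _) _; rewrite /X; lra.
  - by apply: le_trans (key _ t2 _) _; rewrite /X; lra.
have [w [m [D [hw hm /andP[mD dD] [hfree hkill] [[c1 hc1] [c2 hc2]]]]]] :=
  trT n' e' u0 y z d.+1 e'0.
pose a (i : 'I_d.+1) := iter i T w.
have be0 : 0 <= b%:R * e' by rewrite mulr_ge0 // ltW.
have be1 : b%:R * e' <= e' by case: (b); rewrite ?mul1r ?mul0r // ltW.
have sumbound v (A : 'I_d.+1 -> V) : (forall i, q n' (A i) <= b%:R * e') ->
    \sum_i nrm (h i v) * q n' (A i) <= b%:R * e' * M * q N v.
  move=> hA; have -> : b%:R * e' * M * q N v = \sum_(i < d.+1) C * q N v * (b%:R * e').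
    by rewrite sumr_const card_ord -mulr_natl /M; ring.
  apply: ler_sum => i _; apply: ler_pM => //; [exact: absval_ge0|exact: q_ge0].
have ha (i : 'I_d.+1) : q n' (a i) <= b%:R * e'.
  by apply: hw; apply: leq_trans dn'; exact: ltnW.
have ha1 (i : 'I_d.+1) : q n' (iter i.+1 T w) <= b%:R * e'.
  by apply: hw; apply: leq_trans dn'.
have bM : b%:R * e' * M <= 1 / 4.
  by apply: le_trans eM; rewrite ler_wpM2r.
have hsmall v : \sum_i nrm (h i v) * q n' (a i) <= q n' v / 2.
  apply: le_trans (sumbound _ _ ha) _.
  apply: (@le_trans _ _ (1 / 4 * q n' v)); last by have := q_ge0 n' v; lra.
  by apply: ler_pM => //; [rewrite mulr_ge0|exact: q_ge0|exact: q_le].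
have hker v : q n' v = 0 -> forall i, h i v = 0.
  move=> v0 i; apply: (absval_eq0 hn); apply/eqP.
  rewrite eq_le absval_ge0 // andbT; apply: le_trans (hC i v) _.
  by rewrite -(mulr0 C); apply: ler_wpM2l => //; rewrite -v0; exact: q_le.
have [F [G [FE FK GK hG]]] := finite_rank_inverse hn (hq n') hsmall hker.
have GE v : G v = v - \sum_i h i (G v) *: a i by apply/eqP; rewrite eq_sym subr_eq -FE GK.
have Fu i : (i <= d)%N -> F (iter i T u0) = iter i T (u0 + w).
  move=> id; rewrite FE linearD; congr (_ + _).
  rewrite (bigD1 (inord i)) //= big1 ?addr0.
    have := hdelta (inord i) (inord i); rewrite eqxx inordK // => ->.
    by rewrite scale1r /a inordK.
  move=> j ji; have := hdelta j (inord i); rewrite inordK // => ->.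
  by rewrite (negbTE ji) scale0r.
pose T' : {linear V -> V} := G \o (T \o F).
have iterT' j v : iter j T' v = G (iter j T (F v)) by apply: iter_conj.
have actT' v c : act T' v c = G (act T (F v) c) by apply: act_conj.
have Fu0 : F u0 = u0 + w by apply: (Fu 0%N).
have contG : qcont G.
  apply: (@qcont_finite_rank _ h a G n' C) => // i v.
  by apply: le_trans (hC i v) _; apply: ler_wpM2l => //; exact: q_le.
have contF : qcont F by apply: (@qcont_add_finite_rank _ h a F N C).
have hdiff k x : (k <= n)%N -> q k (T' x - T x) <= b%:R * e * q 0 x.
  (* T' - T = G (T F - F T), where only the commutator of [T] with the finite-rank part survives. *)
  move=> kn; have -> : T' x - T x = G (\sum_i h i x *: iter i.+1 T w
      - \sum_i h i (T x) *: a i).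
    have -> : T' x - T x = G (T (F x) - F (T x)) by rewrite linearB FK.
    congr (G _).
    rewrite !FE linearD opprD addrACA subrr add0r; congr (_ - _).
    by rewrite linear_sum; apply: eq_bigr => i _; rewrite linearZ.
  apply: le_trans (q_le _ (leq_trans kn nn')) _; apply: le_trans (hG _) _.
  have h1 := semiB hn (hq n') (\sum_i h i x *: iter i.+1 T w) (\sum_i h i (T x) *: a i).
  have h2 := le_trans (semi_lincomb hn (hq n') _ _ _ _) (sumbound x _ ha1).
  have h3 := le_trans (semi_lincomb hn (hq n') _ _ _ _) (sumbound (T x) _ ha).
  have {}h1 := le_trans h1 (lerD h2 h3).
  suff : b%:R * e' * M * q N x + b%:R * e' * M * q N (T x) <= b%:R * (e / 2) * q 0 x by lra.
  case: (b) bN hC2 => [/(_ isT) N0 /(_ isT) hC2|_ _]; last by rewrite !mul0r addr0.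
  rewrite N0 !mul1r; have h4 := hC2 x.
  apply: (@le_trans _ _ (e' * (M * (1 + C2)) * q 0 x)).
    have -> : e' * (M * (1 + C2)) * q 0 x = e' * M * q 0 x + e' * M * (C2 * q 0 x) by ring.
    by rewrite lerD2l ler_wpM2l // mulr_ge0 // ltW.
  by apply: ler_wpM2r; [exact: q_ge0|lra].
exists T', D; split => //.
- split.
  + by apply: qcont_comp => //; apply: qcont_comp.
  + move=> hb; have := hdiff 0%N; rewrite hb => hd; exists (C2 + e) => v.
    have := (hq 0).1 (T' v - T v) (T v); rewrite subrK => h1.
    by have := hd v (leq0n _); have := hC2 hb v; rewrite mul1r; lra.
  + exact: transitive_ext_conj.
  + move=> c hc; rewrite actT' Fu0 => h0; apply: hfree => //.
    by rewrite -[LHS]GK h0 linear0.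
- by move=> i id; rewrite iterT' Fu0 -Fu // FK.
- split; last first.
    exists m => //; rewrite iterT' Fu0.
    have -> : G (iter m T (u0 + w)) - y = G (iter m T (u0 + w) - y) + (G y - y).
      by rewrite linearB addrA subrK.
    apply: le_trans ((hq n).1 _ _) _.
    have h1 : q n (G (iter m T (u0 + w) - y)) <= 2 * e'.
      apply: le_trans (q_le _ nn') _; apply: le_trans (hG _) _; lra.
    have h2 : q n (G y - y) <= e / 2.
      rewrite GE addrC addKr (semiN hn (hq n)); apply: le_trans (q_le _ nn') _.
      apply: le_trans (semi_lincomb hn (hq n') _ _ _ _) _.
      apply: le_trans (sumbound _ _ ha) _.
      apply: (@le_trans _ _ (e' * M * (2 * q n' y))); last lra.
      apply: ler_pM => //; [by rewrite mulr_ge0|exact: q_ge0|by rewrite ler_wpM2r|].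
      exact: le_trans (q_le _ Nn') (hG _).
    lra.
  have [c hc] : exists c, z = act T' u0 c.
    have hFz : exists c, F z = act T (u0 + w) c.
      (* As u0 = c1(T) (u0 + w), the vector T^i w is X^i - X^i c1 applied to u0 + w, so [F z] stays
         in the cyclic subspace of u0 + w. *)
      pose c := c2 + \sum_(i < d.+1) h i z *: ('X^i - 'X^i * c1).
      exists c; rewrite FE /c linearD /= -hc2; congr (_ + _).
      rewrite linear_sum; apply: eq_bigr => i _.
      rewrite linearZ /= linearB /= act_Xn act_XnM -hc1; congr (_ *: _).
      by rewrite linearD addrAC subrr add0r.
    by have [c hc] := hFz; exists c; rewrite actT' Fu0 -hc FK.
  (* The modulus annihilates [u0] under [T']; the remainder has degree at most D and thus only
     involves the iterates now fixed. *)
  exists (c %% ('X - 1) ^+ D.+1).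
    have := ltn_modp c (('X - 1) ^+ D.+1); rewrite -size_poly_eq0 -['X - 1]/('X - 1%:P).
    by rewrite size_exp_XsubC /= ltnS.
  have k0 : act T' u0 (('X - 1) ^+ D.+1) = 0 by rewrite actT' Fu0 hkill linear0.
  rewrite hc {1}(divp_eq c (('X - 1) ^+ D.+1)) linearD /= act_mul k0.
  by rewrite /act big1 ?add0r // => i _; rewrite linear0 scaler0.
Qed.

End Scheme.

(** * The limit of the conjugated operators *)

Section SchemeLimit.
Context {R : realType} {K : numFieldType} {V : lmodType K}.
Variables (nrm : K -> R) (hn : absval nrm).
Variables (q : nat -> V -> R) (hq : forall k, seminorm nrm (q k)).
Hypothesis (hmono : forall k x, q k x <= q k.+1 x).
Variable b : bool.
Hypothesis hdual : forall d (u : 'I_d -> V),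
  (forall c : 'I_d -> K, \sum_i c i *: u i = 0 -> forall i, c i = 0) ->
  exists N C (h : 'I_d -> {scalar V}),
    [/\ b -> N = 0%N, forall i j, h i (u j) = (i == j)%:R &
        forall i z, nrm (h i z) <= C * q N z].

Lemma linear_by_basis (u : nat -> V) :
  linear (fun c : {poly K} => \sum_(i < size c) c`_i *: u i).
Proof.
have E (c : {poly K}) n : (size c <= n)%N ->
    \sum_(i < size c) c`_i *: u i = \sum_(i < n) c`_i *: u i.
  move=> h; rewrite (big_ord_widen _ (fun i => c`_i *: u i) h) big_mkcond /=.
  apply: eq_bigr => i _; case: ifP => // /negbT; rewrite -leqNgt => hi.
  by rewrite nth_default // scale0r.
move=> a c d; set n := maxn (size c) (size d).
have hs : (size (a *: c + d)%R <= n)%N.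
  apply: leq_trans (size_polyD _ _) _; rewrite geq_max; apply/andP; split.
    exact: leq_trans (size_scale_leq _ _) (leq_maxl _ _).
  exact: leq_maxr.
rewrite !(E _ n) ?leq_maxl ?leq_maxr // scaler_sumr -big_split /=.
by apply: eq_bigr => i _; rewrite coefD coefZ scalerDl scalerA.
Qed.

Lemma linear_by_basis_Xn (u : nat -> V) i : mk_linear (linear_by_basis u) 'X^i = u i.
Proof.
rewrite /= size_polyXn big_ord_recr /= coefXn eqxx scale1r.
by rewrite big1 ?add0r // => j _; rewrite coefXn ltn_eqF // scale0r.
Qed.

(** Step n puts [bb n] into the span of the fixed iterates and one of them near [yy n]. The fixed
    iterates are then a basis, the limit is multiplication by X in it, and it coincides with the
    operator of step n on the span of the first d_n iterates, d_n being the number recorded at that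
    step. *)
Theorem scheme_limit (T0 : {linear V -> V}) (u0 : V) (bb yy : nat -> V) :
  qcont q T0 -> bounded0 q b T0 -> transitive_ext q b T0 -> u0 != 0 ->
  (forall x, exists n (a : nat -> K), x = \sum_(i < n) a i *: bb i) ->
  exists T : {linear V -> V},
    [/\ qcont q T, forall x, exists c, x = act T u0 c,
        forall c, act T u0 c = 0 -> c = 0 &
        forall n, exists m, q n (iter m T u0 - yy n) <= 2^-1 ^+ n].
Proof.
move=> cT0 bT0 tT0 u0n0 hbb.
pose S := ({linear V -> V} * nat)%type.
pose Inv (s : S) := [/\ qcont q s.1, bounded0 q b s.1, transitive_ext q b s.1
  & orbit_free s.1 u0 s.2].
pose Step n (s s' : S) := [/\ Inv s',
   forall i, (i <= s.2)%N -> iter i s'.1 u0 = iter i s.1 u0, (s.2 < s'.2)%N,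
   (exists2 c : {poly K}, (size c <= s'.2.+1)%N & bb n = act s'.1 u0 c) /\
   (exists2 m, (m <= s'.2)%N & q n (iter m s'.1 u0 - yy n) <= 2^-1 ^+ n) &
   forall k x, (k <= n)%N -> q k (s'.1 x - s.1 x) <= b%:R * 2^-1 ^+ n * q 0 x].
have e0 n : 0 < 2^-1 ^+ n :> R by rewrite exprn_gt0 // invr_gt0.
have hex (p : S * nat) : exists s', Inv p.1 -> Step p.2 p.1 s'.
  case: p => [[T d] n] /=.
  case: (pselect (Inv (T, d))) => [hI|nI]; last by exists (T, d) => /nI.
  case: (hI) => /= h1 h2 h3 h4.
  have [T' [d' [i1 i2 i3 i4 i5]]] :=
    scheme_step hn hq hmono hdual n (bb n) (yy n) h1 h2 h3 h4 (e0 n).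
  by exists (T', d') => _; split.
have [f hf] := choice hex.
pose st := fix st n : S := if n is n.+1 then f (st n, n) else (T0, 0%N).
have Inv0 : Inv (st 0%N).
  split=> //= c hc; have [a ->] : exists a, c = a%:P.
    by exists c`_0; exact: size1_polyC.
  have -> : a%:P = a *: 1 :> {poly K} by rewrite alg_polyC.
  rewrite linearZ /= act_1 => /eqP; rewrite scaler_eq0 (negbTE u0n0) orbF => /eqP ->.
  by rewrite scale0r.
have Invn n : Inv (st n) by elim: n => //= n IH; case: (hf (st n, n) IH).
have Stepn n : Step n (st n) (st n.+1) by exact: (hf (st n, n) (Invn n)).
have dn n : (n <= (st n).2)%N.
  by elim: n => // n IH; case: (Stepn n) => _ _ h _ _; exact: leq_ltn_trans h.
have stable n j i : (i <= (st n).2)%N -> iter i (st (n + j)%N).1 u0 = iter i (st n).1 u0.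
  move=> hi; elim: j => [|j IH]; rewrite ?addn0 // addnS.
  case: (Stepn (n + j)%N) => _ h0 _ _ _; rewrite h0 ?IH //.
  have {IH} : forall j', ((st n).2 <= (st (n + j')%N).2)%N.
    elim=> [|j' IH']; rewrite ?addn0 // addnS.
    by case: (Stepn (n + j')%N) => _ _ h _ _; exact: leq_trans (ltnW h).
  by move=> h; exact: leq_trans hi (h j).
pose u i := iter i (st i).1 u0.
have uE n i : (i <= (st n).2)%N -> iter i (st n).1 u0 = u i.
  move=> hi; rewrite /u; case: (leqP n i) => hni.
    by have := stable n (i - n)%N i hi; rewrite subnKC // => ->.
  by have := stable i (n - i)%N i (dn i); rewrite subnKC // ltnW.
pose Psi : {linear {poly K} -> V} := mk_linear (linear_by_basis u).
have PsiE n (c : {poly K}) : (size c <= (st n).2.+1)%N -> act (st n).1 u0 c = Psi c.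
  move=> hc; apply: eq_bigr => i _; rewrite uE //.
  by rewrite -ltnS; exact: leq_trans hc.
have Psi_inj c : Psi c = 0 -> c = 0.
  have hc : (size c <= (st (size c)).2.+1)%N by rewrite leqW.
  by rewrite -(PsiE _ _ hc); case: (Invn (size c)) => _ _ _ h; exact: h.
have Psi_surj x : exists c, x = Psi c.
  have hb n : exists c, bb n = Psi c.
    by case: (Stepn n) => _ _ _ [[c hc ->] _] _; exists c; rewrite PsiE.
  have [cb hcb] := choice hb.
  have [n [a ->]] := hbb x; exists (\sum_(i < n) a i *: cb i).
  by rewrite linear_sum; apply: eq_bigr => i _; rewrite linearZ /= hcb.
have [co hco] := choice Psi_surj.
have Psi_injB c d : Psi c = Psi d -> c = d.
  by move=> h; apply/eqP; rewrite -subr_eq0; apply/eqP/Psi_inj; rewrite linearB h subrr.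
have coPsi c : co (Psi c) = c by apply: Psi_injB; rewrite -hco.
have linT : linear (fun x => Psi (co x * 'X)).
  move=> a x y; rewrite -linearP scalerAl -mulrDl; congr (Psi (_ * _)).
  by rewrite [in LHS](hco x) [in LHS](hco y) -linearP coPsi.
pose T : {linear V -> V} := mk_linear linT.
have TPsi c : T (Psi c) = Psi (c * 'X) by rewrite /T /= coPsi.
have Psi_Xn i : Psi 'X^i = u i by exact: linear_by_basis_Xn.
have iterT i : iter i T u0 = u i.
  elim: i => // i IH; by rewrite iterS IH -Psi_Xn TPsi -exprSr Psi_Xn.
have actT c : act T u0 c = Psi c by apply: eq_bigr => i _; rewrite iterT.
exists T; split.
- move=> k; case: (Invn k) => /(qcontP hn hq hmono)/(_ k)[l [C [C0 kl hC]]] _ _ _.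
  exists l, (C + 2) => x; have [c ->] := Psi_surj x; set v := Psi c.
  have close j : q k ((st (k + j)%N).1 v - (st k).1 v) <= (2 - 2 * 2^-1 ^+ j) * q 0 v.
    elim: j => [|j IH].
      rewrite addn0 subrr (semi0 hn (hq k)) expr0 mulr1 subrr mul0r; exact: lexx.
    rewrite addnS; case: (Stepn (k + j)%N) => _ _ _ _ /(_ k v (leq_addr _ _)) h.
    have := (hq k).1 ((st (k + j).+1).1 v - (st (k + j)%N).1 v)
              ((st (k + j)%N).1 v - (st k).1 v).
    rewrite addrA subrK => h1.
    have h2 : b%:R * 2^-1 ^+ (k + j) * q 0 v <= 2^-1 ^+ j * q 0 v.
      apply: ler_wpM2r; first exact: (q_ge0 hn hq).
      have e1 : 2^-1 ^+ k <= 1 :> R by rewrite exprn_ile1 // ?invr_ge0 // invf_le1 // ler1n.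
      have h3 : 2^-1 ^+ (k + j) <= 2^-1 ^+ j :> R.
        by rewrite exprD ler_piMl // ltW.
      by case: (b); rewrite ?mul1r ?mul0r // ltW.
    have -> : (2 - 2 * 2^-1 ^+ j.+1) * q 0 v
        = (2 - 2 * 2^-1 ^+ j) * q 0 v + 2^-1 ^+ j * q 0 v by rewrite exprS; field.
    by lra.
  (* [T v] only involves iterates of index at most [size c], which are fixed at this step. *)
  have -> : T v = (st (k + size c)%N).1 v.
    have hs : (size c <= (st (k + size c)%N).2)%N.
      exact: leq_trans (leq_addl _ _) (dn _).
    rewrite /v TPsi -(@PsiE (k + size c)%N c) ?(leqW hs) // -act_MX PsiE //.
    by apply: leq_trans (size_polyMleq _ _) _; rewrite size_polyX addn2.
  have h1 := (hq k).1 ((st (k + size c)%N).1 v - (st k).1 v) ((st k).1 v).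
  rewrite subrK in h1; apply: le_trans h1 _.
  have h2 := close (size c); have h3 := hC v.
  have h4 : q 0 v <= q l v by apply: q_le.
  have h5 : 0 <= 2^-1 ^+ size c * q 0 v by rewrite mulr_ge0 ?(ltW (e0 _)) // (q_ge0 hn hq).
  by rewrite mulrDl; lra.
- by move=> x; have [c ->] := Psi_surj x; exists c; rewrite actT.
- by move=> c; rewrite actT => /Psi_inj.
- move=> n; case: (Stepn n) => _ _ _ [_ [m hm h]] _; exists m.
  by rewrite iterT -(uE n.+1).
Qed.

End SchemeLimit.

(** * Translation of the variable *)

Section SizeLowering.
Context {K : numFieldType}.
Variable T : {linear {poly K} -> {poly K}}.
Implicit Types p u v c : {poly K}.
(** On the polynomials of size at most n, T - 1 is a single nilpotent Jordan block, so that every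
    polynomial of size n is a cyclic vector there. Both initial operators on K[X] are of this
    kind. *)
Hypothesis hT : forall p, size (T p - p) = (size p).-1.

Lemma size_lowering_le p : (size (T p) <= size p)%N.
Proof.
rewrite -(subrK p (T p)); apply: leq_trans (size_polyD _ _) _.
by rewrite hT geq_max leq_pred leqnn.
Qed.

Lemma size_act_le u c : (size (act T u c) <= size u)%N.
Proof.
rewrite /act; elim/big_ind: _ => [|p r hp hr|i _]; first by rewrite size_poly0.
  by apply: leq_trans (size_polyD _ _) _; rewrite geq_max hp.
apply: leq_trans (size_scale_leq _ _) _; elim: (nat_of_ord i) => //= j.
exact: leq_trans (size_lowering_le _).
Qed.

Lemma size_act_subX1 u j : size (act T u (('X - 1) ^+ j)) = (size u - j)%N.
Proof.
elim: j => [|j IH]; first by rewrite expr0 act_1 subn0.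
rewrite exprS act_mul linearB /= act_X act_1 hT IH.
by rewrite subnS.
Qed.

Lemma act_subX1_eq0 u j : (size u <= j)%N -> act T u (('X - 1) ^+ j) = 0.
Proof. by move=> h; apply/eqP; rewrite -size_poly_eq0 size_act_subX1 subn_eq0. Qed.

(** The vectors (T - 1)^j u have every size up to that of [u], so leading terms can be cancelled
    successively. *)
Lemma lowering_span u p : (size p <= size u)%N -> exists c, p = act T u c.
Proof.
have [n] := ubnP (size p); elim: n p => // n IH p; rewrite ltnS => hn hp.
have [->|p0] := eqVneq p 0; first by exists 0; rewrite linear0.
pose v := act T u (('X - 1) ^+ (size u - size p)).
have sv : size v = size p by rewrite size_act_subX1 subKn.
have v0 : v != 0 by rewrite -size_poly_eq0 sv size_poly_eq0.
pose r := p - (lead_coef p / lead_coef v) *: v.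
have sr : (size r < size p)%N.
  rewrite -(prednK (n := size p)); last by rewrite lt0n size_poly_eq0.
  rewrite ltnS; apply/leq_sizeP => j; rewrite leq_eqVlt => /orP[/eqP <-|hj].
    rewrite coefB coefZ -{2}sv -!lead_coefE divfK ?subrr //.
    by rewrite lead_coef_eq0.
  have hj' : (size p <= j)%N by move: hj; case: (size p).
  by rewrite coefB coefZ !nth_default ?sv // mulr0 subrr.
have [c hc] := IH r (leq_trans sr hn) (leq_trans (ltnW sr) hp).
exists (c + (lead_coef p / lead_coef v) *: ('X - 1) ^+ (size u - size p)).
by rewrite linearD linearZ /= -hc subrK.
Qed.

(** Write c = (X - 1)^j c' with c'(1) <> 0; the bound on the size of c gives j < size u, so v = (T -
    1)^j u is nonzero. Since c'(T) - c'(1) is a multiple of T - 1, it lowers sizes, and c'(T) v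
    keeps the leading term c'(1) times that of v. *)
Lemma lowering_orbit_free u D : size u = D.+1 -> orbit_free T u D.
Proof.
move=> su c hc; apply: contra_eq => c0.
have [j [c' rc' cE]] := multiplicity_XsubC c 1; rewrite c0 /= in rc'.
have hj : (j < size u)%N.
  rewrite su; apply: leq_trans hc; rewrite cE size_Mmonic ?monicXn //; last first.
  - exact/monic_exp/monicXsubC.
  - by apply: contraNneq rc' => ->; rewrite root0.
  rewrite size_exp_XsubC addnS /= -add1n leq_add2r lt0n size_poly_eq0.
  by apply: contraNneq rc' => ->; rewrite root0.
pose v := act T u (('X - 1) ^+ j).
have sv : size v = (size u - j)%N by exact: size_act_subX1.
have v0 : v != 0 by rewrite -size_poly_eq0 sv -lt0n subn_gt0.
have -> : act T u c = act T v c' by rewrite cE act_mul.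
have [c2 c2E] : exists c2, c' - (c'.[1])%:P = c2 * ('X - 1%:P).
  by apply/factor_theorem; rewrite rootE !hornerE subrr.
apply: contra v0 => /eqP h0.
have : act T v (c'.[1])%:P + act T v (c2 * ('X - 1%:P)) = 0.
  by rewrite -linearD -c2E addrC subrK.
have -> : (c'.[1])%:P = c'.[1] *: 1 :> {poly K} by rewrite alg_polyC.
rewrite linearZ /= act_1 act_mul => /eqP; rewrite addr_eq0 => /eqP hE.
have : (size (c'.[1] *: v) <= (size v).-1)%N.
  rewrite hE size_polyN; apply: leq_trans (size_act_le _ _) _.
  by have := size_act_subX1 v 1; rewrite expr1 => ->; rewrite subn1.
rewrite size_scale; last by rewrite -rootE.
by rewrite -size_poly_eq0; case: (size v) => // k; rewrite ltnn.
Qed.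

End SizeLowering.

Section Translation.
Context {R : realType} {K : numFieldType}.
Variables (nrm : K -> R) (hn : absval nrm).

Definition translation : {linear {poly K} -> {poly K}} := comp_poly ('X + 1).

Lemma iter_translation l (p : {poly K}) : iter l translation p = p \Po ('X + l%:R%:P).
Proof.
elim: l => [|l IH]; first by rewrite mulr0n addr0 comp_polyXr.
rewrite iterS IH /= -comp_polyA comp_polyD comp_polyX comp_polyC -addrA.
by rewrite -[1]/(1%:P) -polyCD -[1]/(1%:R) -natrD add1n.
Qed.

Lemma coef_exp_addX1 i k : (('X + 1 : {poly K}) ^+ i)`_k = 'C(i, k)%:R.
Proof.
rewrite exprD1n coef_sum.
under eq_bigr do rewrite coefMn coefXn.
case: (ltnP k i.+1) => hk.
  rewrite (bigD1 (Ordinal hk)) //= eqxx big1 ?addr0 // => j.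
  by rewrite -val_eqE /= eq_sym => /negbTE ->; rewrite mul0rn.
rewrite bin_small // big1 // => j _.
have -> : (k == j) = false by apply/negbTE; rewrite neq_ltn (leq_trans (ltn_ord j) hk) orbT.
by rewrite mul0rn.
Qed.

(** For p of degree n + 1 the difference has the term (n + 1) (lead_coef p) X^n, which survives in
    characteristic 0. *)
Lemma size_translation p : size (translation p - p) = (size p).-1.
Proof.
have co k : (translation p - p)`_k = \sum_(i < size p | (k < i)%N) p`_i * 'C(i, k)%:R.
  rewrite coefB /= coef_comp_poly.
  have -> : \sum_(i < size p) p`_i * (('X + 1) ^+ i)`_k = \sum_(i < size p) p`_i * 'C(i, k)%:R.
    by apply: eq_bigr => i _; congr (_ * _); exact: coef_exp_addX1.
  have [hk|hk] := ltnP k (size p); last first.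
    rewrite nth_default // subr0 !big1 // => i; last first.
      by move=> _; rewrite bin_small ?mulr0 // (leq_trans (ltn_ord i) hk).
    by rewrite ltnNge (leq_trans (ltnW (ltn_ord i)) hk).
  rewrite (bigID (fun i : 'I_(size p) => (k < i)%N)) /= -addrA -[RHS]addr0; congr (_ + _).
  rewrite (bigD1 (Ordinal hk)) /= ?ltnn // binn mulr1 big1 ?addr0 ?subrr // => i.
  rewrite -leqNgt => /andP[ik]; rewrite -val_eqE /= => ne.
  by rewrite bin_small ?mulr0 // ltn_neqAle ne.
apply/eqP; rewrite eqn_leq; apply/andP; split.
  apply/leq_sizeP => k hk; rewrite co big1 // => i hi.
  by have := ltn_ord i; lia.
case sp: (size p) => [|[|n]] //=.
rewrite ltnNge; apply/negP => /leq_sizeP/(_ n (leqnn n)); rewrite co.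
have hn1 : (n.+1 < size p)%N by rewrite sp.
rewrite (bigD1 (Ordinal hn1)) //= big1 => [|i /andP[ni]]; last first.
  rewrite -val_eqE /= => ne; have h := ltn_ord i.
  by case/negP: ne; rewrite eqn_leq ni -ltnS -sp h.
rewrite addr0 binSn => /eqP; rewrite mulf_eq0 pnatr_eq0 orbF.
have -> : p`_n.+1 = lead_coef p by rewrite lead_coefE sp.
by rewrite lead_coef_eq0 -size_poly_eq0 sp.
Qed.

End Translation.

Section TranslationTransitive.
Context {R : realType} {K : numFieldType}.
Variables (nrm : K -> R) (hn : absval nrm).

Lemma small_nat (C e : R) : 0 < e -> exists m, [/\ (0 < m)%N & C / m%:R <= e].
Proof.
move=> e0; pose m := (Num.truncn (`|C| / e)).+1.
have h : `|C| / e < m%:R by apply: truncnS_gt.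
exists m; split => //; rewrite ler_pdivrMr ?ltr0n //.
rewrite ltr_pdivrMr // in h; have := ler_norm C; lra.
Qed.

Lemma seminorm_comp (V W : lmodType K) (q : W -> R) (f : {linear V -> W}) :
  seminorm nrm q -> seminorm nrm (q \o f).
Proof.
by move=> hq; split=> [x y|a x] /=; rewrite ?linearD ?linearZ ?hq.1 ?hq.2.
Qed.

(** This rescaling carries conditions at 1 to conditions at m, so that one Hermite problem at 0 and
    1 serves all m. *)
Definition dilation (m : nat) (p : {poly K}) : {poly K} := p \Po (m%:R^-1 *: 'X).

(** Every monomial of g_a has degree i >= M > a, so the factor m^-i of the dilation beats the weight
    m^a. An arbitrary seminorm is allowed because the polynomials g_a do not depend on m. *)
Lemma dilation_small (rho : {poly K} -> R) (M : nat) (g : nat -> {poly K}) :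
  seminorm nrm rho -> (forall a i, (i < M)%N -> (g a)`_i = 0) ->
  exists C, forall m, (0 < m)%N ->
    rho (\sum_(a < M) m%:R ^+ a *: dilation m (g a)) <= C / m%:R.
Proof.
move=> hrho hg.
exists (\sum_(a < M) \sum_(i < size (g a)) nrm (g a)`_i * rho 'X^i) => m m0.
apply: le_trans (semi_lincomb hn hrho _ _ _ _) _.
rewrite mulr_suml; apply: ler_sum => a _.
rewrite /dilation comp_polyE.
have mm : 1 <= m%:R :> R by rewrite ler1n.
apply: le_trans (ler_wpM2l (absval_ge0 hn _) (semi_lincomb hn hrho _ _ _ _)) _.
rewrite mulr_sumr mulr_suml; apply: ler_sum => i _.
have [iM|Mi] := ltnP i M.
  by rewrite hg // (absval0 hn) !(mul0r, mulr0).
rewrite exprZn hrho.2 !(absvalX hn) (absvalV hn) (absval_nat hn).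
set A := nrm _; set B := rho 'X^i.
have AB0 : 0 <= A * B by rewrite mulr_ge0 // ?(absval_ge0 hn) ?(semi_ge0 hn hrho).
have -> : m%:R ^+ a * (A * (m%:R^-1 ^+ i * B)) = A * B * (m%:R ^+ a * m%:R^-1 ^+ i) by ring.
have -> : m%:R ^+ a * m%:R^-1 ^+ i = m%:R^-1 * m%:R^-1 ^+ (i - a.+1) :> R.
  rewrite -(subnK (leq_trans (ltn_ord a) Mi)) addnK exprD exprS !mulrA.
  rewrite mulrC !mulrA -exprMn mulVf ?expr1n ?mul1r 1?mulrC //.
  by rewrite pnatr_eq0 -lt0n.
apply: ler_wpM2l => //; rewrite ler_piMr ?invr_ge0 // exprn_ile1 ?invr_ge0 // invf_le1 //.
by rewrite ltr0n.
Qed.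

Lemma Xn_dvd_coef0 (M : nat) (g h : {poly K}) : g = 'X^M * h ->
  forall i, (i < M)%N -> g`_i = 0.
Proof. by move=> -> i hi; rewrite coefXnM hi. Qed.

(* [t] divides [1 - (1 - t) ^+ M], so [bump M t = (1 - (1 - t) ^+ M) ^+ M] is divisible by
   [t ^+ M] and congruent to 1 modulo [(1 - t) ^+ M]: it solves a two-point Hermite problem. *)
Definition bump M (t : {poly K}) : {poly K} := (1 - (1 - t) ^+ M) ^+ M.

Lemma one_sub_dvd M (t : {poly K}) : exists s, 1 - (1 - t) ^+ M = t * s.
Proof.
have -> : 1 - (1 - t) ^+ M = 1 ^+ M - (1 - t) ^+ M by rewrite expr1n.
by rewrite subrXX subKr; eexists.
Qed.

Lemma bump_dvd M : exists s, bump M 'X = 'X^M * s.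
Proof.
have [s hs] := one_sub_dvd M 'X; exists (s ^+ M).
by rewrite /bump hs exprMn.
Qed.

Lemma cobump_dvd M : exists s, (1 - bump M 'X) \Po ('X + 1) = 'X^M * s.
Proof.
have -> : (1 - bump M 'X) \Po ('X + 1) = 1 - (1 - (- 'X) ^+ M) ^+ M.
  rewrite /bump comp_polyB comp_polyC rmorphXn rmorphB rmorphXn rmorphB /=.
  rewrite comp_polyX comp_polyC; congr (1 - (1 - _ ^+ _) ^+ _).
  by rewrite opprD addrCA subrr addr0.
have [s ->] := one_sub_dvd M ((- 'X) ^+ M).
by exists ((-1) ^+ M * s); rewrite (exprNn 'X) mulrA; congr (_ * _); rewrite mulrC.
Qed.

Variables (q : nat -> {poly K} -> R) (hq : forall k, seminorm nrm (q k)).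

(** The perturbation is eta(X / m) (y(X - m) - x) with [eta] the bump, so that the sum with x looks
    like x near 0 and like y(X - m) near m. Expanded in powers of m, this perturbation and the error
    after m translations are sums of m^a times dilations of fixed polynomials divisible by X^M,
    hence O(1 / m). A small multiple of X^L, with L above all other degrees, finally makes the
    vector cyclic up to degree L. *)
Lemma transitive_translation : transitive_ext q true translation.
Proof.
move=> n e x y z D0 e0; rewrite mul1r.
pose M := maxn (size x) (size y).
have polyM (p : {poly K}) : (size p <= M)%N -> p = \sum_(a < M) p`_a *: 'X^a.
  move=> hp; rewrite -{1}(coefK p) poly_def.
  rewrite (big_ord_widen _ (fun i => p`_i *: 'X^i) hp) big_mkcond /=.
  apply: eq_bigr => i _; case: ifP => // /negbT; rewrite -leqNgt => hi.
  by rewrite nth_default // scale0r.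
have sx : (size x <= M)%N by rewrite leq_maxl.
have sy : (size y <= M)%N by rewrite leq_maxr.
pose eta := bump M 'X; pose th := 1 - eta.
pose g (a : nat) := eta * (y`_a *: ('X - 1) ^+ a - x`_a *: 'X^a).
pose g' (a : nat) := (th \Po ('X + 1)) * (x`_a *: ('X + 1) ^+ a - y`_a *: 'X^a).
pose w0 m := \sum_(a < M) m%:R ^+ a *: dilation m (g a).
pose r m := \sum_(a < M) m%:R ^+ a *: dilation m (g' a).
have dilM m p1 p2 : dilation m (p1 * p2) = dilation m p1 * dilation m p2.
  by rewrite /dilation comp_polyM.
have w0E m : (0 < m)%N -> w0 m = dilation m eta * (y \Po ('X - m%:R%:P) - x).
  move=> m0; have mn0 : m%:R != 0 :> K by rewrite pnatr_eq0 -lt0n.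
  rewrite /w0; under eq_bigr do rewrite /g dilM scalerAr.
  rewrite -mulr_sumr; congr (_ * _).
  have -> : y \Po ('X - m%:R%:P) = \sum_(a < M) y`_a *: ('X - m%:R%:P) ^+ a.
    by rewrite {1}(polyM _ sy) linear_sum; apply: eq_bigr => a _; rewrite linearZ /= comp_Xn_poly.
  rewrite [X in _ = _ - X](polyM _ sx) -sumrB.
  apply: eq_bigr => a _; rewrite /dilation comp_polyB !comp_polyZ scalerBr.
  rewrite rmorphXn /= comp_polyB comp_polyX comp_polyC comp_Xn_poly.
  rewrite !scalerA ![_ ^+ a * _]mulrC -!scalerA -!exprZn scalerA divff // scale1r.
  by rewrite scalerBr scalerA divff // scale1r alg_polyC.
have rE m : (0 < m)%N ->
    r m = dilation m (th \Po ('X + 1)) * (x \Po ('X + m%:R%:P) - y).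
  move=> m0; have mn0 : m%:R != 0 :> K by rewrite pnatr_eq0 -lt0n.
  rewrite /r; under eq_bigr do rewrite /g' dilM scalerAr.
  rewrite -mulr_sumr; congr (_ * _).
  have -> : x \Po ('X + m%:R%:P) = \sum_(a < M) x`_a *: ('X + m%:R%:P) ^+ a.
    by rewrite {1}(polyM _ sx) linear_sum; apply: eq_bigr => a _; rewrite linearZ /= comp_Xn_poly.
  rewrite [X in _ = _ - X](polyM _ sy) -sumrB.
  apply: eq_bigr => a _; rewrite /dilation comp_polyB !comp_polyZ scalerBr.
  rewrite rmorphXn /= comp_polyD comp_polyX comp_polyC comp_Xn_poly.
  rewrite !scalerA ![_ ^+ a * _]mulrC -!scalerA -!exprZn scalerA divff // scale1r.
  by rewrite scalerDr scalerA divff // scale1r alg_polyC.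
have key m : (0 < m)%N -> iter m translation (x + w0 m) - y = r m.
  move=> m0; have mn0 : m%:R != 0 :> K by rewrite pnatr_eq0 -lt0n.
  have yE : (y \Po ('X - m%:R%:P)) \Po ('X + m%:R%:P) = y.
    by rewrite -comp_polyA comp_polyB comp_polyX comp_polyC addrK comp_polyXr.
  rewrite iter_translation w0E // rE // comp_polyD comp_polyM.
  rewrite (comp_polyB (y \Po _)) yE.
  have -> : dilation m (th \Po ('X + 1)) = 1 - (dilation m eta \Po ('X + m%:R%:P)).
    rewrite /dilation -!comp_polyA.
    have -> : ('X + 1) \Po (m%:R^-1 *: 'X) = m%:R^-1 *: 'X + 1 :> {poly K}.
      by rewrite comp_polyD comp_polyX comp_polyC.
    have -> : (m%:R^-1 *: 'X) \Po ('X + m%:R%:P) = m%:R^-1 *: 'X + 1 :> {poly K}.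
      by rewrite comp_polyZ comp_polyX scalerDr -[_ *: m%:R%:P]mul_polyC -polyCM mulVf.
    by rewrite /th comp_polyB comp_polyC.
  set A := x \Po _; set B := _ \Po _; ring.
have [sg hsg] := bump_dvd M; have [sg' hsg'] := cobump_dvd M.
have hg a i : (i < M)%N -> (g a)`_i = 0.
  by apply: (@Xn_dvd_coef0 _ _ (sg * (y`_a *: ('X - 1) ^+ a - x`_a *: 'X^a))); rewrite mulrA -hsg.
have hg' a i : (i < M)%N -> (g' a)`_i = 0.
  by apply: (@Xn_dvd_coef0 _ _ (sg' * (x`_a *: ('X + 1) ^+ a - y`_a *: 'X^a))); rewrite mulrA -hsg'.
have semil l k := @seminorm_comp _ _ _ (iter l translation) (hq k).
have [Cl hCl] := choice (fun l => dilation_small (semil l n) hg).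
have [Cr hCr] := dilation_small (hq n) hg'.
have [m [m0 hm]] := small_nat (`|Cr| + \sum_(l < n.+1) `|Cl l|) (divr_gt0 e0 (ltr0n R 2)).
have mpos : 0 < m%:R :> R by rewrite ltr0n.
have sumCl0 : 0 <= \sum_(l < n.+1) `|Cl l| by apply: sumr_ge0.
have hw0 l : (l <= n)%N -> q n (iter l translation (w0 m)) <= e / 2.
  move=> ln; apply: le_trans (hCl l m m0) _; apply: le_trans hm.
  rewrite ler_pM2r ?invr_gt0 // (bigD1 (Ordinal (ln : (l < n.+1)%N))) //=.
  have := ler_norm (Cl l); have := normr_ge0 Cr.
  have : 0 <= \sum_(i < n.+1 | i != Ordinal (ln : (l < n.+1)%N)) `|Cl i| by apply: sumr_ge0.
  lra.
have hr : q n (r m) <= e / 2.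
  apply: le_trans (hCr m m0) _; apply: le_trans hm.
  by rewrite ler_pM2r ?invr_gt0 //; have := ler_norm Cr; lra.
pose L := maxn (maxn m D0) (maxn (maxn (size x) (size z)) (size (x + w0 m))).
pose P := 'X^L : {poly K}.
pose B := q n (iter m translation P) + \sum_(l < n.+1) q n (iter l translation P).
have [N [N0 hN]] := small_nat B (divr_gt0 e0 (ltr0n R 2)).
have Npos : 0 < N%:R :> R by rewrite ltr0n.
have semi_ge v := semi_ge0 hn (hq n) v.
have hdelta v : q n v <= B -> q n (N%:R^-1 *: v) <= e / 2.
  move=> hv; rewrite (hq n).2 (absvalV hn) (absval_nat hn) mulrC.
  by apply: le_trans hN; rewrite ler_pM2r ?invr_gt0.
have hiter l v w : iter l translation (v + N%:R^-1 *: w)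
    = iter l translation v + N%:R^-1 *: iter l translation w.
  by rewrite linearD linearZ.
have sxw : size (x + (w0 m + N%:R^-1 *: P)) = L.+1.
  have sP : size (N%:R^-1 *: P) = L.+1.
    by rewrite size_scale ?size_polyXn // invr_eq0 pnatr_eq0 -lt0n.
  by rewrite addrA addrC size_polyDl sP // ltnS !leq_max leqnn !orbT.
exists (w0 m + N%:R^-1 *: P), m, L; split.
- move=> l ln; rewrite hiter; apply: le_trans ((hq n).1 _ _) _.
  have : q n (N%:R^-1 *: iter l translation P) <= e / 2.
    apply: hdelta; rewrite /B (bigD1 (Ordinal (ln : (l < n.+1)%N))) //=.
    have := semi_ge (iter m translation P).
    have : 0 <= \sum_(i < n.+1 | i != Ordinal (ln : (l < n.+1)%N)) q n (iter i translation P).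
      by apply: sumr_ge0.
    lra.
  have := hw0 l ln; lra.
- rewrite addrA hiter addrAC key //; apply: le_trans ((hq n).1 _ _) _.
  have : q n (N%:R^-1 *: iter m translation P) <= e / 2.
    apply: hdelta; rewrite /B lerDl; exact: sumr_ge0.
  lra.
- by rewrite !leq_max !leqnn orbT.
- split; first exact: (lowering_orbit_free size_translation sxw).
  by apply: (act_subX1_eq0 size_translation); rewrite sxw.
- split; apply: (lowering_span size_translation); rewrite sxw leqW //;
    by rewrite !leq_max leqnn !orbT.
Qed.

End TranslationTransitive.

(** * The operator p + (p - p(0)) / X *)

Section Descent.
Context {R : realType} {K : numFieldType}.
Variables (nrm : K -> R) (hn : absval nrm).

Definition descent : {linear {poly K} -> {poly K}} := idfun \+ drop_poly 1.

Lemma descentE p : descent p = p + drop_poly 1 p. Proof. by []. Qed.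

Lemma size_descent p : size (descent p - p) = (size p).-1.
Proof. by rewrite descentE addrAC subrr add0r size_drop_poly subn1. Qed.

(** As long as no constant term is discarded the operator is multiplication by 1 + X^-1. *)
Lemma iter_descent_XnM l M (g : {poly K}) : (l <= M)%N ->
  iter l descent ('X^M * g) = 'X^(M - l) * (('X + 1) ^+ l * g).
Proof.
elim: l => [|l IH] lM; first by rewrite subn0 expr0 mul1r.
rewrite iterS IH ?(ltnW lM) // descentE.
have -> : (M - l)%N = (M - l.+1).+1 by rewrite subnSK.
rewrite exprS [X in drop_poly 1 X](_ : _ =
  ('X^(M - l.+1) * (('X + 1) ^+ l * g)) * 'X^1); last by rewrite expr1; ring.
by rewrite drop_polyMXn_id exprS; ring.
Qed.

Variables (q : nat -> {poly K} -> R) (hq : forall k, seminorm nrm (q k)).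
Hypothesis (hmono : forall k x, q k x <= q k.+1 x).
Hypothesis hwindow : forall n, exists2 M, (n <= M)%N &
  forall j, (M - n <= j <= M.*2)%N -> q n 'X^j = 0.

(** The perturbation is w = X^M (X^M + g) with g of size at most M. Its iterates up to n have their
    degrees in [M - n, 2 M], where [q n] vanishes. Its M-th iterate is (X + 1)^M (X^M + g), and g
    makes it agree with y - T^M x modulo X^M; the remainder again lies in the window. The term X^M
    gives w the exact degree 2 M. *)
Lemma transitive_descent : transitive_ext q false descent.
Proof.
move=> n e x y z D0 e0; rewrite mul0r.
pose n' := maxn (maxn n D0) (maxn (size x) (maxn (size y) (size z))).
have [M nM hM'] := hwindow n'.
have [hn1 hD0 sx sy sz] : [/\ (n <= M)%N, (D0 <= M)%N, (size x <= M)%N,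
    (size y <= M)%N & (size z <= M)%N].
  by split; apply: leq_trans nM; rewrite !leq_max leqnn ?orbT.
have hM j : (M - n <= j <= M.*2)%N -> q n 'X^j = 0.
  move=> hj; apply/eqP; rewrite eq_le (semi_ge0 hn (hq n)) andbT.
  rewrite -(hM' j); first by apply: (q_le hmono); rewrite !leq_max leqnn.
  by move: hj; lia.
have zero a (g : {poly K}) : (M - n <= a)%N -> (a + size g <= M.*2.+1)%N ->
    q n ('X^a * g) = 0.
  move=> ha hg; apply/eqP; rewrite eq_le (semi_ge0 hn (hq n)) andbT.
  rewrite -{1}(coefK g) poly_def mulr_sumr.
  apply: (le_trans (semi_sum hn (hq n) _ _ _)).
  rewrite big1 // => i _; rewrite -scalerAr -exprD (hq n).2 hM ?mulr0 //.
  by have := ltn_ord i; lia.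
(* [s] inverts t = (X + 1)^M modulo X^M: the product t s is 1 - (1 - t)^M, and X divides 1 - t. *)
have [s hs] := one_sub_dvd M (('X + 1 : {poly K}) ^+ M).
have [k hk] := one_sub_dvd M (- 'X : {poly K}).
pose t := ('X + 1 : {poly K}) ^+ M.
have tE : 1 - t = - 'X * k by rewrite -hk opprK /t [1 + 'X]addrC.
pose d := y - iter M descent x.
pose g := take_poly M (s * d).
have [h hE] : exists h, t * ('X^M + g) - d = 'X^M * h.
  exists (t - (- k) ^+ M * d - t * drop_poly M (s * d)).
  have e1 : s * d = g + drop_poly M (s * d) * 'X^M by rewrite poly_take_drop.
  have e2 : t * s = 1 - 'X^M * (- k) ^+ M.
    by rewrite -hs -exprMn -/t tE mulNr mulrN.
  have e3 : t * g = (1 - 'X^M * (- k) ^+ M) * d - t * (drop_poly M (s * d) * 'X^M).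
    have e4 : t * (s * d) = t * g + t * (drop_poly M (s * d) * 'X^M).
      by rewrite -mulrDr -e1.
    by rewrite mulrA e2 in e4; rewrite e4 addrK.
  rewrite mulrDr e3; ring.
have siter l p : (size (iter l descent p) <= size p)%N.
  by elim: l => //= l; apply: leq_trans (size_lowering_le size_descent _).
have sX1 l : size (('X + 1 : {poly K}) ^+ l) = l.+1.
  by have := size_exp_XsubC l (-1 : K); rewrite polyCN opprK.
have sXg : size ('X^M + g) = M.+1.
  by rewrite size_polyDl size_polyXn // ltnS size_take_poly.
have st : (size (t * ('X^M + g))%R <= M.*2.+1)%N.
  apply: leq_trans (size_polyMleq _ _) _; rewrite sX1 sXg; lia.
have M2 : (M <= M.*2.+1)%N by lia.
have sh : (M + size h <= M.*2.+1)%N.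
  have [->|h0] := eqVneq h 0; first by rewrite size_poly0; lia.
  have <- : size ('X^M * h)%R = (M + size h)%N.
    rewrite mulrC size_mulXn // addnC //.
  rewrite -hE; apply: leq_trans (size_polyD _ _) _; rewrite size_polyN geq_max st /=.
  rewrite /d; apply: leq_trans (size_polyD _ _) _; rewrite size_polyN geq_max.
  apply/andP; split; first exact: leq_trans sy M2.
  exact: leq_trans (siter _ _) (leq_trans sx M2).
pose w := 'X^M * ('X^M + g).
have sw : size w = M.*2.+1.
  rewrite /w mulrC size_mulXn ?sXg; first by lia.
  by rewrite -size_poly_eq0 sXg.
have sxw : size (x + w) = M.*2.+1 by rewrite addrC size_polyDl sw // ltnS; lia.
exists w, M, M.*2; split.
- move=> l ln; rewrite iter_descent_XnM ?(leq_trans ln) // zero //; first by lia.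
  have : (size (('X + 1) ^+ l * ('X^M + g))%R <= l.+1 + M.+1 .-1)%N.
    by apply: leq_trans (size_polyMleq _ _) _; rewrite sX1 sXg addnS.
  by move: ln hn1; lia.
- have -> : iter M descent (x + w) - y = 'X^M * h.
    rewrite -hE linearD /= iter_descent_XnM // subnn expr0 mul1r /d /t; ring.
  by rewrite zero ?(ltW e0) //; lia.
- by apply/andP; split; lia.
- split; first exact: (lowering_orbit_free size_descent sxw).
  by apply: (act_subX1_eq0 size_descent); rewrite sxw.
- split; apply: (lowering_span size_descent); rewrite sxw.
    exact: leq_trans sx M2.
  exact: leq_trans sz M2.
Qed.

End Descent.

(** * Dense ideals *)

Section DenseIdeals.
Context {R : realType} {F : fieldType}.
Variables (nrm : F -> R) (rho : nat -> {poly F} -> R) (B : R).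
Hypotheses (hB : 0 < B) (nrm0 : nrm 0 = 0) (nrm_ge0 : forall c, 0 <= nrm c).
Hypothesis rho_ge0 : forall k p, 0 <= rho k p.
Hypothesis rhoD : forall k p r, rho k (p + r) <= rho k p + rho k r.
Hypothesis rhoZ : forall k c p, rho k (c *: p) <= B * nrm c * rho k p.
Hypothesis rhoX : forall k, exists l C, forall p, rho k ('X * p) <= C * rho l p.

(** Density of the ideal generated by [p], tested on the constant 1 because multiplication is
    continuous. Homogeneity is assumed up to the factor [B] only, to cover the complexification of
    real seminorms. *)
Definition dense_ideal (p : {poly F}) : Prop :=
  forall k e, 0 < e -> exists r, rho k (p * r - 1) <= e.

Lemma rho_at0 k : rho k 0 = 0.
Proof.
apply/eqP; rewrite eq_le rho_ge0 andbT.
by have := rhoZ k 0 0; rewrite scale0r nrm0 mulr0 mul0r.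
Qed.

Lemma rho_mul (p : {poly F}) k : exists ls : seq nat, exists2 C, 0 < C &
  forall r, rho k (p * r) <= C * \sum_(l <- ls) rho l r.
Proof.
elim/poly_ind: p k => [|p c IH] k.
  by exists [::], 1 => // r; rewrite mul0r rho_at0 big_nil mulr0.
have [l [C hC]] := rhoX k; have [ls [D D0 hD]] := IH l.
pose C1 := `|C| + 1; have C10 : 0 < C1 by have := normr_ge0 C; rewrite /C1; lra.
pose c1 := B * nrm c; have c10 : 0 <= c1 by rewrite mulr_ge0 // ltW.
have P0 : 0 <= C1 * D by rewrite mulr_ge0 // ltW.
exists (k :: ls), (C1 * D + c1 + 1); first by lra.
move=> r; rewrite mulrDl [p * 'X]mulrC -mulrA mul_polyC big_cons.
have S0 : 0 <= \sum_(j <- ls) rho j r by apply: sumr_ge0.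
apply: le_trans (rhoD _ _ _) _.
have h1 : rho k ('X * (p * r)) <= C1 * (D * \sum_(j <- ls) rho j r).
  apply: le_trans (hC _) _; apply: (@le_trans _ _ (C1 * rho l (p * r))).
    by apply: ler_wpM2r => //; rewrite /C1; have := ler_norm C; lra.
  by rewrite ler_pM2l.
have h2 := rhoZ k c r.
have h3 : 0 <= (C1 * D + 1) * rho k r by rewrite mulr_ge0 //; lra.
have h4 : 0 <= (c1 + 1) * \sum_(j <- ls) rho j r by rewrite mulr_ge0 //; lra.
rewrite -/c1 in h2; lra.
Qed.

Lemma dense_ideal_const (c : F) : c != 0 -> dense_ideal c%:P.
Proof.
move=> c0 k e e0; exists (c^-1)%:P.
by rewrite -polyCM divff // subrr rho_at0 ltW.
Qed.

Hypothesis rho_mono : forall k p, rho k p <= rho k.+1 p.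

Lemma rho_le k l p : (k <= l)%N -> rho k p <= rho l p.
Proof.
elim: l => [|l IH]; first by rewrite leqn0 => /eqP ->.
rewrite leq_eqVlt => /orP[/eqP -> //|]; rewrite ltnS => /IH h.
exact: le_trans h (rho_mono _ _).
Qed.

(** [r'] is chosen before [p']: it fixes the multiplier P = r r', whose continuity tells how close p
    p' must come to 1. *)
Lemma dense_idealM p r : dense_ideal p -> dense_ideal r -> dense_ideal (p * r).
Proof.
move=> hp hr k e e0; have e20 : 0 < e / 2 by lra.
have [r' hr'] := hr k _ e20; pose P := r * r'.
have [ls [C C0 hC]] := rho_mul P k.
pose N := (size ls)%:R + 1 : R; have N0 : 0 < N by rewrite ltr_wpDl.
pose L := \max_(l <- ls) l.
have [p' hp'] := hp L (e / 2 / (C * N)) (divr_gt0 e20 (mulr_gt0 C0 N0)).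
exists (p' * r').
have -> : p * r * (p' * r') - 1 = P * (p * p' - 1) + (P - 1) by rewrite /P; ring.
apply: le_trans (rhoD _ _ _) _.
suff : rho k (P * (p * p' - 1)) <= e / 2 by rewrite /P; lra.
apply: le_trans (hC _) _.
have : \sum_(l <- ls) rho l (p * p' - 1) <= \sum_(l <- ls) (e / 2 / (C * N)).
  rewrite big_seq [leRHS]big_seq; apply: ler_sum => l hl.
  apply: le_trans hp'; apply: rho_le.
  by rewrite /L (big_rem l) //= leq_maxl.
rewrite big_const_seq count_predT iter_addr_0 => h.
apply: le_trans (ler_wpM2l (ltW C0) h) _.
have -> : C * (e / 2 / (C * N) *+ size ls) = e / 2 * ((size ls)%:R / N).
  by rewrite -mulr_natr; field; rewrite !lt0r_neq0.
rewrite -[leRHS]mulr1; apply: ler_wpM2l; first exact: ltW.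
by rewrite ler_pdivrMr // mul1r /N; lra.
Qed.

Hypothesis nrmV : forall c, nrm c^-1 = (nrm c)^-1.
Hypothesis nrmX : forall c m, nrm (c ^+ m) = nrm c ^+ m.
Hypothesis nrm2 : forall c, nrm c <= 1 -> 1 <= nrm (2 - c).
Hypothesis nrmN : forall c, nrm (- c) = nrm c.
Hypothesis approx0 : forall k e, 0 < e -> exists m, rho k 'X^m <= e.
Hypothesis approx2 : forall k e, 0 < e -> exists m, rho k ('X^m - 2%:P) <= e.

(* Both constants 2 and 0 are limits of powers of X; whichever is separated from the powers of
   [lambda] makes [('X^m - lambda ^+ m) / (c - lambda ^+ m)] close to 1. *)
Lemma dense_ideal_XsubC (lambda : F) : dense_ideal ('X - lambda%:P).
Proof.
have main c k e m : 0 < e -> 1 <= nrm (c - lambda ^+ m) ->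
    rho k ('X^m - c%:P) <= e / B -> exists r, rho k (('X - lambda%:P) * r - 1) <= e.
  move=> e0 h1 h2; set d := c - lambda ^+ m in h1.
  have d0 : d != 0 by apply: contraTneq h1 => ->; rewrite nrm0 ler10.
  exists (d^-1 *: \sum_(i < m) 'X^(m.-1 - i) * lambda%:P ^+ i).
  rewrite -scalerAr -subrXX -polyC_exp.
  have -> : d^-1 *: ('X^m - (lambda ^+ m)%:P) - 1 = d^-1 *: ('X^m - c%:P).
    rewrite -[1](scalerK d0) -scalerBr; congr (_ *: _).
    by rewrite alg_polyC /d polyCB opprB addrA subrK.
  apply: le_trans (rhoZ _ _ _) _; rewrite nrmV.
  have i1 : (nrm d)^-1 <= 1 by rewrite invf_le1 //; lra.
  apply: (@le_trans _ _ (B * 1 * (e / B))).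
    apply: ler_pM => //; first by rewrite mulr_ge0 ?invr_ge0 // ltW.
    by rewrite ler_pM2l.
  by rewrite mulr1 mulrCA divff ?mulr1 // lt0r_neq0.
move=> k e e0; have eB : 0 < e / B by apply: divr_gt0.
have [hl|hl] := lerP (nrm lambda) 1.
  have [m hm] := approx2 k eB; apply: (main 2 k e m) => //.
  by apply: nrm2; rewrite nrmX exprn_ile1.
have [m hm] := approx0 k eB; apply: (main 0 k e m); rewrite ?subr0 //.
by rewrite sub0r nrmN nrmX exprn_ege1 // ltW.
Qed.

End DenseIdeals.

Section ClosedDense.
Context {R : realType} {F : closedFieldType}.
Variables (nrm : F -> R) (rho : nat -> {poly F} -> R) (B : R).

Lemma dense_ideal_closed :
  0 < B -> nrm 0 = 0 -> (forall c, 0 <= nrm c) ->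
  (forall k p, 0 <= rho k p) ->
  (forall k p r, rho k (p + r) <= rho k p + rho k r) ->
  (forall k c p, rho k (c *: p) <= B * nrm c * rho k p) ->
  (forall k, exists l C, forall p, rho k ('X * p) <= C * rho l p) ->
  (forall k p, rho k p <= rho k.+1 p) ->
  (forall c, nrm c^-1 = (nrm c)^-1) ->
  (forall c m, nrm (c ^+ m) = nrm c ^+ m) ->
  (forall c, nrm c <= 1 -> 1 <= nrm (2 - c)) ->
  (forall c, nrm (- c) = nrm c) ->
  (forall k e, 0 < e -> exists m, rho k 'X^m <= e) ->
  (forall k e, 0 < e -> exists m, rho k ('X^m - 2%:P) <= e) ->
  forall p, p != 0 -> dense_ideal rho p.
Proof.
move=> h1 h2 h3 h4 h5 h6 h7 h8 h9 h10 h11 h12 h13 h14 p p0.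
have [s ->] := closed_field_poly_normal p.
rewrite -mul_polyC; apply: (dense_idealM h1 h2 h3 h4 h5 h6 h7 h8).
  by apply: (dense_ideal_const h2 h4 h6); rewrite lead_coef_eq0.
elim: s => [|z s IH].
  by rewrite big_nil; apply: (dense_ideal_const h2 h4 h6); exact: oner_neq0.
rewrite big_cons; apply: (dense_idealM h1 h2 h3 h4 h5 h6 h7 h8) => //.
by apply: (@dense_ideal_XsubC _ _ nrm rho B).
Qed.

End ClosedDense.

(** * From one dense orbit to the orbits of all nonzero polynomials in the operator *)

Section Criterion.
Context {R : realType} {K : numFieldType}.
Variables (nrm : K -> R) (hn : absval nrm).

(** Isolated as a property of the scalars: it comes from factorization over C, from complexification
    over R, and is used uniformly afterwards. *)
Definition dense_ideals : Prop := forall q : nat -> {poly K} -> R,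
  (forall k, seminorm nrm (q k)) -> (forall k p, q k p <= q k.+1 p) ->
  (forall k, exists l C, forall p, q k ('X * p) <= C * q l p) ->
  (forall k e, 0 < e -> exists m, q k 'X^m <= e) ->
  (forall k e, 0 < e -> exists m, q k ('X^m - 2%:P) <= e) ->
  forall p, p != 0 -> dense_ideal q p.

Variables (V : lmodType K) (q : nat -> V -> R) (hq : forall k, seminorm nrm (q k)).
Hypothesis (hmono : forall k x, q k x <= q k.+1 x).

Lemma qcont_add (f g : V -> V) : qcont q f -> qcont q g -> qcont q (fun v => f v + g v).
Proof.
move=> /(qcontP hn hq hmono) hf /(qcontP hn hq hmono) hg k.
have [l [C [C0 _ hC]]] := hf k; have [l' [C' [C'0 _ hC']]] := hg k.
exists (maxn l l'), (C + C') => x; apply: le_trans ((hq k).1 _ _) _.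
have h1 : q l x <= q (maxn l l') x by apply: (q_le hmono); rewrite leq_maxl.
have h2 : q l' x <= q (maxn l l') x by apply: (q_le hmono); rewrite leq_maxr.
rewrite mulrDl; apply: lerD.
  by apply: le_trans (hC x) _; rewrite ler_pM2l.
by apply: le_trans (hC' x) _; rewrite ler_pM2l.
Qed.

Lemma qcont_scale (c : K) : qcont q ( *:%R c).
Proof. by move=> k; exists k, (nrm c) => x; rewrite (hq k).2. Qed.

Lemma qcont_act (T : {linear V -> V}) (c : {poly K}) :
  qcont q T -> qcont q (fun v => act T v c).
Proof.
move=> hT; elim/poly_ind: c => [|c a IH].
  by move=> k; exists k, 0 => x; rewrite linear0 (semi0 hn (hq k)) mul0r.
have -> : (fun v => act T v (c * 'X + a%:P)) = (fun v => T (act T v c) + a *: v).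
  by apply: funext => v; rewrite linearD /= act_MX -alg_polyC linearZ /= act_1.
apply: qcont_add; last exact: qcont_scale.
exact: (qcont_comp hn hq hmono hT IH).
Qed.

Lemma act_linear_vec (T : {linear V -> V}) (c : {poly K}) : linear (fun v => act T v c).
Proof.
move=> a v w; rewrite /act scaler_sumr -big_split /=; apply: eq_bigr => i _.
by rewrite linearP scalerDr !scalerA mulrC.
Qed.

Definition hypercyclic (T : V -> V) (u : V) : Prop :=
  forall y k e, 0 < e -> exists m, q k (iter m T u - y) <= e.

Hypothesis hdense : dense_ideals.

(** Choose m1 with T^m1 u near y, then r with c r near 1, then m with T^m u near r(T) T^m1 u. Then
    T^m c(T) u is near (c r)(T) T^m1 u, hence near T^m1 u. In this order the continuity of T^m1 and
    of c(T) fixes the last two tolerances. *)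
Lemma hypercyclic_act (T : {linear V -> V}) (u : V) (c : {poly K}) :
  qcont q T -> hypercyclic T u -> c != 0 -> hypercyclic T (act T u c).
Proof.
move=> hT hu c0 y k e e0.
have e30 : 0 < e / 3 by lra.
have [m1 hm1] := hu y k (e / 3) e30.
have cT1 : qcont q (fun v => act T v 'X^m1) := qcont_act 'X^m1 hT.
have [l1 [C1 [C10 _ hC1]]] := qcontP hn hq hmono cT1 k.
have [l2 [C2 [C20 _ hC2]]] := qcontP hn hq hmono (qcont_act c hT) k.
have [r hr] : exists r, q l1 (act T u (c * r - 1)) <= e / 3 / C1.
  apply: (@hdense (fun k p => q k (act T u p))) => //; last exact: divr_gt0.
  - by move=> j; exact: (@seminorm_comp _ _ _ _ _ _ (act T u) (hq j)).
  - by move=> j; have [l [C hC]] := hT j; exists l, C => p; rewrite act_XM.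
  - move=> j d d0; have [m hm] := hu 0 j d d0; exists m.
    by rewrite act_Xn -[iter _ _ _]subr0.
  - move=> j d d0; have [m hm] := hu (act T u 2%:P) j d d0; exists m.
    by rewrite linearB /= act_Xn.
have [m hm] := hu (act T u (r * 'X^m1)) l2 (e / 3 / C2) (divr_gt0 e30 C20).
exists m.
have swap a b' : act T (act T u a) b' = act T u (a * b') by rewrite mulrC act_mul.
have -> : iter m T (act T u c) - y
    = act T (iter m T u - act T u (r * 'X^m1)) c
      + (act T (act T u (c * r - 1)) 'X^m1 + (iter m1 T u - y)).
  have e1 : act T (iter m T u - act T u (r * 'X^m1)) c
      = act T u (c * 'X^m) - act T u (c * r * 'X^m1).
    have lB v w : act T (v - w) c = act T v c - act T w c.
      by rewrite -[LHS]/(mk_linear (act_linear_vec T c) (v - w)) linearB.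
    by rewrite lB -act_Xn !swap; congr (act T u _ - act T u _); ring.
  rewrite e1 swap mulrBl mul1r linearB /= act_Xn -{1}(act_Xn T (act T u c)) swap.
  by rewrite !addrA !subrK.
apply: le_trans ((hq k).1 _ _) _.
have h1 : q k (act T (iter m T u - act T u (r * 'X^m1)) c) <= e / 3.
  apply: le_trans (hC2 _) _; rewrite mulrC -ler_pdivlMr //.
have h2 : q k (act T (act T u (c * r - 1)) 'X^m1) <= e / 3.
  apply: le_trans (hC1 _) _; rewrite mulrC -ler_pdivlMr //.
have := (hq k).1 (act T (act T u (c * r - 1)) 'X^m1) (iter m1 T u - y).
lra.
Qed.

End Criterion.

(** * The scalar fields R and C *)

Section RealHahnBanach.
Context {R : realType}.
Variable Q : {poly R} -> R.
Hypothesis QD : forall f g : {poly R}, Q (f + g) <= Q f + Q g.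
Hypothesis QZ : forall (t : R) (f : {poly R}), 0 <= t -> Q (t *: f) = t * Q f.

Let L n (al : nat -> R) (f : {poly R}) := \sum_(j < n) f`_j * al j.

Let LD n al f g : L n al (f + g) = L n al f + L n al g.
Proof. by rewrite /L -big_split; apply: eq_bigr => j _; rewrite coefD mulrDl. Qed.

Let LZ n al t f : L n al (t *: f) = t * L n al f.
Proof. by rewrite /L mulr_sumr; apply: eq_bigr => j _; rewrite coefZ mulrA. Qed.

Let Dom n al := forall f : {poly R}, (size f <= n)%N -> L n al f <= Q f.

(** One step of Hahn-Banach: the value at X^n is the supremum of the lower bounds, each of which is
    below all upper bounds by subadditivity ([cross]). In countable dimension, iterating over the
    degree replaces Zorn's lemma. *)
Local Lemma dominated_extension n al : Dom n al ->
  exists a, Dom n.+1 (fun j => if j == n then a else al j).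
Proof.
move=> hD.
pose S := [set s | exists2 g : {poly R}, (size g <= n)%N & s = L n al g - Q (g - 'X^n)].
have cross (g g' : {poly R}) : (size g <= n)%N -> (size g' <= n)%N ->
    L n al g - Q (g - 'X^n) <= Q (g' + 'X^n) - L n al g'.
  move=> hg hg'.
  have h1 : L n al (g + g') <= Q (g + g').
    by apply: hD; apply: leq_trans (size_polyD _ _) _; rewrite geq_max hg.
  have h2 := QD (g - 'X^n) (g' + 'X^n).
  rewrite addrACA addNr addr0 in h2; rewrite LD in h1; lra.
have s0 : (size (0%R : {poly R}) <= n)%N by rewrite size_poly0.
have S0 : S !=set0 by exists (L n al 0 - Q (0 - 'X^n)), 0.
have Sub (g' : {poly R}) : (size g' <= n)%N -> ubound S (Q (g' + 'X^n) - L n al g').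
  by move=> hg' _ [g hg ->]; exact: cross.
have Ssup : has_sup S by split => //; exists (Q (0 + 'X^n) - L n al 0); exact: Sub.
exists (sup S) => f hf; rewrite /L big_ord_recr /= eqxx.
have -> : \sum_(i < n) f`_i * (if (i : nat) == n then sup S else al i) = L n al f.
  by apply: eq_bigr => i _; rewrite ltn_eqF.
pose g := take_poly n f; pose c := f`_n.
have sg : (size g <= n)%N by exact: size_take_poly.
have fE : f = g + c *: 'X^n.
  apply/polyP => j; rewrite coefD coefZ coefXn coef_take_poly.
  case: (ltngtP j n) => [jn|nj|->]; rewrite ?mulr0 ?addr0 ?mulr1 ?add0r //.
  by rewrite nth_default // (leq_trans hf).
have LE : L n al f = L n al g.
  by apply: eq_bigr => j _; rewrite coef_take_poly ltn_ord.
rewrite LE -/c {1}fE; case: (ltrgtP c 0) => [c0|c0|->].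
- pose t := - c; have t0 : 0 < t by rewrite oppr_gt0.
  have sg' : (size (t^-1 *: g) <= n)%N by apply: leq_trans (size_scale_leq _ _) sg.
  have h : L n al (t^-1 *: g) - Q (t^-1 *: g - 'X^n) <= sup S.
    by apply: sup_upper_bound => //; exists (t^-1 *: g).
  have -> : g + c *: 'X^n = t *: (t^-1 *: g - 'X^n).
    by rewrite scalerBr scalerA divff ?lt0r_neq0 // scale1r /t scaleNr opprK.
  rewrite QZ ?(ltW t0) // LZ in h *.
  have := ler_wpM2l (ltW t0) h; rewrite mulrBr mulrA divff ?lt0r_neq0 // mul1r.
  by rewrite /t; lra.
- have sg' : (size (c^-1 *: g) <= n)%N by apply: leq_trans (size_scale_leq _ _) sg.
  have h : sup S <= Q (c^-1 *: g + 'X^n) - L n al (c^-1 *: g).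
    by apply: ge_sup => //; exact: Sub.
  have -> : g + c *: 'X^n = c *: (c^-1 *: g + 'X^n).
    by rewrite scalerDr scalerA divff ?lt0r_neq0 // scale1r.
  rewrite QZ ?(ltW c0) // LZ in h *.
  have := ler_wpM2l (ltW c0) h; rewrite mulrBr mulrA divff ?lt0r_neq0 // mul1r.
  by lra.
- by rewrite mul0r scale0r !addr0; exact: hD.
Qed.

Lemma real_hahn_banach : exists phi : {scalar {poly R}},
  (forall f, phi f <= Q f) /\ phi 1 = Q 1.
Proof.
have Q0 : Q 0 = 0 by have := QZ 0 (lexx 0); rewrite scale0r mul0r.
pose al0 (j : nat) := Q 1.
have D1 : Dom 1 al0.
  move=> f hf; rewrite (size1_polyC hf) /L big_ord1 coefC eqxx.
  have -> : (f`_0)%:P = f`_0 *: 1 :> {poly R} by rewrite alg_polyC.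
  case: (lerP 0 f`_0) => [h|h]; first by rewrite QZ.
  have := QD (f`_0 *: 1) (- f`_0 *: 1).
  rewrite -scalerDl subrr scale0r Q0 [Q (- _ *: _)]QZ; last by rewrite oppr_ge0 ltW.
  by rewrite /al0 => h1; lra.
have hex (p : nat * (nat -> R)) : exists a,
    Dom p.1 p.2 -> Dom p.1.+1 (fun j => if j == p.1 then a else p.2 j).
  case: (pselect (Dom p.1 p.2)) => [/dominated_extension[a ha]|hN]; first by exists a.
  by exists 0 => /hN.
have [ext hext] := choice hex.
pose st := fix st n := if n is m.+1 then
  (fun j => if j == n then ext (n, st m) else st m j) else al0.
have Dst n : Dom n.+1 (st n) by elim: n => //= n IH; exact: (hext (n.+1, st n)).
have stable n j k : (j <= n)%N -> st (n + k)%N j = st n j.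
  move=> hj; elim: k => [|k IH]; rewrite ?addn0 // addnS /= -IH.
  by have -> : (j == (n + k).+1) = false by apply/negbTE; lia.
pose al j := st j j.
have alE n j : (j <= n)%N -> st n j = al j.
  by move=> hj; rewrite /al -(subnKC hj) stable.
have LinE (f : {poly R}) n : (size f <= n)%N ->
    \sum_(j < size f) f`_j * al j = \sum_(j < n) f`_j * al j.
  move=> h; rewrite (big_ord_widen _ (fun i => f`_i * al i) h) big_mkcond /=.
  apply: eq_bigr => i _; case: ifP => // /negbT; rewrite -leqNgt => hi.
  by rewrite nth_default // mul0r.
have lin : scalar (fun f : {poly R} => \sum_(j < size f) f`_j * al j).
  move=> a f g; set n := maxn (size f) (size g).
  have hs : (size (a *: f + g)%R <= n)%N.
    apply: leq_trans (size_polyD _ _) _; rewrite geq_max; apply/andP; split.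
      exact: leq_trans (size_scale_leq _ _) (leq_maxl _ _).
    exact: leq_maxr.
  rewrite !(LinE _ n) ?leq_maxl ?leq_maxr // mulr_sumr -big_split /=.
  by apply: eq_bigr => i _; rewrite coefD coefZ mulrDl mulrA.
exists (mk_scalar lin); split => /=.
  move=> f; rewrite (LinE f (size f).+1) //.
  apply: le_trans (Dst (size f) f (leqnSn _)); rewrite /L.
  by apply: ler_sum => j _; rewrite alE // -ltnS.
by rewrite size_poly1 big_ord1 coef1 mul1r.
Qed.

End RealHahnBanach.

Section HahnBanach.
Context {R : realType} {K : numFieldType}.
Variables (nrm : K -> R) (hn : absval nrm).

Definition hahn_banach : Prop := forall (q : {poly K} -> R) (x : {poly K}),
  seminorm nrm q -> 0 < q x -> exists (phi : {scalar {poly K}}) (C : R),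
    (forall f, nrm (phi f) <= C * q f) /\ phi x != 0.

(** A parametrization of K[X] as a real vector space by R[X]; [c 0] will be the vector on which a
    functional attains the seminorm. *)
Definition embedded_lincomb (emb : {rmorphism R -> K}) (c : nat -> {poly K})
  (r : {poly R}) := \sum_(j < size r) emb r`_j *: c j.

Lemma embedded_lincombP (emb : {rmorphism R -> K}) (c : nat -> {poly K}) a r s :
  embedded_lincomb emb c (a *: r + s) =
  emb a *: embedded_lincomb emb c r + embedded_lincomb emb c s.
Proof.
have embE (t : {poly R}) n : (size t <= n)%N ->
    \sum_(j < size t) emb t`_j *: c j = \sum_(j < n) emb t`_j *: c j.
  move=> h; rewrite (big_ord_widen _ (fun i => emb t`_i *: c i) h) big_mkcond /=.
  apply: eq_bigr => i _; case: ifP => // /negbT; rewrite -leqNgt => hi.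
  by rewrite nth_default // rmorph0 scale0r.
rewrite /embedded_lincomb; set n := maxn (size r) (size s).
have hs : (size (a *: r + s)%R <= n)%N.
  apply: leq_trans (size_polyD _ _) _; rewrite geq_max; apply/andP; split.
    exact: leq_trans (size_scale_leq _ _) (leq_maxl _ _).
  exact: leq_maxr.
rewrite !(embE _ n) ?leq_maxl ?leq_maxr // scaler_sumr -big_split /=.
by apply: eq_bigr => i _; rewrite coefD coefZ rmorphD rmorphM scalerDl scalerA.
Qed.

(** The seminorm is pulled back to R[X], where 1 stands for [c 0]. The parametrization may have a
    kernel, but the pulled-back seminorm vanishes there, so the dominated functional does too and
    descends to K[X]. *)
Lemma real_functional (emb : {rmorphism R -> K}) (c : nat -> {poly K}) (q : {poly K} -> R) :
  (forall t, nrm (emb t) = `|t|) -> seminorm nrm q ->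
  (forall f, exists r, f = embedded_lincomb emb c r) ->
  exists g : {poly K} -> R, [/\ forall x y, g (x + y) = g x + g y,
    forall t x, g (emb t *: x) = t * g x, forall x, g x <= q x & g (c 0%N) = q (c 0%N)].
Proof.
move=> hemb hq hc.
pose La := embedded_lincomb emb c.
have LaP a r s : La (a *: r + s) = emb a *: La r + La s by exact: embedded_lincombP.
have La0 : La 0 = 0 by rewrite /La /embedded_lincomb size_poly0 big_ord0.
have LaD r s : La (r + s) = La r + La s by rewrite -[r]scale1r LaP rmorph1 !scale1r.
have LaZ a r : La (a *: r) = emb a *: La r by rewrite -[_ *: r]addr0 LaP La0 addr0.
have [||phi [hphi phi1]] := @real_hahn_banach R (fun r => q (La r)).
- by move=> r s; rewrite LaD hq.1.
- by move=> t r t0; rewrite LaZ hq.2 hemb ger0_norm.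
have [re hre] := choice hc.
have ker r : La r = 0 -> phi r = 0.
  move=> hr; apply/eqP; rewrite eq_le; apply/andP; split.
    by apply: le_trans (hphi r) _; rewrite hr (semi0 hn hq).
  rewrite -oppr_le0 -linearN; apply: le_trans (hphi (- r)) _.
  by rewrite -scaleN1r LaZ hr scaler0 (semi0 hn hq).
have gE r x : La r = x -> phi (re x) = phi r.
  move=> hr; apply/eqP; rewrite -subr_eq0 -linearB; apply/eqP/ker.
  by rewrite -[- r]scaleN1r LaD LaZ hr rmorphN1 scaleN1r -(hre x : x = La _) subrr.
have hre' x : La (re x) = x by rewrite -(hre x : x = La _).
exists (fun x => phi (re x)); split => [x y|t x|x|].
- by rewrite -linearD; apply: gE; rewrite LaD !hre'.
- by rewrite -[RHS]linearZ; apply: gE; rewrite LaZ hre'.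
- by have := hphi (re x); rewrite hre'.
- have L1 : La 1 = c 0%N by rewrite /La /embedded_lincomb size_poly1 big_ord1 coef1 rmorph1 scale1r.
  by rewrite (gE 1) // phi1 L1.
Qed.

End HahnBanach.

Section ScalarFields.
Context {R : realType} {K : numFieldType}.

(** All that the construction uses of R or C. The embedding of R relates the R-valued absolute value
    to the norm and the order of K, which the topology and the convexity of the space refer to. *)
Record scalar_field (nrm : K -> R) : Prop := ScalarField {
  sf_absval : absval nrm;
  sf_hahn_banach : hahn_banach nrm;
  sf_dense_ideals : dense_ideals nrm;
  sf_separable : exists d : nat -> K, forall a e, 0 < e -> exists n, nrm (a - d n) <= e;
  sf_embedding : exists emb : {rmorphism R -> K},
    [/\ forall x, `|x| = emb (nrm x), forall t, nrm (emb t) = `|t| &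
        forall s t, (emb s <= emb t) = (s <= t)] }.

Lemma absval_two_sub (nrm : K -> R) : absval nrm ->
  forall c, nrm c <= 1 -> 1 <= nrm (2 - c).
Proof.
move=> hn c hc; have := absvalD hn (2 - c) c; rewrite subrK.
by rewrite (absval_nat hn); lra.
Qed.

End ScalarFields.

Section RealScalars.
Context {R : realType}.

Lemma absval_real : absval (fun x : R => `|x|).
Proof.
split=> [x|x|x y|x y|n]; [exact: normr_ge0|exact: normr0_eq0|exact: normrM|exact: ler_normD|].
exact: normr_nat.
Qed.

Lemma hahn_banach_real : hahn_banach (fun x : R => `|x|).
Proof.
move=> q x hq x0.
(* Index 0 is reserved for [x], so [f] is represented by f X. *)
pose c (j : nat) := if j is i.+1 then 'X^i else x.
have hc (f : {poly R}) : exists r, f = embedded_lincomb idfun c r.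
  exists (f * 'X); have [->|f0] := eqVneq f 0.
    by rewrite mul0r /embedded_lincomb size_poly0 big_ord0.
  rewrite /embedded_lincomb size_mulX // big_ord_recl coefMX /= scale0r add0r -{1}(coefK f) poly_def.
  by apply: eq_bigr => i _; rewrite coefMX.
have [g [gD gZ gle gx]] := @real_functional R R _ absval_real idfun c q (fun=> erefl) hq hc.
have lin : scalar g by move=> a u v; rewrite gD gZ.
exists (mk_scalar lin), 1; split => /= [f|]; last by rewrite gx lt0r_neq0.
rewrite mul1r ler_norml gle andbT lerNl.
have := gle (- f); rewrite (semiN absval_real hq) -scaleN1r (gZ (-1)) mulN1r //.
Qed.

Lemma separable_real :
  exists d : nat -> R, forall a e, 0 < e -> exists n, `|a - d n| <= e.
Proof.
exists (fun n => ratr (odflt 0 (choice.unpickle n))) => a e e0.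
have : a < a + e by rewrite ltrDl.
move=> /rat_in_itvoo[x]; rewrite in_itv /= => /andP[h1 h2].
exists (choice.pickle x); rewrite choice.pickleK /= ler_norml; apply/andP; split; lra.
Qed.

End RealScalars.

Section ComplexScalars.
Context {R : realType}.
Local Open Scope complex_scope.
Local Notation nrm := (@Normc.normc R).

Lemma absval_complex : absval (nrm : R[i] -> R).
Proof.
split=> [x|x|x y|x y|n].
- by case: x => a b; exact: sqrtr_ge0.
- exact: Normc.eq0_normc.
- exact: Normc.normcM.
- exact: le_normcD.
- by rewrite -[n%:R]/((1 : Rcomplex R) *+ n) normcMn Normc.normc1.
Qed.

Lemma absval_real_complex (t : R) : nrm t%:C = `|t|.
Proof. by rewrite /Normc.normc /= expr0n /= addr0 sqrtr_sqr. Qed.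

Lemma norm_complexE (x : R[i]) : `|x| = (nrm x)%:C.
Proof. by rewrite normc_def; case: x. Qed.

Lemma hahn_banach_complex : hahn_banach (nrm : R[i] -> R).
Proof.
have hn := absval_complex; move=> q x hq x0.
(* The vector [x], followed by the real basis 1, i, X, i X, X^2, ... of C[X]. *)
pose c (j : nat) : {poly R[i]} :=
  if j is i.+1 then (if odd i then 'i *: 'X^(i./2) else 'X^(i./2)) else x.
pose La := embedded_lincomb (real_complex R) c.
have hc f : exists r, f = La r.
  have La0 : La 0 = 0 by rewrite /La /embedded_lincomb size_poly0 big_ord0.
  have LaZ a j : La (a *: 'X^j) = a%:C *: c j.
    rewrite -[_ *: _]addr0 /La embedded_lincombP -/La La0 addr0; congr (_ *: _).
    rewrite /La /embedded_lincomb size_polyXn big_ord_recr /= coefXn eqxx scale1r.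
    by rewrite big1 ?add0r // => i _; rewrite coefXn ltn_eqF // scale0r.
  rewrite -(coefK f) poly_def; elim/big_ind: _ => [|p r [s ->] [t ->]|i _].
  - by exists 0.
  - by exists (1 *: s + t); rewrite /La embedded_lincombP rmorph1 scale1r.
  - exists (1 *: (complex.Re f`_i *: 'X^(i.*2.+1)) + complex.Im f`_i *: 'X^(i.*2.+2)).
    rewrite /La embedded_lincombP -/La rmorph1 scale1r !LaZ /c.
    rewrite odd_double /= odd_double /= doubleK uphalf_double scalerA -scalerDl.
    by congr (_ *: _); rewrite {1}[f`_i]complexE; congr (_ + _); rewrite mulrC.
have [g [gD gZ gle gx]] :=
  @real_functional R _ _ hn (real_complex R) c q absval_real_complex hq hc.
have gN y : g (- y) = - g y by rewrite -scaleN1r -[-1](rmorphN1 (real_complex R)) gZ mulN1r.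
have gabs y : `|g y| <= q y.
  rewrite ler_norml gle andbT lerNl -gN; apply: le_trans (gle _) _.
  by rewrite (semiN hn hq).
have gI y : g ('i *: ('i *: y)) = - g y by rewrite scalerA -expr2 sqr_i scaleN1r gN.
have ni : nrm 'i = 1 by rewrite /Normc.normc /= expr0n expr1n add0r sqrtr1.
(* The complex-linear functional with real part [g]; at [x] this real part is q(x) > 0. *)
have lin : scalar (fun y => (g y)%:C - 'i * (g ('i *: y))%:C).
  move=> [a b] u v.
  have E w : (a +i* b) *: w = a%:C *: w + b%:C *: ('i *: w).
    by rewrite scalerA -scalerDl {1}[a +i* b]complexE /= [b%:C * _]mulrC.
  have Ei w : 'i *: (b%:C *: w) = b%:C *: ('i *: w) by rewrite !scalerA mulrC.
  have Ea w : 'i *: (a%:C *: w) = a%:C *: ('i *: w) by rewrite !scalerA mulrC.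
  rewrite !E scalerDr scalerDr Ea Ei !gD !gZ gI.
  apply/eqP; rewrite eq_complex /=; simpc; apply/andP; split => //; apply/eqP; ring.
exists (@mk_scalar (R[i] : numFieldType) {poly (R[i] : numFieldType)} _ lin), 2; split => [f|].
  change (nrm ((g f)%:C - 'i * (g ('i *: f))%:C) <= 2 * q f).
  have h1 := absvalD hn (g f)%:C (- ('i * (g ('i *: f))%:C)).
  rewrite (absvalN hn) (absvalM hn) ni mul1r !absval_real_complex in h1.
  have h2 := gabs f; have h3 := gabs ('i *: f).
  by rewrite hq.2 ni mul1r in h3; lra.
apply/eqP => /(congr1 (@complex.Re R)) /=; rewrite gx; simpc => h.
by move: x0; rewrite /c /= in h; lra.
Qed.

Lemma dense_ideals_complex : dense_ideals (nrm : R[i] -> R).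
Proof.
move=> q hq hmono hX h0 h2.
have hn := absval_complex.
apply: (@dense_ideal_closed _ _ nrm q 1) => //.
- exact: absval0 hn.
- exact: absval_ge0 hn.
- by move=> k; exact: (semi_ge0 hn (hq k)).
- by move=> k; exact: (hq k).1.
- by move=> k c p; rewrite mul1r (hq k).2.
- exact: absvalV hn.
- exact: absvalX hn.
- exact: absval_two_sub hn.
- exact: absvalN hn.
Qed.

(** The seminorms are extended to C[X] by q(re f) + q(im f), homogeneous up to the factor 2, and the
    algebraically closed case applies. As p is real, p re(r) - 1 is the real part of p r - 1. *)
Lemma dense_ideals_real : dense_ideals (fun x : R => `|x|).
Proof.
move=> q hq hmono hX h0 h2 p p0.
have hn := @absval_real R.
pose re (f : {poly R[i]}) : {poly R} := map_poly (@complex.Re R) f.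
pose im (f : {poly R[i]}) : {poly R} := map_poly (@complex.Im R) f.
have cre f i : (re f)`_i = complex.Re f`_i by rewrite coef_map_id0.
have cim f i : (im f)`_i = complex.Im f`_i by rewrite coef_map_id0.
pose rho k f := q k (re f) + q k (im f).
have ReD (a b : R[i]) : complex.Re (a + b) = complex.Re a + complex.Re b by case: a; case: b.
have ImD (a b : R[i]) : complex.Im (a + b) = complex.Im a + complex.Im b by case: a; case: b.
have qge k f := semi_ge0 hn (hq k) f.
have rhoreal k (f : {poly R}) : rho k (map_poly (real_complex R) f) = q k f.
  have -> : rho k (map_poly (real_complex R) f) = q k f + q k 0.
    congr (q k _ + q k _); apply/polyP => i; rewrite ?cre ?cim coef_map //=.
    by rewrite coef0.
  by rewrite (semi0 hn (hq k)) addr0.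
have : @dense_ideal R R[i] rho (map_poly (real_complex R) p).
  apply: (@dense_ideal_closed _ _ nrm rho 2) => //.
  - exact: absval0 absval_complex.
  - exact: absval_ge0 absval_complex.
  - by move=> k f; rewrite addr_ge0.
  - move=> k f g; rewrite /rho.
    have -> : re (f + g) = re f + re g by apply/polyP => i; rewrite coefD !cre coefD ReD.
    have -> : im (f + g) = im f + im g by apply/polyP => i; rewrite coefD !cim coefD ImD.
    by have := (hq k).1 (re f) (re g); have := (hq k).1 (im f) (im g); lra.
  - move=> k [a b] f; rewrite /rho.
    have -> : re ((a +i* b) *: f) = a *: re f - b *: im f.
      apply/polyP => i; rewrite coefB !coefZ !cre cim coefZ.
      by case: f`_i.
    have -> : im ((a +i* b) *: f) = a *: im f + b *: re f.
      apply/polyP => i; rewrite coefD !coefZ !cim cre coefZ.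
      by case: f`_i => u v /=; rewrite addrC [b * u]mulrC.
    have h1 := semiB hn (hq k) (a *: re f) (b *: im f).
    have h3 := (hq k).1 (a *: im f) (b *: re f).
    rewrite !(hq k).2 in h1 h3.
    have na : `|a| <= nrm (a +i* b).
      by rewrite /Normc.normc -sqrtr_sqr ler_wsqrtr // lerDl sqr_ge0.
    have nb : `|b| <= nrm (a +i* b).
      by rewrite /Normc.normc -sqrtr_sqr ler_wsqrtr // lerDr sqr_ge0.
    have := ler_wpM2r (qge k (re f)) na; have := ler_wpM2r (qge k (re f)) nb.
    have := ler_wpM2r (qge k (im f)) na; have := ler_wpM2r (qge k (im f)) nb.
    lra.
  - move=> k; have [l [C hC]] := hX k; exists l, C => f; rewrite /rho.
    have -> : re ('X * f) = 'X * re f.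
      by apply/polyP => i; rewrite cre !coefXM cre; case: (i == 0%N).
    have -> : im ('X * f) = 'X * im f.
      by apply/polyP => i; rewrite cim !coefXM cim; case: (i == 0%N).
    by rewrite mulrDr; apply: lerD.
  - by move=> k f; apply: lerD.
  - exact: absvalV absval_complex.
  - exact: absvalX absval_complex.
  - exact: absval_two_sub absval_complex.
  - exact: absvalN absval_complex.
  - move=> k e e0; have [m hm] := h0 k e e0; exists m.
    by rewrite -(map_polyXn (real_complex R)) rhoreal.
  - move=> k e e0; have [m hm] := h2 k e e0; exists m.
    have -> : 'X^m - 2%:P = map_poly (real_complex R) ('X^m - 2%:P).
      rewrite rmorphB /= map_polyXn map_polyC; congr (_ - _%:P).
      by rewrite -(rmorph_nat (real_complex R) 2).
    by rewrite rhoreal.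
  - by rewrite map_poly_eq0.
move=> hd k e e0; have [r hr] := hd k e e0; exists (re r).
apply: le_trans hr; rewrite /rho.
have -> : re (map_poly (real_complex R) p * r - 1) = p * re r - 1.
  apply/polyP => i; rewrite cre !coefB !coef1 !coefM.
  have -> : (i == 0)%:R = ((i == 0)%:R : R)%:C :> R[i] by rewrite rmorph_nat.
  have ReB (a b : R[i]) : complex.Re (a - b) = complex.Re a - complex.Re b by case: a; case: b.
  rewrite ReB; congr (_ - _).
  rewrite (big_morph (@complex.Re R) ReD (erefl : complex.Re 0 = 0)).
  apply: eq_bigr => j _; rewrite cre coef_map /=.
  by case: r`_(i - j) => u v /=; rewrite mul0r subr0.
by rewrite lerDl.
Qed.

Lemma separable_complex :
  exists d : nat -> R[i], forall a e, 0 < e -> exists n, nrm (a - d n) <= e.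
Proof.
have [d hd] := @separable_real R.
pose dd (x : nat * nat) : R[i] := d x.1 +i* d x.2.
exists (fun n => dd (odflt (0, 0)%N (choice.unpickle n))) => -[a b] e e0.
have e20 : 0 < e / 2 by lra.
have [m hm] := hd a _ e20; have [n hn] := hd b _ e20.
exists (choice.pickle (m, n)); rewrite choice.pickleK; change (nrm ((a +i* b) - dd (m, n)) <= e).
have -> : (a +i* b) - dd (m, n) = (a - d m)%:C + 'i * (b - d n)%:C.
  by rewrite /dd /real_complex_def; simpc.
apply: le_trans (absvalD absval_complex _ _) _.
rewrite (absvalM absval_complex) !absval_real_complex.
have -> : nrm 'i = 1 by rewrite /Normc.normc /= expr0n expr1n add0r sqrtr1.
by rewrite mul1r; lra.
Qed.

End ComplexScalars.

Lemma scalar_field_real {R : realType} : scalar_field (fun x : R => `|x|).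
Proof.
split; [exact: absval_real|exact: hahn_banach_real|exact: dense_ideals_real|
  exact: separable_real|].
by exists idfun; split => // t; rewrite normr_id.
Qed.

Lemma scalar_field_complex {R : realType} : scalar_field (@Normc.normc R : R[i] -> R).
Proof.
split; [exact: absval_complex|exact: hahn_banach_complex|exact: dense_ideals_complex|
  exact: separable_complex|].
exists (real_complex R); split; [exact: norm_complexE|exact: absval_real_complex|].
by move=> s t; rewrite lecR.
Qed.

(** * Typed bases *)

Section TypedBasis.
Context {R : realType} {K : numFieldType}.
Variables (nrm : K -> R) (hn : absval nrm) (hb : hahn_banach nrm).
Variables (q : nat -> {poly K} -> R) (hq : forall k, seminorm nrm (q k)).
Hypothesis (hmono : forall k x, q k x <= q k.+1 x).
Hypothesis (hsep : forall f : {poly K}, f != 0 -> exists k, 0 < q k f).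

(* [t r] is the level at which [e r] becomes visible: the seminorms before it vanish on [e r],
   and the dual functional [f r] is already bounded by the seminorm of that level. *)
Record typed_basis (e : nat -> {poly K}) (f : nat -> {scalar {poly K}}) (t : nat -> nat) : Prop :=
  TypedBasis {
  tb_dual : forall i j, f i (e j) = (i == j)%:R;
  tb_zero : forall r k, (k < t r)%N -> q k (e r) = 0;
  tb_bound : forall r, exists C, forall x, nrm (f r x) <= C * q (t r) x;
  tb_span : forall x, exists n, forall m, (n <= m)%N -> x = \sum_(i < m) f i x *: e i }.

Let D := ({poly K} * {scalar {poly K}} * nat)%type.
Let Inv (n : nat) (S : nat -> D) := forall r, (r < n)%N ->
  [/\ forall j, (j <= r)%N -> (S j).1.2 (S r).1.1 = (j == r)%:R /\
                              (S r).1.2 (S j).1.1 = (r == j)%:R,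
      forall k, (k < (S r).2)%N -> q k (S r).1.1 = 0,
      exists C, forall x, nrm ((S r).1.2 x) <= C * q (S r).2 x,
      size (S r).1.1 = r.+1 &
      (S r).1.1 = 'X^r - \sum_(j < r) (S j).1.2 'X^r *: (S j).1.1].

(** Gram-Schmidt on the monomials: [kap] is X^n corrected so that the earlier functionals vanish on
    it, its type [tau] is the first level that sees it, and Hahn-Banach provides [phi] bounded by
    [q tau]. Subtracting the phi(e_j) f_j from [phi] keeps such a bound: either the type of f_j is
    at most [tau], or q_tau (e_j) = 0 and phi(e_j) vanishes. *)
Lemma exists_typed_basis : exists e f t, typed_basis e f t.
Proof.
have linz : scalar (fun _ : {poly K} => 0 : K) by move=> a u v; rewrite mulr0 addr0.
pose S0 (j : nat) : D := (0, mk_scalar linz, 0%N).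
have hloc n S S' : (forall j, (j < n)%N -> S j = S' j) -> Inv n S -> Inv n S'.
  move=> hSS' hI r rn; have [h1 h2 h3 h4 h5] := hI r rn.
  have E j : (j <= r)%N -> S' j = S j by move=> jr; rewrite hSS' // (leq_ltn_trans jr).
  rewrite (E r) //; split => // [j jr|]; first by rewrite E //; exact: h1.
  by rewrite {1}h5; congr (_ - _); apply: eq_bigr => j _; rewrite E // ltnW.
have inv0 : Inv 0%N S0 by [].
suff hext n S : Inv n S -> exists d, Inv n.+1 (update S n d).
  have [S hS] := sequence_by_extension hloc inv0 hext.
  exists (fun r => (S r).1.1), (fun r => (S r).1.2), (fun r => (S r).2).
  have hS' r := hS r.+1 r (ltnSn r).
  have dual i j : (S i).1.2 (S j).1.1 = (i == j)%:R.
    case: (leqP i j) => [ij|/ltnW ji]; first by case: (hS' j) => /(_ i ij)[].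
    by case: (hS' i) => /(_ j ji)[].
  split => // [r k|r|x]; [by case: (hS' r) => _ h _ _ _; exact: h|by case: (hS' r)|].
  exists (size x) => m; elim: m x => [|m IH] x sx.
    by rewrite big_ord0; apply/eqP; rewrite -size_poly_eq0 -leqn0.
  pose x' := x - x`_m *: (S m).1.1.
  have [_ _ _ sm Em] := hS' m.
  have lead1 : ((S m).1.1)`_m = 1.
    rewrite Em coefB coefXn eqxx coef_sum big1 ?subr0 // => j _.
    have [_ _ _ sj _] := hS' j.
    by rewrite coefZ [_`_m]nth_default ?mulr0 // sj.
  have sx' : (size x' <= m)%N.
    apply/leq_sizeP => j; rewrite leq_eqVlt => /orP[/eqP <-|mj].
      by rewrite coefB coefZ lead1 mulr1 subrr.
    by rewrite coefB coefZ (nth_default _ (leq_trans sx mj)) [_`_j]nth_default ?sm // mulr0 subrr.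
  have fx' i : (i < m)%N -> (S i).1.2 x' = (S i).1.2 x.
    by move=> im; rewrite linearB linearZ /= dual ltn_eqF // mulr0 subr0.
  have xE : x = \sum_(i < m) (S i).1.2 x *: (S i).1.1 + x`_m *: (S m).1.1.
    rewrite -{1}(subrK (x`_m *: (S m).1.1) x) -/x' {1}(IH x' sx'); congr (_ + _).
    by apply: eq_bigr => i _; rewrite fx'.
  have fm : (S m).1.2 x = x`_m.
    rewrite {1}xE linearD linear_sum /= big1 => [|i _]; last first.
      by rewrite linearZ /= dual gtn_eqF // mulr0.
    by rewrite add0r linearZ /= dual eqxx mulr1.
  by rewrite big_ord_recr /= fm.
move=> hI.
pose e j := (S j).1.1; pose f j := (S j).1.2; pose t j := (S j).2.
have dual i j : (i < n)%N -> (j < n)%N -> f i (e j) = (i == j)%:R.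
  move=> iN jN; case: (leqP i j) => [ij|/ltnW ji]; first by case: (hI j jN) => /(_ i ij)[].
  by case: (hI i iN) => /(_ j ji)[].
pose kap := 'X^n - \sum_(j < n) f j 'X^n *: e j.
have ssum : (size (\sum_(j < n) f j 'X^n *: e j)%R <= n)%N.
  apply/leq_sizeP => i ni; rewrite coef_sum big1 // => j _.
  have [_ _ _ sj _] := hI j (ltn_ord j).
  by rewrite coefZ [_`_i]nth_default ?mulr0 // /e sj (leq_trans _ ni).
have skap : size kap = n.+1.
  by rewrite size_polyDl ?size_polyXn // size_polyN ltnS.
have kap0 : kap != 0 by rewrite -size_poly_eq0 skap.
have fkap j : (j < n)%N -> f j kap = 0.
  move=> jn; rewrite linearB linear_sum /= (bigD1 (Ordinal jn)) //= linearZ /= dual //.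
  rewrite eqxx mulr1 big1 ?addr0 ?subrr // => i /negbTE ne.
  by rewrite linearZ /= dual // eq_sym -val_eqE /= in ne *; rewrite ne mulr0.
have [k0 hk0] := hsep kap0.
have ex : exists k, 0 < q k kap by exists k0.
pose tau := ex_minn ex.
have [tau0 taumin] : 0 < q tau kap /\ forall k, 0 < q k kap -> (tau <= k)%N.
  by rewrite /tau; case: ex_minnP.
have below k : (k < tau)%N -> q k kap = 0.
  move=> kt; apply/eqP; rewrite eq_le (semi_ge0 hn (hq k)) andbT leNgt.
  by apply/negP => /taumin; rewrite leqNgt kt.
have [phi [C [hC phik]]] := hb (hq tau) tau0.
have lin : scalar (fun x => (phi x - \sum_(j < n) phi (e j) * f j x) / phi kap).
  move=> a u v; rewrite scalarP; under eq_bigr do rewrite scalarP mulrDr mulrCA.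
  by rewrite big_split /= -mulr_sumr; ring.
pose fn := mk_scalar lin.
exists (kap, fn, tau) => r; rewrite ltnS leq_eqVlt => /orP[/eqP -> |rn]; last first.
  have [h1 h2 h3 h4 h5] := hI r rn.
  have E j : (j <= r)%N -> update S n (kap, fn, tau) j = S j.
    by move=> jr; rewrite /update ltn_eqF // (leq_ltn_trans jr).
  rewrite (E r) //; split => // [j jr|]; first by rewrite E //; exact: h1.
  by rewrite {1}h5; congr (_ - _); apply: eq_bigr => j _; rewrite E // ltnW.
have En : update S n (kap, fn, tau) n = (kap, fn, tau) by rewrite /update eqxx.
have E j : (j < n)%N -> update S n (kap, fn, tau) j = S j by move=> jn; rewrite /update ltn_eqF.
have sum0 : \sum_(j < n) phi (e j) * f j kap = 0.
  by rewrite big1 // => j _; rewrite fkap // mulr0.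
rewrite En /=; split => //.
- move=> j; rewrite leq_eqVlt => /orP[/eqP ->|jn].
    by rewrite En /= sum0 subr0 divff // eqxx.
  rewrite E // fkap // ltn_eqF // gtn_eqF //; split => //.
  rewrite (bigD1 (Ordinal jn)) //= dual // eqxx mulr1 big1 ?addr0 ?subrr ?mul0r // => i ne.
  by rewrite dual // -[i == j :> nat]/(i == Ordinal jn) (negbTE ne) mulr0.
- have hj (j : 'I_n) : exists Cj, forall x, nrm (phi (e j) * f j x) <= Cj * q tau x.
    have [_ _ [Cj hCj] _ _] := hI j (ltn_ord j).
    have [jt|tj] := leqP (t j) tau.
      exists (nrm (phi (e j)) * `|Cj|) => x; rewrite (absvalM hn) -mulrA.
      apply: ler_wpM2l; first exact: (absval_ge0 hn).
      apply: le_trans (hCj x) _; apply: (@le_trans _ _ (`|Cj| * q (t j) x)).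
        by apply: ler_wpM2r; [exact: (semi_ge0 hn (hq _))|exact: ler_norm].
      by apply: ler_wpM2l => //; apply: (q_le hmono).
    exists 0 => x; have [_ hz _ _ _] := hI j (ltn_ord j).
    have : nrm (phi (e j)) <= 0 by have := hC (e j); rewrite (hz tau tj) mulr0.
    have := absval_ge0 hn (phi (e j)) => h1 h2.
    have -> : phi (e j) = 0 by apply: (absval_eq0 hn); apply/eqP; rewrite eq_le h1 h2.
    by rewrite mul0r (absval0 hn) mul0r.
  have [Cf hCf] := choice hj.
  exists ((C + \sum_(j < n) Cf j) / nrm (phi kap)) => x.
  rewrite (absvalM hn) (absvalV hn) mulrAC ler_wpM2r ?invr_ge0 ?(absval_ge0 hn) //.
  apply: le_trans (absvalD hn _ _) _; rewrite (absvalN hn) mulrDl; apply: lerD => //.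
  apply: le_trans (absval_sum hn _ _ _) _; rewrite mulr_suml.
  by apply: ler_sum => j _; exact: hCf.
- by congr (_ - _); apply: eq_bigr => j _; rewrite E.
Qed.

End TypedBasis.

(** * The conjugation scheme on K[X] *)

Section PolynomialScheme.
Context {R : realType} {K : numFieldType}.
Variables (nrm : K -> R) (hn : absval nrm).
Variables (q : nat -> {poly K} -> R) (hq : forall k, seminorm nrm (q k)).
Hypothesis (hmono : forall k x, q k x <= q k.+1 x).
Variable b : bool.
Hypothesis hcoef : forall i, exists N C,
  (b -> N = 0%N) /\ forall p : {poly K}, nrm p`_i <= C * q N p.

Lemma dual_functionals d (u : 'I_d -> {poly K}) :
  (forall c : 'I_d -> K, \sum_i c i *: u i = 0 -> forall i, c i = 0) ->
  exists N C (h : 'I_d -> {scalar {poly K}}),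
    [/\ b -> N = 0%N, forall i j, h i (u j) = (i == j)%:R &
        forall i z, nrm (h i z) <= C * q N z].
Proof.
move=> hfree; pose L := \max_i size (u i).
pose B := \matrix_(i < d, l < L) (u i)`_l.
have /row_freeP[Y hY] : row_free B.
  apply: inj_row_free => v hv; apply/rowP => i; rewrite mxE.
  apply: (hfree (fun i => v 0 i)); apply/polyP => l; rewrite coef_sum coef0.
  case: (ltnP l L) => hl.
    have := congr1 (fun M : 'rV[K]_L => M 0 (Ordinal hl)) hv; rewrite !mxE => h; rewrite -[RHS]h.
    by apply: eq_bigr => j _; rewrite coefZ mxE.
  rewrite big1 // => j _; rewrite coefZ nth_default ?mulr0 //.
  by apply: leq_trans hl; exact: (@leq_bigmax _ (fun i => size (u i))).
have lin i : scalar (fun z : {poly K} => \sum_(l < L) z`_l * Y l i).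
  move=> a z w; rewrite mulr_sumr -big_split /=; apply: eq_bigr => l _.
  by rewrite coefD coefZ mulrDl mulrA.
have [Nf hNf] := choice hcoef; have [Cf hCf] := choice hNf.
pose N := \max_(l < L) Nf l.
exists N, (\sum_i \sum_(l < L) `|Cf l| * nrm (Y l i)), (fun i => mk_scalar (lin i)); split.
- by move=> hb; apply: big1 => l _; case: (hCf l) => /(_ hb).
- move=> i j /=; have := congr1 (fun M : 'M[K]_d => M j i) hY; rewrite !mxE eq_sym => <-.
  by apply: eq_bigr => l _; rewrite mxE.
- move=> i z /=; apply: le_trans (absval_sum hn _ _ _) _.
  have qN : 0 <= q N z by exact: (semi_ge0 hn (hq N)).
  rewrite (bigD1 i) //= mulrDl -[leLHS]addr0; apply: lerD; last first.
    apply: mulr_ge0 => //; apply: sumr_ge0 => j _; apply: sumr_ge0 => l _.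
    by rewrite mulr_ge0 // (absval_ge0 hn).
  rewrite mulr_suml; apply: ler_sum => l _; rewrite (absvalM hn) mulrAC.
  apply: ler_wpM2r; first exact: (absval_ge0 hn).
  have [_ h] := hCf l; apply: le_trans (h z) _.
  apply: (@le_trans _ _ (`|Cf l| * q (Nf l) z)).
    by apply: ler_wpM2r; [exact: (semi_ge0 hn (hq _))|exact: ler_norm].
  apply: ler_wpM2l => //; apply: (q_le hmono).
  exact: (@leq_bigmax _ (fun j : 'I_L => Nf j)).
Qed.

Hypothesis hsep : exists d : nat -> K, forall a e, 0 < e -> exists n, nrm (a - d n) <= e.

(** The scheme approaches its n-th target only for [q n] and up to 2^-n, so every target must recur
    at arbitrarily large indices. With n = 2^M (2 l + 1), the code l determines the polynomial and M
    is free. *)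
Lemma dense_targets : exists yy : nat -> {poly K}, forall y k M e, 0 < e ->
  exists2 n, (M <= n)%N & q k (yy n - y) <= e.
Proof.
have [d hd] := hsep.
pose dec (n : nat) : seq nat := odflt [::] (choice.unpickle ((n %/ 2 ^ logn 2 n)./2)).
exists (fun n => \poly_(i < size (dec n)) d (nth 0%N (dec n) i)) => y k M e e0.
pose X := 1 + \sum_(i < size y) q k 'X^i.
have S0 : 0 <= \sum_(i < size y) q k 'X^i by apply: sumr_ge0 => i _; exact: (semi_ge0 hn (hq k)).
have X0 : 0 < X by rewrite /X; lra.
have [s hs] := choice (fun i : nat => hd y`_i (e / X) (divr_gt0 e0 X0)).
pose l := mkseq s (size y).
pose n := (2 ^ M * (choice.pickle l).*2.+1)%N.
have hlog : logn 2 n = M.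
  rewrite /n lognM ?expn_gt0 // pfactorK // lognE /= dvdn2 /= odd_double /=.
  by rewrite addn0.
have hdec : dec n = l.
  rewrite /dec hlog /n mulKn ?expn_gt0 //.
  have -> : ((choice.pickle l).*2.+1)./2 = choice.pickle l by exact: (half_bit_double _ true).
  by rewrite choice.pickleK.
exists n.
  apply: (@leq_trans (2 ^ M)); first by apply: ltnW; exact: ltn_expl.
  by rewrite /n leq_pmulr.
rewrite hdec size_mkseq.
have -> : \poly_(i < size y) d (nth 0%N l i) - y = \sum_(i < size y) (d (s i) - y`_i) *: 'X^i.
  rewrite -{2}(coefK y) !poly_def -sumrB; apply: eq_bigr => i _.
  by rewrite scalerBl nth_mkseq.
apply: le_trans (semi_lincomb hn (hq k) _ _ _ _) _.
apply: (@le_trans _ _ (\sum_(i < size y) e / X * q k 'X^i)).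
  apply: ler_sum => i _; apply: ler_wpM2r; first exact: (semi_ge0 hn (hq k)).
  by rewrite -(absvalN hn) opprB.
rewrite -mulr_sumr mulrAC ler_pdivrMr // ler_pM2l // /X; lra.
Qed.


Lemma scheme_poly (T0 : {linear {poly K} -> {poly K}}) :
  qcont q T0 -> bounded0 q b T0 -> transitive_ext q b T0 ->
  exists (T : {linear {poly K} -> {poly K}}) u,
    [/\ qcont q T, forall x, exists c, x = act T u c,
        forall c, act T u c = 0 -> c = 0 & hypercyclic q T u].
Proof.
move=> h1 h2 h3; have [yy hyy] := dense_targets.
have hspan x : exists n (a : nat -> K), x = \sum_(i < n) a i *: 'X^i.
  by exists (size x), (fun i => x`_i); rewrite -poly_def coefK.
have [T [hT hsurj hinj hyp]] := scheme_limit hn hq hmono dual_functionals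
  yy h1 h2 h3 (oner_neq0 _ : (1 : {poly K}) != 0) hspan.
exists T, 1; split => // y k e e0; have e20 : 0 < e / 2 by lra.
have [N [N0 hN]] := small_nat 1 e20.
have [n hn' hy] := hyy y k (maxn k N) (e / 2) e20.
have [m hm] := hyp n; exists m.
have := (hq k).1 (iter m T 1 - yy n) (yy n - y); rewrite addrA subrK.
have h4 : q k (iter m T 1 - yy n) <= 2^-1 ^+ n.
  apply: le_trans hm; apply: (q_le hmono).
  by apply: leq_trans hn'; exact: leq_maxl.
have h5 : 2^-1 ^+ n <= e / 2.
  apply: le_trans hN; rewrite exprVn mul1r lef_pV2 ?posrE ?ltr0n ?exprn_gt0 //.
  rewrite -natrX ler_nat; apply: (leq_trans _ (ltnW (ltn_expl n (ltnSn 1)))).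
  by apply: leq_trans hn'; exact: leq_maxr.
lra.
Qed.

End PolynomialScheme.

(** * Cyclic models for the two basic operators *)

Section CyclicModels.
Context {R : realType} {K : numFieldType} {W : lmodType K}.
Implicit Types c : {poly K}.
Variables (nrm : K -> R) (hK : scalar_field nrm).
Let hn := sf_absval hK.
Variables (p : nat -> W -> R) (hp : forall k, seminorm nrm (p k)).
Hypothesis (hmono : forall k x, p k x <= p k.+1 x).

(* A copy of K[X] inside W spanned by [v] on which multiplication by X is continuous and all of
   whose nonzero elements have dense orbits (in the copy). *)
Record cyclic_model (v : nat -> W) (Psi : {linear {poly K} -> W}) : Prop := CyclicModel {
  cm_inj : forall c, Psi c = 0 -> c = 0;
  cm_basis : forall i, exists c, Psi c = v i;
  cm_span : forall c, exists n (a : nat -> K), Psi c = \sum_(i < n) a i *: v i;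
  cm_cont : forall k, exists l C, forall c, p k (Psi ('X * c)) <= C * p l (Psi c);
  cm_dense : forall c y k e, c != 0 -> 0 < e -> exists m, p k (Psi ('X^m * c - y)) <= e }.

Variables (v : nat -> W) (g : nat -> {scalar W}) (t : nat -> nat) (C : nat -> R).
Hypothesis hdual : forall i j, g i (v j) = (i == j)%:R.
Hypothesis hC : forall i x, nrm (g i x) <= C i * p (t i) x.

Let C' i := `|C i|.
Let hC' i x : nrm (g i x) <= C' i * p (t i) x.
Proof.
apply: le_trans (hC i x) _; apply: ler_wpM2r; [exact: (semi_ge0 hn (hp _))|exact: ler_norm].
Qed.

(** In the basis s_i v_i the i-th coefficient is bounded by C_i / s_i times a seminorm. The weights
    grow so fast that this compensates, with a margin 2^-i, the size under [p i] of a combination of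
    the earlier vectors with binomial coefficients; binomials dominate the entries of both basic
    operators. *)
Lemma exists_scale : exists s : nat -> nat, forall i, (0 < s i)%N /\
  2 ^+ i * C' i * \sum_(j < i) 'C(i, j)%:R * ((s j)%:R * p i (v j)) <= (s i)%:R.
Proof.
pose A (s : nat -> nat) i := 2 ^+ i * C' i * \sum_(j < i) 'C(i, j)%:R * ((s j)%:R * p i (v j)).
pose Inv n (s : nat -> nat) := forall i, (i < n)%N -> (0 < s i)%N /\ A s i <= (s i)%:R.
have AE s s' i : (forall j, (j < i)%N -> s j = s' j) -> A s i = A s' i.
  by move=> h; congr (_ * _); apply: eq_bigr => j _; rewrite h.
have hloc n s s' : (forall j, (j < n)%N -> s j = s' j) -> Inv n s -> Inv n s'.
  move=> h hI i hi; have [h1 h2] := hI i hi; rewrite -h //; split => //.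
  by rewrite -(AE s) // => j ji; apply: h; exact: ltn_trans hi.
have hext n s : Inv n s -> exists d, Inv n.+1 (update s n d).
  move=> hI; exists (Num.truncn (A s n)).+1 => i; rewrite ltnS => hi.
  have E : A (update s n (Num.truncn (A s n)).+1) i = A s i.
    by apply: AE => j ji; rewrite /update ltn_eqF // (leq_trans ji).
  rewrite E /update; case: eqP => [->|/eqP ne]; first by split => //; rewrite ltW // truncnS_gt.
  by apply: hI; rewrite ltn_neqAle ne.
have [s hs] := @sequence_by_extension _ Inv (fun=> 0%N) hloc (fun i h => False_ind _ (notF h)) hext.
by exists s => i; exact: (hs i.+1 i).
Qed.

Variables (s : nat -> nat) (hs : forall i, (0 < s i)%N /\
  2 ^+ i * C' i * \sum_(j < i) 'C(i, j)%:R * ((s j)%:R * p i (v j)) <= (s i)%:R).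

Definition scaled_basis : {linear {poly K} -> W} :=
  mk_linear (linear_by_basis (fun i => (s i)%:R *: v i)).
Local Notation Phi := scaled_basis.
Let q k (c : {poly K}) := p k (Phi c).

Lemma scaled_basis_Xn i : Phi 'X^i = (s i)%:R *: v i.
Proof. exact: linear_by_basis_Xn. Qed.

Lemma dual_scaled_basis i c : g i (Phi c) = c`_i * (s i)%:R.
Proof.
rewrite /= linear_sum; case: (ltnP i (size c)) => hi.
  rewrite (bigD1 (Ordinal hi)) //= !linearZ /= hdual eqxx mulr1 big1 ?addr0 // => j.
  by rewrite -val_eqE /= eq_sym !linearZ /= hdual => /negbTE ->; rewrite !mulr0.
rewrite nth_default // mul0r big1 // => j _; rewrite !linearZ /= hdual.
by rewrite gtn_eqF ?mulr0 // (leq_trans (ltn_ord j)).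
Qed.

Let s_pos i : 0 < (s i)%:R :> R. Proof. by rewrite ltr0n; case: (hs i). Qed.

Lemma coef_scaled_bound i c : nrm c`_i * (s i)%:R <= C' i * q (t i) c.
Proof.
by have := hC' i (Phi c); rewrite dual_scaled_basis (absvalM hn) (absval_nat hn).
Qed.

Lemma q_seminorm k : seminorm nrm (q k).
Proof. exact: (seminorm_comp Phi (hp k)). Qed.

Lemma q_monotone k c : q k c <= q k.+1 c. Proof. exact: hmono. Qed.

(** For i >= k the weights give summable factors 2^-i, and the finitely many i < k contribute a
    constant. The hypothesis on types makes the i-th coefficient bounded by [q l] whenever [q k]
    sees T0 X^i - X^i. *)
Lemma triangular_bound (T0 : {linear {poly K} -> {poly K}}) k l :
  (forall i, (size (T0 'X^i - 'X^i)%R <= i)%N) ->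
  (forall i j, nrm (T0 'X^i - 'X^i)`_j <= 'C(i, j)%:R) ->
  (forall i j, (j < i)%N -> (T0 'X^i - 'X^i)`_j != 0 -> p k (v j) != 0 -> (t i <= l)%N) ->
  exists B, forall c, q k (T0 c - c) <= B * q l c.
Proof.
move=> hsize hbin htype; pose D i := T0 'X^i - 'X^i.
pose A k i := \sum_(j < i) 'C(i, j)%:R * ((s j)%:R * p k (v j)).
have A0 k' i : 0 <= A k' i.
  by apply: sumr_ge0 => j _; rewrite !mulr_ge0 // (semi_ge0 hn (hp _)).
have hD i : q k (D i) <= A k i.
  rewrite -(coefK (D i)) poly_def; apply: le_trans (semi_lincomb hn (q_seminorm k) _ _ _ _) _.
  rewrite /A (big_ord_widen _ (fun j => nrm (D i)`_j * q k 'X^j) (hsize i)) big_mkcond /=.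
  apply: ler_sum => j _; case: ifP => _; last by rewrite !mulr_ge0 // (semi_ge0 hn (hp _)).
  have -> : q k 'X^j = (s j)%:R * p k (v j).
    by rewrite /q scaled_basis_Xn (hp k).2 (absval_nat hn).
  apply: ler_wpM2r; last exact: hbin.
  by rewrite mulr_ge0 // (semi_ge0 hn (hp _)).
have qge k' c : 0 <= q k' c by exact: (semi_ge0 hn (q_seminorm k')).
have hterm i : exists Bi, (forall c, nrm c`_i * q k (D i) <= Bi * q l c) /\
    ((k <= i)%N -> Bi = 2^-1 ^+ i).
  have [D0|D0] := eqVneq (q k (D i)) 0.
    exists (2^-1 ^+ i); split => // c; rewrite D0 mulr0 mulr_ge0 ?exprn_ge0 ?invr_ge0 //.
  have til : (t i <= l)%N.
    apply: contraT => htl; case/negP: D0; apply/eqP.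
    apply/eqP; rewrite eq_le qge andbT.
    rewrite -(coefK (D i)) poly_def; apply: le_trans (semi_lincomb hn (q_seminorm k) _ _ _ _) _.
    rewrite big1 // => j _; have [->|cj] := eqVneq ((D i)`_j) 0.
      by rewrite (absval0 hn) mul0r.
    have ji : (j < i)%N by apply: leq_trans (hsize i).
    have [pz|pn] := eqVneq (p k (v j)) 0; last by rewrite (htype i j) in htl.
    by rewrite /q scaled_basis_Xn (hp k).2 pz !mulr0.
  have cb c : nrm c`_i <= C' i / (s i)%:R * q l c.
    rewrite mulrAC ler_pdivlMr //; apply: le_trans (coef_scaled_bound i c) _.
    apply: ler_wpM2l; first exact: normr_ge0.
    exact: (q_le q_monotone).
  case: (leqP k i) => [ki|ik].
    exists (2^-1 ^+ i); split => // c.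
    apply: (@le_trans _ _ (C' i / (s i)%:R * q l c * A i i)).
      apply: ler_pM => //; first exact: (absval_ge0 hn).
      apply: le_trans (hD i) _; apply: ler_sum => j _.
      by rewrite ler_wpM2l // ler_wpM2l //; apply: (q_le hmono).
    rewrite mulrAC; apply: ler_wpM2r => //; rewrite mulrAC ler_pdivrMr //.
    rewrite exprVn ler_pdivlMl ?exprn_gt0 // mulrA.
    by case: (hs i).
  exists (C' i / (s i)%:R * q k (D i)); split => [c|//].
  by rewrite mulrAC; apply: ler_wpM2r.
have [Bf hBf] := choice hterm.
exists (\sum_(i < k) `|Bf i| + 2) => c.
have -> : T0 c - c = \sum_(i < size c) c`_i *: D i.
  rewrite -{1 2}(coefK c) poly_def linear_sum -sumrB; apply: eq_bigr => i _.
  by rewrite linearZ scalerBr.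
apply: le_trans (semi_lincomb hn (q_seminorm k) _ _ _ _) _.
apply: (@le_trans _ _ (\sum_(i < size c) Bf i * q l c)).
  by apply: ler_sum => i _; case: (hBf i).
rewrite -mulr_suml; apply: ler_wpM2r => //.
pose G i := if (i < k)%N then `|Bf i| else 0.
have G0 i : 0 <= G i by rewrite /G; case: ifP.
have hG : \sum_(i < size c) G i <= \sum_(i < k) `|Bf i|.
  apply: (@le_trans _ _ (\sum_(i < size c + k) G i)).
    by rewrite big_split_ord /= lerDl sumr_ge0.
  rewrite addnC big_split_ord /= [X in _ + X]big1 ?addr0 => [|i _].
    by apply: ler_sum => i _; rewrite /G ltn_ord.
  by rewrite /G ltnNge leq_addr.
have geo n : \sum_(i < n) 2^-1 ^+ i = 2 - 2 * 2^-1 ^+ n :> R.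
  elim: n => [|n IH]; first by rewrite big_ord0 expr0 mulr1 subrr.
  by rewrite big_ord_recr /= IH exprS; field.
apply: (@le_trans _ _ (\sum_(i < size c) (G i + 2^-1 ^+ i))).
  apply: ler_sum => i _; have [_ h] := hBf i; rewrite /G.
  case: (ltnP i k) => ik; last by rewrite h // add0r.
  have := ler_norm (Bf i); have : 0 <= 2^-1 ^+ i :> R by rewrite exprn_ge0 // invr_ge0.
  by lra.
rewrite big_split /= geo; apply: lerD => //.
have : 0 <= 2^-1 ^+ size c :> R by rewrite exprn_ge0 // invr_ge0.
by lra.
Qed.

Lemma qcont_of_bound (T0 : {linear {poly K} -> {poly K}}) k l B :
  (forall c, q k (T0 c - c) <= B * q l c) -> exists l' B', forall c, q k (T0 c) <= B' * q l' c.
Proof.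
move=> hB; exists (maxn k l), (1 + `|B|) => c.
have h1 := (q_seminorm k).1 (T0 c - c) c; rewrite subrK in h1.
have h2 : q k c <= q (maxn k l) c by apply: (q_le q_monotone); rewrite leq_maxl.
have h3 : B * q l c <= `|B| * q (maxn k l) c.
  apply: (@le_trans _ _ (`|B| * q l c)).
    by apply: ler_wpM2r; [exact: (semi_ge0 hn (q_seminorm l))|exact: ler_norm].
  by apply: ler_wpM2l; [exact: normr_ge0|apply: (q_le q_monotone); rewrite leq_maxr].
by have := hB c; rewrite mulrDl mul1r; lra.
Qed.

(** The scheme yields an operator T on K[X] with a cyclic vector u; the model sends c to the image
    of c(T) u, so that multiplication by X becomes T. *)
Lemma cyclic_model_of_scheme (b : bool) (T0 : {linear {poly K} -> {poly K}}) :
  (b -> forall i, t i = 0%N) -> qcont q T0 -> bounded0 q b T0 -> transitive_ext q b T0 ->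
  exists Psi, cyclic_model v Psi.
Proof.
move=> hb h1 h2 h3.
have hcoef i : exists N B, (b -> N = 0%N) /\ forall c, nrm c`_i <= B * q N c.
  exists (t i), (C' i / (s i)%:R); split => [/hb -> //|c].
  by rewrite mulrAC ler_pdivlMr //; exact: coef_scaled_bound.
have [T [u [hT hsurj hinj hyp]]] := scheme_poly hn q_seminorm q_monotone hcoef
  (sf_separable hK) h1 h2 h3.
exists (Phi \o act T u); split.
- move=> c h0; have h : Phi (act T u c) = 0 by exact: h0.
  apply: hinj; apply/polyP => i; rewrite coef0.
  have := dual_scaled_basis i (act T u c); rewrite h linear0 => /esym/eqP.
  by rewrite mulf_eq0 pnatr_eq0 eqn0Ngt; case: (hs i) => -> _; rewrite orbF => /eqP.
- move=> i; have [c hc] := hsurj ((s i)%:R^-1 *: 'X^i); exists c.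
  change (Phi (act T u c) = v i).
  have PhiZ a r : Phi (a *: r) = a *: Phi r by exact: linearZ.
  rewrite -hc PhiZ scaled_basis_Xn scalerA mulVf ?scale1r //.
  by rewrite pnatr_eq0 -lt0n; case: (hs i).
- move=> c; exists (size (act T u c)), (fun i => (act T u c)`_i * (s i)%:R).
  by apply: eq_bigr => i _; rewrite scalerA.
- move=> k; have [l [B hB]] := hT k; exists l, B => c.
  change (q k (act T u ('X * c)) <= B * q l (act T u c)).
  by rewrite act_XM; exact: hB.
- move=> c y k e c0 e0.
  have hypc := hypercyclic_act hn q_seminorm q_monotone (sf_dense_ideals hK) hT hyp c0.
  have [m hm] := hypc (act T u y) k e e0; exists m.
  change (q k (act T u ('X^m * c - y)) <= e).
  by rewrite linearB /= act_XnM.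
Qed.

Lemma cyclic_model_bounded : (forall i, t i = 0%N) -> exists Psi, cyclic_model v Psi.
Proof.
move=> ht.
have hB k : exists B, forall c, q k (translation c - c) <= B * q 0 c.
  apply: triangular_bound => [i|i j|i j _ _ _].
  - by rewrite size_translation size_polyXn.
  - rewrite coefB /= comp_Xn_poly coef_exp_addX1 coefXn.
    case: eqP => [->|_]; first by rewrite binn subrr (absval0 hn) ler01.
    by rewrite subr0 (absval_nat hn).
  - by rewrite ht.
apply: (@cyclic_model_of_scheme true translation) => //.
- by move=> k; have [B h] := hB k; exact: qcont_of_bound h.
- move=> _; have [B h] := hB 0%N; exists (1 + B) => c.
  have := (q_seminorm 0).1 (translation c - c) c; rewrite subrK.
  by have := h c; rewrite mulrDl mul1r; lra.
- exact: (transitive_translation hn q_seminorm).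
Qed.

(** The operator changes X^(j+1) by X^j, so continuity compares the type of the vector j + 1 with
    the seminorms that see the vector j. *)
Lemma cyclic_model_windows :
  (forall k, exists l, forall j, p k (v j) != 0 -> (t j.+1 <= l)%N) ->
  (forall n, exists2 M, (n <= M)%N & forall j, (M - n <= j <= M.*2)%N -> p n (v j) = 0) ->
  exists Psi, cyclic_model v Psi.
Proof.
move=> htype hwin.
have hB k : exists l B, forall c, q k (descent c - c) <= B * q l c.
  have [l hl] := htype k; exists l.
  have coE i j : (descent 'X^i - 'X^i)`_j = (j.+1 == i)%:R :> K.
    by rewrite descentE addrAC subrr add0r coef_drop_poly coefXn addn1.
  apply: triangular_bound => [i|i j|i j ji].
  - by rewrite size_descent size_polyXn.
  - rewrite coE (absval_nat hn) ler_nat; case: eqP => // <-.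
    by rewrite binSn.
  - rewrite coE; have [<- _|_] := eqVneq j.+1 i; first exact: hl.
    by rewrite eqxx.
apply: (@cyclic_model_of_scheme false descent) => //.
- by move=> k; have [l [B h]] := hB k; exact: qcont_of_bound h.
- apply: (transitive_descent hn q_seminorm q_monotone) => n.
  have [M nM hM] := hwin n; exists M => // j hj.
  by rewrite /q scaled_basis_Xn (hp n).2 hM ?mulr0.
Qed.

End CyclicModels.

(** * Reorderings of the basis *)

Section Enumerations.

Definition infinitely_often (P : nat -> Prop) : Prop := forall N, exists2 r, (N <= r)%N & P r.

Lemma enumeration (P : nat -> Prop) : infinitely_often P ->
  exists f : nat -> nat, [/\ injective f, forall i, P (f i) & forall r, P r -> exists i, f i = r].
Proof.
move=> hP.
have ex N : exists r, (N <= r)%N && `[< P r >].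
  by have [r h1 h2] := hP N; exists r; rewrite h1; apply/asboolP.
pose nxt N := ex_minn (ex N).
have [n1 n2 n3] : [/\ forall N, (N <= nxt N)%N, forall N, P (nxt N) &
    forall N r, (N <= r)%N -> P r -> (nxt N <= r)%N].
  split=> N; rewrite /nxt; case: ex_minnP => m /andP[h1 /asboolP h2] h3 //.
  by move=> r hr hPr; apply: h3; rewrite hr; apply/asboolP.
pose f := fix f i := if i is j.+1 then nxt (f j).+1 else nxt 0%N.
have fS i : (f i < f i.+1)%N by exact: n1.
have fP i : P (f i) by case: i => [|i]; exact: n2.
have mono i j : (i < j)%N -> (f i < f j)%N.
  elim: j => // j IH; rewrite ltnS leq_eqVlt => /orP[/eqP -> //|/IH h].
  exact: ltn_trans h (fS j).
exists f; split => //.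
  move=> i j h; case: (ltngtP i j) => // /mono; by rewrite h ltnn.
move=> r hr.
have key i : (r < f i)%N -> exists j, f j = r.
  elim: i => [|i IH] hi; first by have := n3 0%N r (leq0n _) hr; rewrite leqNgt hi.
  case: (ltngtP r (f i)) => [/IH //|h|->]; last by exists i.
  by have := n3 (f i).+1 r h hr; rewrite leqNgt hi.
have fge i : (i <= f i)%N by elim: i => // i IH; exact: leq_ltn_trans IH (fS i).
by apply: (key r.+1); exact: fge.
Qed.

(** For each value s, the k-th index where [t] equals s is sent to the k-th place where [tau] equals
    s. *)
Lemma matching_reordering (t tau : nat -> nat) :
  (forall s, infinitely_often (fun r => t r = s)) ->
  (forall s, infinitely_often (fun i => tau i = s)) ->
  exists f : nat -> nat,
    [/\ injective f, forall i, t (f i) = tau i & forall r, exists i, f i = r].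
Proof.
move=> ht htau.
have [P hP] := choice (fun s => enumeration (ht s)).
have [S hS] := choice (fun s => enumeration (htau s)).
have hex i : exists j, S (tau i) j = i by have [_ _ h] := hS (tau i); exact: h.
have [rk hrk] := choice hex.
have tP s i : t (P s i) = s by have [_ h _] := hP s; exact: h.
exists (fun i => P (tau i) (rk i)); split => [i j h|i|r]; [|exact: tP|].
  have hs : tau i = tau j by rewrite -(tP (tau i) (rk i)) h tP.
  rewrite -(hrk i) -(hrk j) hs; congr (S _ _).
  by rewrite hs in h; have [inj _ _] := hP (tau j); exact: inj h.
have [_ _ /(_ r erefl)[j hj]] := hP (t r).
have [injS hSt _] := hS (t r).
exists (S (t r) j); have h := hrk (S (t r) j); rewrite hSt in h *.
by rewrite (injS _ _ h).
Qed.

(* Restarts at 0 at every power of 4, so that every value recurs, increments never exceed 1, and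
   some stretch [[M - n, 2 M]] stays above [n]. *)
Definition zigzag (i : nat) : nat := (i - 4 ^ trunc_log 4 i)%N.

Lemma zigzagE a j : (4 ^ a <= j < 4 ^ a.+1)%N -> zigzag j = (j - 4 ^ a)%N.
Proof. by move=> h; rewrite /zigzag (trunc_log_eq _ h). Qed.

Lemma zigzag_infinitely_often s : infinitely_often (fun i => zigzag i = s).
Proof.
move=> N; pose a := maxn N s.
have ha : (a < 4 ^ a)%N by exact: ltn_expl.
have [hN hs] : (N <= a)%N /\ (s <= a)%N by rewrite leq_maxl leq_maxr.
exists (4 ^ a + s)%N; first by lia.
by rewrite (@zigzagE a) ?addKn // expnS; lia.
Qed.

Lemma zigzag_step i : (zigzag i.+1 <= (zigzag i).+1)%N.
Proof.
case: i => [|i]; first by rewrite (@zigzagE 0).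
have := @trunc_log_bounds 4 i.+1 isT isT; set a := trunc_log 4 i.+1 => /andP[h1 h2].
rewrite (@zigzagE a i.+1) ?h1 //.
case: (ltnP i.+2 (4 ^ a.+1)) => h3.
  by rewrite (@zigzagE a i.+2) ?(leqW h1) //; lia.
have -> : i.+2 = (4 ^ a.+1)%N by apply/eqP; rewrite eqn_leq h2 h3.
rewrite (@zigzagE a.+1) ?subnn //.
by rewrite leqnn /= ltn_exp2l // ltnSn.
Qed.

Lemma zigzag_window n : exists2 M, (n <= M)%N &
  forall j, (M - n <= j <= M.*2)%N -> (n < zigzag j)%N.
Proof.
(* With M = 4^a + 2 n + 1 the interval from M - n = 4^a + n + 1 to 2 M ends before 4^(a+1), because
   4 n + 4 < 4^a. *)
pose a := (4 * n + 4)%N; have ha : (a < 4 ^ a)%N by exact: ltn_expl.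
exists (4 ^ a + n.*2.+1)%N; first by lia.
by move=> j hj; rewrite (@zigzagE a) ?expnS; lia.
Qed.

End Enumerations.

(** * Operators all of whose nonzero orbits are dense *)

Section HypercyclicOperators.
Context {R : realType} {K : numFieldType} {W : lmodType K}.
Variables (nrm : K -> R) (hK : scalar_field nrm).
Let hn := sf_absval hK.

Definition has_minimal_operator (p : nat -> W -> R) : Prop :=
  exists T : {linear W -> W}, qcont p T /\ forall x, x != 0 -> hypercyclic p T x.

Lemma minimal_operator_equiv (p p' : nat -> W -> R) :
  (forall k, seminorm nrm (p k)) -> (forall k x, p k x <= p k.+1 x) ->
  (exists kap : nat -> nat, [/\ forall k, (k <= kap k)%N & forall k, p' k = p (kap k)]) ->
  has_minimal_operator p' -> has_minimal_operator p.
Proof.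
move=> hp hmono [kap [hkap hp']] [T [hT hx]]; exists T; split.
  move=> k; have [l [C hC]] := hT k; exists (kap l), C => x.
  by apply: le_trans (q_le hmono _ (hkap k)) _; rewrite -!hp'.
move=> x x0 y k e e0; have [m hm] := hx x x0 y k e e0; exists m.
by apply: le_trans (q_le hmono _ (hkap k)) _; rewrite -hp'.
Qed.

Lemma minimal_operator_of_model (p : nat -> W -> R) (v : nat -> W) Psi :
  (forall x, exists n (a : nat -> K), x = \sum_(i < n) a i *: v i) ->
  cyclic_model p v Psi -> has_minimal_operator p.
Proof.
move=> hspan [inj hbasis _ hcont hdense].
have surj x : exists c, Psi c = x.
  have [cb hcb] := choice hbasis; have [n [a ->]] := hspan x.
  exists (\sum_(i < n) a i *: cb i).
  by rewrite linear_sum; apply: eq_bigr => i _; rewrite linearZ /= hcb.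
have [co hco] := choice surj.
have injB c d : Psi c = Psi d -> c = d.
  by move=> h; apply/eqP; rewrite -subr_eq0; apply/eqP/inj; rewrite linearB /= h subrr.
have coPsi c : co (Psi c) = c by apply: injB; rewrite hco.
have lin : linear (fun x => Psi ('X * co x)).
  move=> a x y; rewrite -linearP scalerAr -mulrDr; congr (Psi (_ * _)).
  by apply: injB; rewrite hco linearP /= !hco.
exists (mk_linear lin); split.
  move=> k; have [l [C hC]] := hcont k; exists l, C => x.
  by rewrite -{2}(hco x); exact: hC.
move=> x x0 y k e e0.
have c0 : co x != 0 by apply: contraNneq x0 => h; rewrite -(hco x) h linear0.
have [m hm] := hdense (co x) (co y) k e c0 e0; exists m.
suff -> : iter m (mk_linear lin) x = Psi ('X^m * co x) by rewrite -[X in _ - X](hco y) -linearB.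
elim: m {hm} => [|m IH]; first by rewrite expr0 mul1r hco.
by rewrite iterS IH /= coPsi exprS mulrA.
Qed.

Variables (p : nat -> W -> R) (hp : forall k, seminorm nrm (p k)).
Hypothesis hmono : forall k x, p k x <= p k.+1 x.
Variables (e : nat -> W) (f : nat -> {scalar W}) (t : nat -> nat).
Hypothesis hdual : forall i j, f i (e j) = (i == j)%:R.
Hypothesis hbound : forall r, exists C, forall x, nrm (f r x) <= C * p (t r) x.
Hypothesis hspan : forall x, exists n (a : nat -> K), x = \sum_(i < n) a i *: e i.

Let hbound_choice : exists C : nat -> R, forall r x, nrm (f r x) <= C r * p (t r) x.
Proof. by have [C hC] := choice hbound; exists C. Qed.

Lemma minimal_operator_bounded_types N : (forall r, (t r <= N)%N) -> has_minimal_operator p.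
Proof.
(* Renumbering the seminorms from N on makes the first one bound all coordinate functionals. *)
move=> ht; pose p' k := p (k + N)%N.
apply: (@minimal_operator_equiv p p') => //.
  by exists (fun k => (k + N)%N); split => // k; exact: leq_addr.
have hp' k : seminorm nrm (p' k) by exact: hp.
have hmono' k x : p' k x <= p' k.+1 x by exact: hmono.
have [C hC] := hbound_choice.
have hC' r x : nrm (f r x) <= `|C r| * p' 0%N x.
  apply: le_trans (hC r x) _; apply: (@le_trans _ _ (`|C r| * p (t r) x)).
    by apply: ler_wpM2r; [exact: (semi_ge0 hn (hp _))|exact: ler_norm].
  by apply: ler_wpM2l => //; apply: (q_le hmono).
have [s hs] := exists_scale p' e (fun r => `|C r|).
have [Psi hPsi] := @cyclic_model_bounded _ _ _ _ hK _ hp' hmono' e f (fun=> 0%N) _ hdual hC' s hs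
  (fun=> erefl).
exact: minimal_operator_of_model hspan hPsi.
Qed.

Lemma minimal_operator_reordered (pi : nat -> nat) :
  injective pi -> (forall r, exists i, pi i = r) ->
  (forall k, exists l, forall j, p k (e (pi j)) != 0 -> (t (pi j.+1) <= l)%N) ->
  (forall n, exists2 M, (n <= M)%N &
     forall j, (M - n <= j <= M.*2)%N -> p n (e (pi j)) = 0) ->
  has_minimal_operator p.
Proof.
move=> inj surj htype hwin.
have [C hC] := hbound_choice.
have hdual' i j : f (pi i) (e (pi j)) = (i == j)%:R.
  by rewrite hdual (inj_eq inj).
have [s hs] := exists_scale p (e \o pi) (C \o pi).
have [Psi hPsi] := @cyclic_model_windows _ _ _ _ hK _ hp hmono (e \o pi) (f \o pi)
  (t \o pi) (C \o pi) hdual' (fun i => hC (pi i)) s hs htype hwin.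
apply: minimal_operator_of_model hPsi => x.
have [n [a ->]] := hspan x; have [rho hrho] := choice surj.
pose c := \sum_(i < n) a i *: 'X^(rho i) : {poly K}.
exists (size c), (fun j => c`_j).
have -> : \sum_(j < size c) c`_j *: (e \o pi) j = mk_linear (linear_by_basis (e \o pi)) c by [].
rewrite linear_sum; apply: eq_bigr => i _.
by rewrite linearZ linear_by_basis_Xn /= hrho.
Qed.

End HypercyclicOperators.

Section FibreCases.
Context {R : realType} {K : numFieldType} {W : lmodType K}.
Variables (nrm : K -> R) (hK : scalar_field nrm).
Let hn := sf_absval hK.
Variables (p : nat -> W -> R) (hp : forall k, seminorm nrm (p k)).
Hypothesis hmono : forall k x, p k x <= p k.+1 x.
Variables (e : nat -> W) (f : nat -> {scalar W}) (t : nat -> nat).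
Hypothesis hdual : forall i j, f i (e j) = (i == j)%:R.
Hypothesis hzero : forall r k, (k < t r)%N -> p k (e r) = 0.
Hypothesis hbound : forall r, exists C, forall x, nrm (f r x) <= C * p (t r) x.
Hypothesis hspan : forall x, exists n (a : nat -> K), x = \sum_(i < n) a i *: e i.

(** Types tend to infinity, so each seminorm sees only finitely many basis vectors and the given
    order already has windows. *)
Lemma minimal_operator_finite_fibres :
  (forall k, exists M, forall r, (M <= r)%N -> (k < t r)%N) -> has_minimal_operator p.
Proof.
move=> hfin; apply: (@minimal_operator_reordered _ _ _ _ hK p hp hmono e f t hdual hbound hspan id) => //.
- by move=> r; exists r.
- move=> k; have [M hM] := hfin k; exists (\max_(j < M) t j.+1) => j hj.
  have jM : (j < M)%N.
    by rewrite ltnNge; apply: contra hj => /hM h; apply/eqP/hzero.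
  exact: (@leq_bigmax _ (fun j : 'I_M => t j.+1) (Ordinal jM)).
- move=> n; have [M hM] := hfin n; exists (M + n)%N; first exact: leq_addl.
  by move=> j /andP[h _]; rewrite addnK in h; apply: hzero; exact: hM.
Qed.

(** Keeping only the seminorms at levels with infinite fibres makes every fibre of the new types
    [lev] infinite, so the basis can be ordered with types following the zigzag. A vector seen at
    level k is then followed by one of type at most k + 1, whence continuity, and the high stretches
    are the windows. *)
Lemma minimal_operator_infinite_fibres :
  (forall N, exists2 k, (N <= k)%N & infinitely_often (fun r => t r = k)) ->
  has_minimal_operator p.
Proof.
move=> hinf.
have hex N : exists k, (N <= k)%N /\ infinitely_often (fun r => t r = k).
  by have [k h1 h2] := hinf N; exists k.
have [nx hnx] := choice hex.
pose kap := fix kap i := if i is j.+1 then nx (kap j).+1 else nx 0%N.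
have kapS i : (kap i < kap i.+1)%N by case: (hnx (kap i).+1).
have kapI i : infinitely_often (fun r => t r = kap i).
  by case: i => [|i]; [case: (hnx 0%N)|case: (hnx (kap i).+1)].
have kap_mono i j : (i < j)%N -> (kap i < kap j)%N.
  elim: j => // j IH; rewrite ltnS leq_eqVlt => /orP[/eqP -> //|/IH h].
  exact: ltn_trans h (kapS j).
have kap_ge i : (i <= kap i)%N by elim: i => // i IH; exact: leq_ltn_trans IH (kapS i).
have exl r : exists s, (t r <= kap s)%N by exists (t r).
pose lev r := ex_minn (exl r).
have [lev1 lev2] : (forall r, (t r <= kap (lev r))%N) /\
    (forall r s, (t r <= kap s)%N -> (lev r <= s)%N).
  by split=> r; rewrite /lev; case: ex_minnP.
have levI s : infinitely_often (fun r => lev r = s).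
  move=> N; have [r h1 h2] := kapI s N; exists r => //.
  apply/eqP; rewrite eqn_leq lev2 ?h2 // leqNgt; apply/negP => /kap_mono.
  by rewrite -h2 ltnNge lev1.
have [pi [inj hpi surj]] := matching_reordering levI zigzag_infinitely_often.
pose p' k := p (kap k).
apply: (@minimal_operator_equiv _ _ _ nrm p p') => //; first by exists kap.
have hp' k : seminorm nrm (p' k) by exact: hp.
have hmono' k x : p' k x <= p' k.+1 x by apply: (q_le hmono); exact: ltnW.
have hzero' r k : (k < lev r)%N -> p' k (e r) = 0.
  move=> h; apply: hzero; rewrite ltnNge; apply/negP => /lev2.
  by rewrite leqNgt h.
have hbound' r : exists C, forall x, nrm (f r x) <= C * p' (lev r) x.
  have [C hC] := hbound r; exists `|C| => x; apply: le_trans (hC x) _.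
  apply: (@le_trans _ _ (`|C| * p (t r) x)).
    by apply: ler_wpM2r; [exact: (semi_ge0 hn (hp _))|exact: ler_norm].
  by apply: ler_wpM2l => //; apply: (q_le hmono).
have htype k : exists l, forall j, p' k (e (pi j)) != 0 -> (lev (pi j.+1) <= l)%N.
  exists k.+1 => j; rewrite !hpi => hj; apply: leq_trans (zigzag_step j) _.
  by rewrite ltnS -hpi leqNgt; apply: contra hj => h; apply/eqP/hzero'.
have hwin n : exists2 M, (n <= M)%N &
    forall j, (M - n <= j <= M.*2)%N -> p' n (e (pi j)) = 0.
  have [M nM hM] := zigzag_window n; exists M => // j hj.
  by apply: hzero'; rewrite hpi; exact: hM.
exact: (@minimal_operator_reordered _ _ _ _ hK p' hp' hmono' e f lev hdual hbound' hspan pi).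
Qed.

End FibreCases.

(** * Coupling with the backward shift *)

Section ProductWithSequences.
Context {R : realType} {K : numFieldType}.
Variables (nrm : K -> R) (hK : scalar_field nrm).
Let hn := sf_absval hK.
Variables (q : nat -> {poly K} -> R) (hq : forall k, seminorm nrm (q k)).
Hypothesis hmono : forall k x, q k x <= q k.+1 x.
Hypothesis hX : forall k, exists l C, forall c, q k ('X * c) <= C * q l c.
Hypothesis hdense : forall c y k e, c != 0 -> 0 < e -> exists m, q k ('X^m * c - y) <= e.
Variable eta : nat -> {scalar {poly K}}.
Hypothesis eta_lt : forall k j, (j < k)%N -> eta k 'X^j = 0.
Hypothesis eta_eq : forall k, eta k 'X^k = 1.
Hypothesis eta_bound : forall k, exists l C, forall y, nrm (eta k y) <= C * q l y.

Let A : lmodType K := ({poly K} * {poly K})%type.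
Implicit Types (a : nat -> K) (x : A).

Definition prod_seminorm k x : R := q k x.1 + \sum_(i < k) nrm (x.2)`_i.
Local Notation r := prod_seminorm.

Lemma prod_seminormP k : seminorm nrm (r k).
Proof.
split=> [x y|c x]; rewrite /r.
  rewrite addrACA -big_split /=; apply: lerD; first exact: (hq k).1.
  by apply: ler_sum => i _; rewrite coefD; exact: absvalD hn _ _.
rewrite (hq k).2 mulrDr mulr_sumr; congr (_ + _).
by apply: eq_bigr => i _; rewrite coefZ (absvalM hn).
Qed.

Lemma prod_seminorm_mono k x : r k x <= r k.+1 x.
Proof.
rewrite /r big_ord_recr /= addrA -[leLHS]addr0.
by apply: lerD; [rewrite lerD2r|exact: absval_ge0].
Qed.

Lemma eta_small k (y : {poly K}) : (size y <= k)%N -> eta k y = 0.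
Proof.
move=> h; rewrite -(coefK y) poly_def linear_sum big1 // => i _.
by rewrite linearZ /= eta_lt ?mulr0 // (leq_trans (ltn_ord i)).
Qed.

(* [coupling a] feeds the sequence component of the backward shift. By triangularity of [eta], the
   parameter [a n] first acts on the orbit of [u0] at time [uphalf n], and it then travels along
   the entries [i] at time [m] with [i + m = n.+1]. *)
Definition coupling a (y : {poly K}) : {poly K} :=
  \poly_(i < size y) (a i.*2 * eta i y + a i.*2.+1 * eta i.+1 y).

Lemma coef_coupling a y i :
  (coupling a y)`_i = a i.*2 * eta i y + a i.*2.+1 * eta i.+1 y.
Proof.
rewrite coef_poly; case: ltnP => // h.
by rewrite !eta_small ?(leqW h) // !mulr0 addr0.
Qed.

Lemma feed_linear a : linear (fun x : A => ('X * x.1 + ((x.2)`_0)%:P, coupling a x.1 + drop_poly 1 x.2) : A).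
Proof.
move=> c [y z] [y' z']; congr (_, _) => /=.
  rewrite mulrDr -scalerAr scalerDr addrACA; congr (_ + _).
  by rewrite coefD coefZ polyCD polyCM mul_polyC.
apply/polyP => i; rewrite scalerDr !coefD !coefZ !coef_coupling !coef_drop_poly coefD coefZ.
by rewrite !scalarP; ring.
Qed.

Definition feed a : {linear A -> A} := mk_linear (feed_linear a).

Let u0 : A := (1, 0).
Let Y a m := (iter m (feed a) u0).1.
Let Z a m := (iter m (feed a) u0).2.

Let YS a m : Y a m.+1 = 'X * Y a m + ((Z a m)`_0)%:P. Proof. by []. Qed.

Let ZS a m i : (Z a m.+1)`_i =
  (Z a m)`_i.+1 + (a i.*2 * eta i (Y a m) + a i.*2.+1 * eta i.+1 (Y a m)).
Proof.
have -> : Z a m.+1 = coupling a (Y a m) + drop_poly 1 (Z a m) by [].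
by rewrite coefD coef_coupling coef_drop_poly addn1 addrC.
Qed.

Let Y_monic a m : size (Y a m) = m.+1 /\ (Y a m)`_m = 1.
Proof.
elim: m => [|m [IH1 IH2]]; first by rewrite /Y /= size_poly1 coef1.
have Y0 : Y a m != 0 by rewrite -size_poly_eq0 IH1.
split; last by rewrite YS coefD coefXM coefC /= addr0.
rewrite YS size_polyDl mulrC size_mulX // IH1 //.
by apply: leq_ltn_trans (size_polyC_leq1 _) _.
Qed.

Let eta_Y a k m : (m < k)%N -> eta k (Y a m) = 0.
Proof. by move=> h; apply: eta_small; case: (Y_monic a m) => ->. Qed.

Let eta_YY a m : eta m (Y a m) = 1.
Proof.
have [h1 h2] := Y_monic a m.
have -> : Y a m = 'X^m + (Y a m - 'X^m) by rewrite addrC subrK.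
rewrite linearD /= eta_eq eta_small ?addr0 //.
apply/leq_sizeP => j; rewrite leq_eqVlt => /orP[/eqP <-|mj].
  by rewrite coefB h2 coefXn eqxx subrr.
by rewrite coefB coefXn gtn_eqF // nth_default ?subrr // h1.
Qed.

(** The step from time m adds to entry i only parameters a_j with j <= i + m, since eta_i vanishes
    on Y_m for m < i. The sum of entry index and time does not change under the backward shift, so
    it bounds the parameters involved. *)
Lemma orbit_local a a' L : (forall j, (j < L)%N -> a j = a' j) -> forall m,
  ((m <= L.+1)%N -> Y a m = Y a' m) /\
  (forall i, (i + m <= L)%N -> (Z a m)`_i = (Z a' m)`_i).
Proof.
move=> h; elim=> [|m [IH1 IH2]]; first by [].
split=> [hm|i hi]; first by rewrite !YS IH1 ?IH2 //; lia.
rewrite !ZS IH2 ?IH1; [|by lia..]; congr (_ + (_ + _)).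
  case: (leqP i m) => im; last by rewrite eta_Y // !mulr0.
  by rewrite h //; lia.
case: (leqP i.+1 m) => im; last by rewrite eta_Y // !mulr0.
by rewrite h //; lia.
Qed.

(** On this antidiagonal a_n enters at the step from time [uphalf n], with coefficient 1: for n = 2
    i it multiplies the value of eta_i at Y_i, for n = 2 i + 1 that of eta_(i+1) at Y_(i+1). Later
    steps along the antidiagonal only add terms with smaller parameters. *)
Lemma orbit_sensitivity a a' n : (forall j, (j < n)%N -> a j = a' j) -> forall m i,
  (i + m = n.+1)%N ->
  (Z a m)`_i = (Z a' m)`_i + (if (uphalf n < m)%N then a n - a' n else 0).
Proof.
move=> h; elim=> [|m IH] i him; first by rewrite addr0.
have hY : Y a m = Y a' m by case: (orbit_local h m) => hY _; apply: hY; lia.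
rewrite !ZS (IH i.+1); last by lia.
rewrite hY; case: (ltngtP m (uphalf n)) => hm.
- have -> : (uphalf n < m.+1)%N = false by lia.
  rewrite addr0 addr0; congr (_ + _).
  rewrite !eta_Y ?mulr0 //; lia.
- have -> : (uphalf n < m.+1)%N by lia.
  have im : (i < m)%N by lia.
  rewrite (h i.*2); last by lia.
  by rewrite (h i.*2.+1); [ring|lia].
- have -> : (uphalf n < m.+1)%N by lia.
  rewrite addr0 -addrA; congr (_ + _).
  case: (boolP (odd n)) => on.
    have hin : i.*2.+1 = n by lia.
    have him1 : i.+1 = m by lia.
    rewrite hin him1 eta_YY !mulr1 h; last by lia.
    by rewrite -addrA [a' n + _]addrC subrK.
  have hin : i.*2 = n by lia.
  have him1 : i = m by lia.
  rewrite hin him1 eta_YY !mulr1 !(@eta_Y _ m.+1 m) // !mulr0 !addr0.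
  by rewrite addrC subrK.
Qed.

Let Z_agree a a' L m i : (forall j, (j < L)%N -> a j = a' j) -> (i + m <= L)%N ->
  (Z a m)`_i = (Z a' m)`_i.
Proof. by move=> h; have [_ hZ] := orbit_local h m; exact: hZ. Qed.

(** One parameter at a time: a_n moves the prescribed entry of its antidiagonal by its own increment
    and leaves the earlier antidiagonals alone. With tau n = n + 1 the prescribed entry is entry 0,
    the one leaving the shift. *)
Lemma prescribed_outflow a L (tau : nat -> nat) (val : nat -> K) :
  (forall n, (L <= n)%N -> (uphalf n < tau n <= n.+1)%N) ->
  exists a', (forall j, (j < L)%N -> a j = a' j) /\
    forall n, (L <= n)%N -> (Z a' (tau n))`_(n.+1 - tau n) = val n.
Proof.
move=> htau.
pose Inv n (S : nat -> K) := forall j, (j < n)%N ->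
  ((j < L)%N -> a j = S j) /\
  ((L <= j)%N -> (Z S (tau j))`_(j.+1 - tau j) = val j).
have sumE j : (L <= j)%N -> (j.+1 - tau j + tau j)%N = j.+1 by move=> /htau; lia.
have ZE n S S' j : (L <= j < n)%N -> (forall j, (j < n)%N -> S j = S' j) ->
    (Z S (tau j))`_(j.+1 - tau j) = (Z S' (tau j))`_(j.+1 - tau j).
  move=> /andP[Lj jn] h; apply: (@Z_agree _ _ n) => //; by rewrite sumE.
have hloc n S S' : (forall j, (j < n)%N -> S j = S' j) -> Inv n S -> Inv n S'.
  move=> h hI j jn; have [h1 h2] := hI j jn; rewrite -h //; split=> // Lj.
  by rewrite -(ZE n S S') ?Lj //; exact: h2.
have hext n S : Inv n S -> exists d, Inv n.+1 (update S n d).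
  move=> hI.
  have below d j : (j < n)%N -> S j = update S n d j by move=> jn; rewrite /update ltn_eqF.
  have extend d : ((n < L)%N -> a n = d) ->
      ((L <= n)%N -> (Z (update S n d) (tau n))`_(n.+1 - tau n) = val n) ->
      Inv n.+1 (update S n d).
    move=> h1 h2 j; rewrite ltnS leq_eqVlt => /orP[/eqP ->|jn].
      by split=> //; rewrite /update eqxx.
    exact: (hloc n S _ (below d) hI j jn).
  case: (ltnP n L) => nL; first by exists (a n); apply: extend => //; rewrite leqNgt nL.
  exists (S n + (val n - (Z S (tau n))`_(n.+1 - tau n))); apply: extend => [|_].
    by rewrite ltnNge nL.
  set d := S n + _.
  have below' j : (j < n)%N -> update S n d j = S j by move=> jn; rewrite -below.
  rewrite (orbit_sensitivity below' (sumE n nL)).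
  have -> : (uphalf n < tau n)%N by case/andP: (htau n nL).
  by rewrite /update eqxx /d; ring.
have inv0 : Inv 0%N a by [].
have [a' ha'] := sequence_by_extension hloc inv0 hext.
exists a'; split=> j hj; first by case: (ha' j.+1 j (ltnSn j)) => h _; exact: h.
by case: (ha' j.+1 j (ltnSn j)) => _ h; exact: h.
Qed.

(* While the entries leaving the shift are kept equal to 0, the polynomial component is only
   multiplied by 'X and comes close to [x.1] at some time [m]; the parameters released shortly
   before [m] write [x.2] into the shift at that time. *)
Lemma approach_target a L x k e : 0 < e -> exists a' L',
  [/\ (L < L')%N, forall j, (j < L)%N -> a j = a' j &
      exists m, forall b, (forall j, (j < L')%N -> a' j = b j) ->
        r k (iter m (feed b) u0 - x) <= e].
Proof.
move=> e0.
have [a1 [agr1 out1]] := @prescribed_outflow a L S (fun=> 0)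
  ltac:(by move=> n _; rewrite ltnSn uphalf_half -{2}(odd_double_half n); lia).
have Y1 j : Y a1 (L + j).+1 = 'X^j * Y a1 L.+1.
  elim: j => [|j IH]; first by rewrite addn0 expr0 mul1r.
  rewrite addnS YS IH; have := out1 (L + j)%N (leq_addr _ _).
  by rewrite subnn => ->; rewrite addr0 exprS mulrA.
(* The factor X^(k+1) makes P larger than k, so that the parameters of index P, ..., P + k - 1 have
   all entered by time m. *)
have c0 : 'X^(k.+1) * Y a1 L.+1 != 0.
  have Y0 : Y a1 L.+1 != 0 by rewrite -size_poly_eq0; case: (Y_monic a1 L.+1) => ->.
  by apply: mulf_neq0 => //; rewrite monic_neq0 ?monicXn.
have [m0 hm0] := hdense x.1 k c0 e0.
pose j := (m0 + k.+1)%N; pose P := (L + j)%N; pose m := P.+1.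
pose tau n := if (n < P + k)%N then m else n.+1.
have htau n : (P <= n)%N -> (uphalf n < tau n <= n.+1)%N.
  by rewrite /tau /m /P /j => hPn; case: (ltnP n) => hn'; apply/andP; split; lia.
have [a2 [agr2 out2]] := prescribed_outflow a1
  (fun n => if (n < P + k)%N then (x.2)`_(n.+1 - m) else 0) htau.
exists a2, (m + k)%N; split.
- by rewrite /m /P; lia.
- by move=> i iL; rewrite agr1 // agr2 // /P; lia.
exists m => b agr3.
have YE : Y b m = 'X^m0 * ('X^(k.+1) * Y a1 L.+1).
  rewrite mulrA -exprD -/j -Y1 -/P -/m.
  have [h _] := orbit_local agr3 m; rewrite -h; last by lia.
  by have [h' _] := orbit_local agr2 m; rewrite -h'.
have ZE i : (i < k)%N -> (Z b m)`_i = (x.2)`_i.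
  move=> ik; rewrite -(Z_agree agr3); last by rewrite addnC leq_add2l ltnW.
  have := out2 (P + i)%N (leq_addr _ _); rewrite /tau ltn_add2l ik.
  by have -> : ((P + i).+1 - m = i)%N by rewrite /m; lia.
change (q k (Y b m - x.1) + \sum_(i < k) nrm (Z b m - x.2)`_i <= e).
rewrite YE big1 ?addr0 // => i _.
by rewrite coefB ZE // subrr (absval0 hn).
Qed.

Lemma approach_targets (tgt : nat -> A) (lev : nat -> nat) (eps : nat -> R) :
  (forall n, 0 < eps n) ->
  exists a, forall n, exists m, r (lev n) (iter m (feed a) u0 - tgt n) <= eps n.
Proof.
move=> eps0.
have hstep (ns : nat * ((nat -> K) * nat)) : exists s' : (nat -> K) * nat,
    [/\ (ns.2.2 < s'.2)%N, forall j, (j < ns.2.2)%N -> ns.2.1 j = s'.1 j &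
      exists m, forall b, (forall j, (j < s'.2)%N -> s'.1 j = b j) ->
        r (lev ns.1) (iter m (feed b) u0 - tgt ns.1) <= eps ns.1].
  have [a' [L' h]] := approach_target ns.2.1 ns.2.2 (tgt ns.1) (lev ns.1) (eps0 ns.1).
  by exists (a', L').
have [next hnext] := choice hstep.
pose st := fix st n := if n is n'.+1 then next (n', st n') else ((fun=> 0) : nat -> K, 0%N).
have stS n : st n.+1 = next (n, st n) by [].
have Llt n : ((st n).2 < (st n.+1).2)%N by case: (hnext (n, st n)).
have Lge n : (n <= (st n).2)%N by elim: n => // n IH; exact: leq_ltn_trans IH (Llt n).
have Lmono n d : ((st n).2 <= (st (n + d)%N).2)%N.
  elim: d => [|d IH]; first by rewrite addn0.
  by rewrite addnS; exact: leq_trans IH (ltnW (Llt _)).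
have agr n d j : (j < (st n).2)%N -> (st n).1 j = (st (n + d)%N).1 j.
  elim: d => [|d IH] hj; first by rewrite addn0.
  rewrite addnS IH //; have [_ h _] := hnext ((n + d)%N, st (n + d)%N); apply: h.
  exact: leq_trans hj (Lmono n d).
pose a j := (st j.+1).1 j.
have agra n j : (j < (st n).2)%N -> (st n).1 j = a j.
  move=> hj; case: (leqP n j.+1) => h; first by rewrite (agr n (j.+1 - n)%N) // subnKC.
  by rewrite /a (agr j.+1 (n - j.+1)%N j (Lge j.+1)) subnKC // ltnW.
exists a => n; have [_ _ [m hm]] := hnext (n, st n); exists m.
by apply: hm => j hj; exact: (agra n.+1).
Qed.

Let bounded (g : A -> R) := exists l C, forall x, g x <= C * r l x.

Let boundedD g g' : bounded g -> bounded g' -> bounded (fun x => g x + g' x).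
Proof.
have up g1 l C l' : (forall x, g1 x <= C * r l x) -> (l <= l')%N ->
    forall x, g1 x <= `|C| * r l' x.
  move=> h ll x; apply: le_trans (h x) _; apply: (@le_trans _ _ (`|C| * r l x)).
    by apply: ler_wpM2r; [exact: (semi_ge0 hn (prod_seminormP l))|exact: ler_norm].
  by apply: ler_wpM2l => //; apply: (q_le prod_seminorm_mono).
move=> [l [C h]] [l' [C' h']]; exists (maxn l l'), (`|C| + `|C'|) => x.
by rewrite mulrDl; apply: lerD; [exact: up h (leq_maxl _ _) x|exact: up h' (leq_maxr _ _) x].
Qed.

Let boundedW g g' : (forall x, g x <= g' x) -> bounded g' -> bounded g.
Proof. by move=> h [l [C h']]; exists l, C => x; exact: le_trans (h x) (h' x). Qed.

Let bounded_scale c g : 0 <= c -> bounded g -> bounded (fun x => c * g x).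
Proof.
move=> c0 [l [C h]]; exists l, (c * C) => x.
by rewrite -mulrA; apply: ler_wpM2l.
Qed.

Let bounded_coef i : bounded (fun x => nrm (x.2)`_i).
Proof.
exists i.+1, 1 => x; rewrite mul1r /r big_ord_recr /= addrA lerDr addr_ge0 //.
  exact: (semi_ge0 hn (hq _)).
by apply: sumr_ge0 => j _; exact: absval_ge0.
Qed.

Let bounded_fst (g : {poly K} -> R) l C : (forall y, g y <= C * q l y) ->
  bounded (fun x => g x.1).
Proof.
move=> h; exists l, `|C| => x; apply: le_trans (h x.1) _.
apply: (@le_trans _ _ (`|C| * q l x.1)).
  by apply: ler_wpM2r; [exact: (semi_ge0 hn (hq l))|exact: ler_norm].
by apply: ler_wpM2l => //; rewrite /r lerDl; apply: sumr_ge0 => j _; exact: absval_ge0.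
Qed.

Lemma qcont_feed a : qcont r (feed a).
Proof.
move=> k; change (bounded (fun x => r k (feed a x))).
apply: boundedD => /=.
  apply: (boundedW (fun x => (hq k).1 ('X * x.1) ((x.2)`_0)%:P)); apply: boundedD.
    by have [l [C h]] := hX k; exact: bounded_fst h.
  apply: (boundedW (g' := fun x => q k 1 * nrm (x.2)`_0)) => [x|].
    by rewrite -alg_polyC (hq k).2 mulrC.
  apply: bounded_scale; [exact: (semi_ge0 hn (hq k))|exact: bounded_coef].
elim: k => [|k IH].
  by exists 0%N, 0 => x; rewrite big_ord0 mul0r.
apply: (boundedW (g' := fun x => \sum_(i < k) nrm (coupling a x.1 + drop_poly 1 x.2)`_i +
   (nrm (a k.*2) * nrm (eta k x.1) + nrm (a k.*2.+1) * nrm (eta k.+1 x.1) + nrm (x.2)`_(k + 1)))).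
  move=> x; rewrite big_ord_recr /=; apply: lerD => //.
  rewrite coefD coef_coupling coef_drop_poly.
  apply: le_trans (absvalD hn _ _) _; rewrite lerD2r.
  by apply: le_trans (absvalD hn _ _) _; rewrite !(absvalM hn).
have beta i c : bounded (fun x => nrm c * nrm (eta i x.1)).
  apply: bounded_scale; first exact: absval_ge0.
  by have [l [C h]] := eta_bound i; exact: bounded_fst h.
by apply: boundedD => //; apply: boundedD; [apply: boundedD|exact: bounded_coef].
Qed.

(** The first components of the iterates of [u0] are monic of degrees 0, 1, 2, ... *)
Lemma cyclic_projection a (y : {poly K}) : exists c, (act (feed a) u0 c).1 = y.
Proof.
have [n hn'] := ubnPleq (size y); elim: n => [|n IH] in y hn' *.
  by exists 0; rewrite linear0 /=; apply/esym/eqP; rewrite -size_poly_eq0 -leqn0.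
have [h1 h2] := Y_monic a n.
have [|c hc] := IH (y - y`_n *: Y a n).
  apply/leq_sizeP => j; rewrite leq_eqVlt => /orP[/eqP <-|nj].
    by rewrite coefB coefZ h2 mulr1 subrr.
  by rewrite coefB coefZ [y`_j]nth_default ?(leq_trans hn') // [_`_j]nth_default ?h1 // mulr0 subrr.
exists (c + y`_n *: 'X^n); rewrite linearD linearZ /= act_Xn hc.
by rewrite subrK.
Qed.

(** Since the coupling vanishes at 0, (0, z) is mapped to z_0 u0 + (0, shifted z). After k steps the
    sequence is used up, and its entries have become the coefficients of a polynomial applied to
    [u0]. *)
Lemma iterates_of_sequence a k (z : {poly K}) : (size z <= k)%N -> exists d : {poly K},
  [/\ (size d <= k)%N, iter k (feed a) (0, z) = act (feed a) u0 d & d = 0 -> z = 0].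
Proof.
elim: k z => [|k IH] z hz.
  have -> : z = 0 by apply/eqP; rewrite -size_poly_eq0 -leqn0.
  by exists 0; split=> //; rewrite ?size_poly0 ?linear0.
have [|d [hd1 hd2 hd3]] := IH (drop_poly 1 z).
  by rewrite size_drop_poly; lia.
exists (z`_0 *: 'X^k + d); split.
- apply: leq_trans (size_polyD _ _) _; rewrite geq_max (leqW hd1) andbT.
  by apply: leq_trans (size_scale_leq _ _) _; rewrite size_polyXn.
- rewrite iterSr linearD linearZ /= act_Xn -hd2 -linearZ -linearD; congr (iter k _ _).
  have c0 : coupling a (0 : {poly K}) = 0.
    by apply/polyP => i; rewrite coef_coupling !linear0 !mulr0 addr0 coef0.
  rewrite c0 mulr0 !add0r; congr (_, _) => /=; last by rewrite scaler0 add0r.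
  by rewrite addr0 alg_polyC.
move=> h0; have z0 : z`_0 = 0.
  have := congr1 (fun p : {poly K} => p`_k) h0.
  by rewrite coefD coefZ coefXn eqxx mulr1 coef0 [d`_k]nth_default ?addr0.
rewrite z0 scale0r add0r in h0; have := hd3 h0 => hdrop.
apply/polyP => -[|i]; rewrite coef0 //.
by have := congr1 (fun p : {poly K} => p`_i) hdrop; rewrite coef_drop_poly addn1 coef0.
Qed.

(** Here K[T] u0 is not the whole space: it contains no nonzero (0, z). But each x is c(T) u0 + (0,
    z), and [size z] iterations bring it into K[T] u0. It arrives at a nonzero point, because
    X^(size z) c cannot cancel a polynomial d of smaller degree, and d = 0 forces z = 0. *)
Lemma minimal_operator_product : has_minimal_operator r.
Proof.
have [yy1 hy1] := dense_targets hn hq (sf_separable hK).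
pose zeta k (z : {poly K}) := \sum_(i < k) nrm z`_i.
have hzeta k : seminorm nrm (zeta k).
  split=> [x y|c x]; rewrite /zeta; last first.
    by rewrite mulr_sumr; apply: eq_bigr => i _; rewrite coefZ (absvalM hn).
  by rewrite -big_split; apply: ler_sum => i _; rewrite coefD; exact: absvalD hn _ _.
have [yy2 hy2] := dense_targets hn hzeta (sf_separable hK).
pose code n : nat * nat * nat * nat := odflt (0, 0, 0, 0)%N (choice.unpickle n).
have [a ha] := @approach_targets (fun n => (yy1 (code n).1.1.1, yy2 (code n).1.1.2))
  (fun n => (code n).1.2) (fun n => (code n).2.+1%:R^-1)
  (fun n => ltac:(by rewrite invr_gt0 ltr0n)).
have hyp : hypercyclic r (feed a) u0.
  move=> x k e e0; have e30 : 0 < e / 3 by lra.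
  have [n1 _ h1] := hy1 x.1 k 0%N _ e30; have [n2 _ h2] := hy2 x.2 k 0%N _ e30.
  have [N [N0 hN]] := @small_nat R 1 _ e30.
  have [m hm] := ha (choice.pickle (n1, n2, k, N)); exists m.
  move: hm; rewrite /code choice.pickleK /= => hm.
  rewrite -(subrK ((yy1 n1, yy2 n2) : A) (iter m _ _)) -addrA.
  apply: le_trans ((prod_seminormP k).1 _ _) _.
  have h3 : r k ((yy1 n1, yy2 n2) - x) = q k (yy1 n1 - x.1) + zeta k (yy2 n2 - x.2) by [].
  rewrite h3.
  have h4 : N.+1%:R^-1 <= e / 3.
    apply: le_trans hN; rewrite mul1r lef_pV2 ?posrE ?ltr0n //.
    by rewrite ler_nat.
  have -> : e = e / 3 + (e / 3 + e / 3) by field.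
  exact: (lerD (le_trans hm h4) (lerD h1 h2)).
exists (feed a); split; first exact: qcont_feed.
move=> x x0; have [c hc] := cyclic_projection a x.1.
pose z := x.2 - (act (feed a) u0 c).2.
have xE : x = act (feed a) u0 c + ((0, z) : A).
  by rewrite [LHS]surjective_pairing [act _ _ _]surjective_pairing /z hc; congr (_, _);
    rewrite /= ?addr0 // addrC subrK.
have [d [hd1 hd2 hd3]] := iterates_of_sequence a (leqnn (size z)).
have iE : iter (size z) (feed a) x = act (feed a) u0 ('X^(size z) * c + d).
  rewrite {1}xE; transitivity (iter (size z) (feed a) (act (feed a) u0 c) + iter (size z) (feed a) (0, z)).
    exact: linearD.
  by rewrite hd2 -act_XnM linearD.
have nz : 'X^(size z) * c + d != 0.
  apply: contra x0 => /eqP h0.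
  have c0 : c = 0.
    apply/polyP => i; rewrite coef0.
    have := congr1 (fun p : {poly K} => p`_(i + size z)) h0.
    rewrite coefD coefXnM ltnNge leq_addl /= addnK coef0 [d`_ _]nth_default ?addr0 //.
    by rewrite (leq_trans hd1) // leq_addl.
  rewrite c0 mulr0 add0r in h0; rewrite xE c0 linear0 add0r.
  by apply/eqP; congr (_, _); exact: hd3.
have hx := hypercyclic_act hn prod_seminormP prod_seminorm_mono (sf_dense_ideals hK)
  (qcont_feed a) hyp nz.
move=> y k e e0; have [m hm] := hx y k e e0; exists (m + size z)%N.
by rewrite iterD iE.
Qed.

End ProductWithSequences.

(** * Transport along a linear homeomorphism *)

Section Transport.
Context {R : realType} {K : numFieldType} {V W : lmodType K}.
Variables (nrm : K -> R) (hn : absval nrm).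
Variables (r : nat -> V -> R) (p : nat -> W -> R).
Hypothesis hr : forall k, seminorm nrm (r k).
Variables (Theta : {linear V -> W}) (inv : W -> V).
Hypotheses (TK : cancel Theta inv) (KT : cancel inv Theta).
Hypothesis hTheta : forall k, exists l C, forall x, p k (Theta x) <= C * r l x.
Hypothesis hinv : forall k, exists l C, forall x, r k x <= C * p l (Theta x).

Lemma minimal_operator_transport : has_minimal_operator r -> has_minimal_operator p.
Proof.
have pos (U : lmodType K) (h : U -> R) (g : U -> R) C : seminorm nrm h ->
    (forall x, g x <= C * h x) -> forall x, g x <= (`|C| + 1) * h x.
  move=> hh hg x; apply: le_trans (hg x) _; apply: ler_wpM2r; first exact: (semi_ge0 hn hh).
  by have := ler_norm C; lra.
have pos0 (C : R) : 0 < `|C| + 1 by have := normr_ge0 C; lra.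
move=> [T [hT hmin]].
have lin : linear (Theta \o (T \o inv)).
  have il : linear inv by move=> a x y; rewrite -{1}(KT x) -{1}(KT y) -linearP TK.
  by move=> a x y /=; rewrite il !linearP.
exists (mk_linear lin); split.
  move=> k; have [l [C /(pos _ _ _ _ (hr l)) h]] := hTheta k.
  have [l' [C' /(pos _ _ _ _ (hr l')) h']] := hT l.
  have [l2 [C2 h2]] := hinv l'.
  exists l2, ((`|C| + 1) * ((`|C'| + 1) * C2)) => x.
  apply: le_trans (h _) _; rewrite -!mulrA ler_pM2l //.
  apply: le_trans (h' _) _; rewrite ler_pM2l //.
  by apply: le_trans (h2 _) _; rewrite KT.
move=> x x0 y k e e0.
have [l [C /(pos _ _ _ _ (hr l)) h]] := hTheta k.
have ix0 : inv x != 0 by apply: contraNneq x0 => h0; rewrite -(KT x) h0 linear0.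
have [m hm] := hmin (inv x) ix0 (inv y) l (e / (`|C| + 1)) (divr_gt0 e0 (pos0 C)).
exists m.
have -> : iter m (mk_linear lin) x = Theta (iter m T (inv x)).
  by elim: m {hm} => [|m IH]; rewrite ?KT // iterS IH /= TK.
rewrite -{1}(KT y) -linearB; apply: le_trans (h _) _.
by rewrite mulrC -ler_pdivlMr.
Qed.

End Transport.

(** * The remaining case: a product with a space of sequences *)

Section MixedCase.
Context {R : realType} {K : numFieldType} {W : lmodType K}.
Variables (nrm : K -> R) (hK : scalar_field nrm).
Let hn := sf_absval hK.
Variables (p : nat -> W -> R) (hp : forall k, seminorm nrm (p k)).
Hypothesis hmono : forall k x, p k x <= p k.+1 x.
Variables (e : nat -> W) (f : nat -> {scalar W}) (t : nat -> nat).
Hypothesis hdual : forall i j, f i (e j) = (i == j)%:R.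
Hypothesis hzero : forall r k, (k < t r)%N -> p k (e r) = 0.
Hypothesis hbound : forall r, exists C, forall x, nrm (f r x) <= C * p (t r) x.
Hypothesis hspan : forall x, exists n (a : nat -> K), x = \sum_(i < n) a i *: e i.

Lemma injective_tends_to_infinity (g : nat -> nat) : injective g ->
  forall M, exists N, forall i, (N <= i)%N -> (M <= g i)%N.
Proof.
move=> inj; elim=> [|M [N IH]]; first by exists 0%N.
case: (pselect (exists i, g i = M)) => [[i hi]|none].
  exists (maxn N i.+1) => j; rewrite geq_max => /andP[hj ij].
  rewrite ltn_neqAle IH // andbT -hi (inj_eq inj); by rewrite ltn_eqF.
exists N => j hj; rewrite ltn_neqAle IH // andbT.
by apply/eqP => h; apply: none; exists j.
Qed.

Let f_lincomb (v : nat -> nat) n (a : nat -> K) i :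
  (forall j, v j <> i) -> f i (\sum_(j < n) a j *: e (v j)) = 0.
Proof.
move=> h; rewrite linear_sum big1 // => j _; rewrite linearZ /= hdual.
by case: eqP => [/esym /h //|_]; rewrite mulr0.
Qed.

(** In a family dual to Psi 1, ..., Psi X^k the last functional is a finite combination of
    coordinates with respect to [v], hence continuous. Its values on higher powers are not
    controlled, and the coupling is triangular for that reason. *)
Lemma triangular_functionals (v : nat -> W) (g : nat -> {scalar W}) (C : nat -> R)
    (p' : nat -> W -> R) (Psi : {linear {poly K} -> W}) :
  (forall k, seminorm nrm (p' k)) -> (forall k x, p' k x <= p' k.+1 x) ->
  (forall i j, g i (v j) = (i == j)%:R) -> (forall i x, nrm (g i x) <= C i * p' 0%N x) ->
  cyclic_model p' v Psi ->
  exists eta : nat -> {scalar {poly K}},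
    [/\ forall k j, (j < k)%N -> eta k 'X^j = 0, forall k, eta k 'X^k = 1 &
        forall k, exists l B, forall y, nrm (eta k y) <= B * p' l (Psi y)].
Proof.
move=> hp' hmono' hgv hg hPsi.
pose B := mk_linear (linear_by_basis v).
have BE c : exists b, B b = Psi c.
  have [n [a ->]] := cm_span hPsi c; exists (\sum_(i < n) a i *: 'X^i).
  by rewrite linear_sum; apply: eq_bigr => i _; rewrite linearZ linear_by_basis_Xn.
have coB (b : {poly K}) i : b`_i = g i (B b).
  rewrite /= linear_sum; case: (ltnP i (size b)) => hi.
    rewrite (bigD1 (Ordinal hi)) //= linearZ /= hgv eqxx mulr1 big1 ?addr0 // => j.
    by rewrite -val_eqE /= eq_sym linearZ /= hgv => /negbTE ->; rewrite mulr0.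
  rewrite nth_default // big1 // => j _; rewrite linearZ /= hgv.
  by rewrite gtn_eqF ?mulr0 // (leq_trans (ltn_ord j)).
have [co hco] := choice BE.
have lin : linear co.
  by move=> a x y; apply/polyP => i; rewrite coefD coefZ !coB !hco !linearP.
pose q N (b : {poly K}) := p' N (B b).
have hq N : seminorm nrm (q N) by exact: (seminorm_comp B (hp' N)).
have hcoef i : exists N D, (true -> N = 0%N) /\ forall b : {poly K}, nrm b`_i <= D * q N b.
  by exists 0%N, (C i); split=> // b; rewrite coB.
have hex k : exists eta : {scalar {poly K}}, [/\ forall j, (j < k)%N -> eta 'X^j = 0, eta 'X^k = 1 &
    exists l D, forall y, nrm (eta y) <= D * p' l (Psi y)].
  have hfree : forall c : 'I_k.+1 -> K, \sum_i c i *: co 'X^i = 0 -> forall i, c i = 0.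
    move=> c hc i; pose P := \poly_(j < k.+1) c (inord j).
    have PE : P = \sum_(j < k.+1) c j *: 'X^j.
      by rewrite /P poly_def; apply: eq_bigr => j _; rewrite inord_val.
    have P0 : P = 0.
      apply: (cm_inj hPsi); rewrite -hco -[co]/(mk_linear lin : _ -> _) PE.
      rewrite linear_sum -[RHS](linear0 B); congr (B _); rewrite -[RHS]hc.
      by apply: eq_bigr => j _; rewrite linearZ.
    have := congr1 (fun s : {poly K} => s`_i) P0.
    by rewrite coef_poly ltn_ord inord_val coef0.
  have [N [D [h [_ hd hb]]]] := dual_functionals hn hq (fun N b => hmono' N (B b)) hcoef hfree.
  have slin : scalar (fun y => h ord_max (co y)) by move=> a x y; rewrite lin linearP.
  exists (mk_scalar slin); split.
  - move=> j jk /=; have := hd ord_max (inord j); rewrite inordK ?(leqW jk) // => ->.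
    by rewrite -val_eqE /= inordK ?gtn_eqF // leqW.
  - by have := hd ord_max ord_max; rewrite eqxx.
  - by exists N, D => y /=; apply: le_trans (hb _ _) _; rewrite /q hco.
have [eta heta] := choice hex.
by exists eta; split=> [k|k|k]; have [] := heta k.
Qed.

(** [piY] lists the vectors of type at most k0 and [piZ] the others. From level k0 on, the first
    seminorm bounds all Y coordinates, which gives a cyclic model of the Y part. Each seminorm sees
    finitely many Z vectors, so the Z part carries the coordinatewise topology. *)
Lemma minimal_operator_mixed k0 :
  infinitely_often (fun r => (t r <= k0)%N) -> infinitely_often (fun r => (k0 < t r)%N) ->
  (forall k, exists M, forall r, (M <= r)%N -> (t r <= k0)%N \/ (k < t r)%N) ->
  has_minimal_operator p.
Proof.
move=> /enumeration[piY [injY hY surjY]] /enumeration[piZ [injZ hZ surjZ]] hfin.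
pose p' k := p (k + k0)%N.
have hp' k : seminorm nrm (p' k) by exact: hp.
have hmono' k x : p' k x <= p' k.+1 x by exact: hmono.
have [C hC] : exists C : nat -> R, forall r, 0 <= C r /\ forall x, nrm (f r x) <= C r * p (t r) x.
  have [C hC] := choice hbound; exists (fun r => `|C r|) => r; split=> // x.
  apply: le_trans (hC r x) _; apply: ler_wpM2r; [exact: (semi_ge0 hn (hp _))|exact: ler_norm].
have hC' i x : nrm (f (piY i) x) <= C (piY i) * p' 0%N x.
  have [C0 h] := hC (piY i); apply: le_trans (h x) _; apply: ler_wpM2l => //.
  exact: (q_le hmono).
have hdualY i j : f (piY i) (e (piY j)) = (i == j)%:R by rewrite hdual (inj_eq injY).
have [s hs] := exists_scale p' (e \o piY) (fun i => C (piY i)).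
have [Psi hPsi] := @cyclic_model_bounded _ _ _ _ hK p' hp' hmono' (e \o piY) (f \o piY)
  (fun=> 0%N) (fun i => C (piY i)) hdualY hC' s hs (fun=> erefl).
have [eta [eta1 eta2 eta3]] :=
  @triangular_functionals (e \o piY) (f \o piY) _ p' Psi hp' hmono' hdualY hC' hPsi.
pose q k y := p' k (Psi y).
have hq k : seminorm nrm (q k) by exact: (seminorm_comp Psi (hp' k)).
have hqmono k x : q k x <= q k.+1 x by exact: hmono'.
have hprod := minimal_operator_product hK hq hqmono (cm_cont hPsi) (cm_dense hPsi) eta1 eta2 eta3.
pose B := mk_linear (linear_by_basis (e \o piZ)).
have fB i z : f (piZ i) (B z) = z`_i.
  rewrite /= linear_sum; case: (ltnP i (size z)) => hi.
    rewrite (bigD1 (Ordinal hi)) //= linearZ /= hdual eqxx mulr1 big1 ?addr0 // => j.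
    by rewrite -val_eqE /= eq_sym linearZ /= hdual (inj_eq injZ) => /negbTE ->; rewrite mulr0.
  rewrite nth_default // big1 // => j _; rewrite linearZ /= hdual (inj_eq injZ).
  by rewrite gtn_eqF ?mulr0 // (leq_trans (ltn_ord j)).
have fPsi i y : f (piZ i) (Psi y) = 0.
  have [n [a ->]] := cm_span hPsi y; apply: f_lincomb => j h.
  by have := hZ i; rewrite -h ltnNge hY.
have lin : linear (fun x : {poly K} * {poly K} => Psi x.1 + B x.2).
  by move=> a x y; rewrite !linearP scalerDr addrACA.
pose Theta := mk_linear lin.
have fTheta i x : f (piZ i) (Theta x) = (x.2)`_i by rewrite linearD fPsi fB add0r.
have Tinj x : Theta x = 0 -> x = 0.
  move=> h; have z0 : x.2 = 0 by apply/polyP => i; rewrite -fTheta h linear0 coef0.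
  have : Psi x.1 + B x.2 = 0 by exact: h.
  rewrite z0 linear0 addr0 => /(cm_inj hPsi) y0.
  by rewrite [x]surjective_pairing y0 z0.
have Tsurj w : exists x, Theta x = w.
  have he r : exists x, Theta x = e r.
    case: (leqP (t r) k0) => [/surjY[i <-]|/surjZ[i <-]].
      by have [c hc] := cm_basis hPsi i; exists (c, 0); rewrite -[LHS]/(Psi c + B 0) linear0 addr0.
    by exists (0, 'X^i); rewrite -[LHS]/(Psi 0 + B 'X^i) linear0 add0r linear_by_basis_Xn.
  have [xe hxe] := choice he; have [n [a ->]] := hspan w.
  by exists (\sum_(i < n) a i *: xe i); rewrite linear_sum; apply: eq_bigr => i _; rewrite linearZ /= -hxe.
have [inv hinv] := choice Tsurj.
have TK : cancel Theta inv.
  by move=> x; apply/eqP; rewrite -subr_eq0; apply/eqP/Tinj; rewrite linearB hinv subrr.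
have hB k : exists M D, 0 <= D /\ forall z : {poly K}, p k (B z) <= D * \sum_(i < M) nrm z`_i.
  have [M1 hM1] := hfin k; have [M hM] := injective_tends_to_infinity injZ M1.
  pose D := \sum_(i < M) p k (e (piZ i)).
  have p0 x : 0 <= p k x by exact: (semi_ge0 hn (hp k)).
  exists M, D; split; first by apply: sumr_ge0.
  move=> z; apply: le_trans (semi_lincomb hn (hp k) _ _ _ _) _.
  pose n := maxn (size z) M.
  have -> : \sum_(i < size z) nrm z`_i * p k ((e \o piZ) i) = \sum_(i < n) nrm z`_i * p k (e (piZ i)).
    rewrite (big_ord_widen n (fun i => nrm z`_i * p k (e (piZ i)))) ?leq_maxl // big_mkcond /=.
    apply: eq_bigr => i _; case: ltnP => // h; by rewrite nth_default // (absval0 hn) mul0r.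
  have -> : \sum_(i < n) nrm z`_i * p k (e (piZ i)) = \sum_(i < M) nrm z`_i * p k (e (piZ i)).
    rewrite [RHS](big_ord_widen n (fun i => nrm z`_i * p k (e (piZ i)))) ?leq_maxr // [RHS]big_mkcond /=.
    apply: eq_bigr => i _; case: ltnP => // /hM/hM1; rewrite leqNgt hZ => -[//|h].
    by rewrite hzero // mulr0.
  rewrite mulr_sumr; apply: ler_sum => i _; rewrite mulrC; apply: ler_wpM2r; first exact: absval_ge0.
  by rewrite /D (bigD1 i) //= lerDl; apply: sumr_ge0.
have hcoefs M : exists l D, 0 <= D /\ forall x : {poly K} * {poly K}, \sum_(i < M) nrm (x.2)`_i <= D * p l (Theta x).
  elim: M => [|M [l [D [D0 h]]]]; first by exists 0%N, 0; split=> // x; rewrite big_ord0 mul0r.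
  have [C0 hCM] := hC (piZ M).
  exists (maxn l (t (piZ M))), (D + C (piZ M)); split; first exact: addr_ge0.
  move=> x; rewrite big_ord_recr /= mulrDl; apply: lerD.
    by apply: le_trans (h x) _; apply: ler_wpM2l => //; apply: (q_le hmono); rewrite leq_maxl.
  rewrite -fTheta; apply: le_trans (hCM _) _; apply: ler_wpM2l => //.
  by apply: (q_le hmono); rewrite leq_maxr.
apply: (@minimal_operator_transport _ _ _ _ nrm hn _ p (prod_seminormP hK hq) Theta inv TK hinv _ _ hprod).
  move=> k; have [M [D [D0 h]]] := hB k; exists (maxn k M), (1 + D) => x.
  apply: le_trans ((hp k).1 _ _) _; rewrite mulrDl mul1r.
  have up M' : (M' <= maxn k M)%N -> \sum_(i < M') nrm (x.2)`_i <= prod_seminorm nrm q (maxn k M) x.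
    move=> hM'; rewrite /prod_seminorm (big_ord_widen _ (fun i => nrm (x.2)`_i) hM') big_mkcond /=.
    rewrite -[leLHS]add0r; apply: lerD; first exact: (semi_ge0 hn (hq _)).
    by apply: ler_sum => i _; case: ifP => // _; exact: absval_ge0.
  apply: lerD; last first.
    by apply: le_trans (h _) _; apply: ler_wpM2l => //; apply: up; rewrite leq_maxr.
  apply: (@le_trans _ _ (q (maxn k M) x.1)).
    by apply: (q_le hmono); rewrite (leq_trans (leq_maxl k M)) ?leq_addr.
  by rewrite /prod_seminorm lerDl; apply: sumr_ge0 => i _; exact: absval_ge0.
(* The Y part is recovered as Theta x - B z, where the seminorm of B z is bounded by finitely many
   coordinates of z, and these by seminorms of Theta x. *)
move=> k; have [M [D [D0 h]]] := hB (k + k0)%N.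
have [l1 [D1 [D10 h1]]] := hcoefs M; have [l2 [D2 [D20 h2]]] := hcoefs k.
pose l := maxn (k + k0) (maxn l1 l2).
have [hl hl1 hl2] : [/\ (k + k0 <= l)%N, (l1 <= l)%N & (l2 <= l)%N].
  by rewrite /l !leq_max !leqnn !orbT.
exists l, (1 + D * D1 + D2) => x; rewrite mulrDl; apply: lerD; last first.
  by apply: le_trans (h2 x) _; apply: ler_wpM2l => //; apply: (q_le hmono).
have E : Psi x.1 = Theta x - B x.2 by rewrite /= addrK.
rewrite /q /p' E; apply: le_trans (semiB hn (hp _) _ _) _; rewrite mulrDl mul1r.
apply: lerD; first by apply: (q_le hmono).
apply: le_trans (h _) _; rewrite -mulrA; apply: ler_wpM2l => //.
by apply: le_trans (h1 x) _; apply: ler_wpM2l => //; apply: (q_le hmono).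
Qed.

End MixedCase.

(** * The case distinction on the fibres of the type function *)

Section CountableDimension.
Context {R : realType} {K : numFieldType}.
Variables (nrm : K -> R) (hK : scalar_field nrm).
Let hn := sf_absval hK.

Lemma minimal_operator_poly (q : nat -> {poly K} -> R) :
  (forall k, seminorm nrm (q k)) -> (forall k x, q k x <= q k.+1 x) ->
  (forall x, x != 0 -> exists k, 0 < q k x) ->
  has_minimal_operator q.
Proof.
move=> hq hmono hsep.
have [e [f [t [hdual hzero hbound hspan0]]]] :=
  exists_typed_basis hn (sf_hahn_banach hK) hq hmono hsep.
have hspan x : exists n (a : nat -> K), x = \sum_(i < n) a i *: e i.
  by have [n h] := hspan0 x; exists n, (fun i => f i x); exact: h.
case: (pselect (forall N, exists2 k, (N <= k)%N & infinitely_often (fun r => t r = k))) => [inf|].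
  exact: (minimal_operator_infinite_fibres hK hq hmono hdual hzero hbound hspan inf).
move=> /existsNP[k0 hk0].
have notio P : ~ infinitely_often P -> exists M, forall r, (M <= r)%N -> ~ P r.
  move=> /existsNP[M hM]; exists M => r hr Pr; apply: hM; by exists r.
have fin k : (k0 <= k)%N -> exists M, forall r, (M <= r)%N -> t r <> k.
  by move=> hk; apply: notio => h; apply: hk0; exists k.
(* From k0 on all fibres are finite, so for each k only finitely many vectors have a type in ]k0,
   k]. Which sides of k0 are infinite then selects the construction. *)
have hfin k : exists M, forall r, (M <= r)%N -> (t r <= k0)%N \/ (k < t r)%N.
  elim: k => [|k [M hM]].
    exists 0%N => r _; case: (posnP (t r)) => h; [by left; rewrite h|by right].
  case: (leqP k0 k.+1) => hk; last first.
    exists 0%N => r _; case: (leqP (t r) k0) => h; [by left|right; exact: ltn_trans hk h].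
  have [M' hM'] := fin k.+1 hk; exists (maxn M M') => r; rewrite geq_max => /andP[h1 h2].
  case: (hM r h1) => h; [by left|right]; rewrite ltn_neqAle h andbT.
  by apply/eqP => /esym; exact: hM'.
case: (pselect (infinitely_often (fun r => (k0 < t r)%N))) => [ioZ|/notio[M hM]]; last first.
  apply: (minimal_operator_bounded_types (N := maxn k0 (\max_(r < M) t r)) hK hq hmono hdual hbound hspan).
  move=> r; case: (ltnP r M) => hr; rewrite leq_max.
    by rewrite (@leq_bigmax _ (fun j : 'I_M => t j) (Ordinal hr)) orbT.
  by have := hM r hr => /negP; rewrite -leqNgt => ->.
case: (pselect (infinitely_often (fun r => (t r <= k0)%N))) => [ioY|/notio[M hM]].
  exact: (minimal_operator_mixed hK hq hmono hdual hzero hbound hspan ioY ioZ hfin).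
apply: (minimal_operator_finite_fibres hK hq hmono hdual hzero hbound hspan).
move=> k; have [M' hM'] := hfin k; exists (maxn M M') => r; rewrite geq_max => /andP[h1 h2].
by case: (hM' r h2) => // /(hM r h1).
Qed.

End CountableDimension.

From mathcomp Require Import all_classical all_reals all_analysis.
Import numFieldNormedType.Exports.

(** * Metrizable locally convex spaces *)

Section Gauge.
Context {R : realType} {K : numFieldType} {E : tvsType K}.
Variables (nrm : K -> R) (hK : scalar_field nrm).
Let hn := sf_absval hK.
Implicit Types (U V W : set E) (x y w : E) (c : K).

Lemma small_scalars x V : nbhs (0 : E) V -> exists d : R, 0 < d /\
  exists2 W, nbhs x W & forall c w, nrm c <= d -> W w -> V (c *: w).
Proof.
move=> V0; have [emb [nE _ eE]] := sf_embedding hK.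
have := @scale_continuous K E (0, x) V; rewrite scale0r => /(_ V0)[[B1 B2] /= [B1n B2n] hB].
have [dK /= dK0 hd] := (nbhs_ballP (0 : K^o) B1).1 B1n.
have nd0 : 0 < nrm dK by apply: (absval_gt0 hn); exact: lt0r_neq0.
exists (nrm dK / 2); split; first by lra.
exists B2 => // c w hc hw; apply: (hB (c, w)); split=> //=; apply: hd.
rewrite -ball_normE /= sub0r normrN nE -(gtr0_norm dK0) nE lt_neqAle eE.
rewrite (inj_eq (fmorph_inj emb)); apply/andP; split; last by lra.
by apply: contraTneq nd0 => h; rewrite -leNgt; lra.
Qed.

Definition real_convex V := forall s t x y, 0 < s -> 0 < t -> s + t = 1 ->
  V x -> V y -> forall emb : {rmorphism R -> K},
  (forall s t, (emb s <= emb t) = (s <= t)) -> V (emb s *: x + emb t *: y).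

Lemma convex_neighbourhood U : nbhs (0 : E) U -> exists V,
  [/\ nbhs (0 : E) V, V `<=` U & real_convex V].
Proof.
move=> U0; have [B Bconv [Bopen Bbasis]] := @locally_convex K E.
have [V [BV V0] VU] := Bbasis 0 U U0.
exists V; split=> //; first by apply: open_nbhs_nbhs; split=> //; exact: Bopen.
move=> s t x y s0 t0 st Vx Vy emb eE.
have es0 : 0 <= emb s by rewrite -(rmorph0 emb) eE ltW.
have es1 : emb s <= 1 by rewrite -(rmorph1 emb) eE; lra.
have := Bconv V (mem_set BV) x y (Itv01 es0 es1) (mem_set Vx) (mem_set Vy).
rewrite inE /conv /= /unstable.onem.
by have -> : 1 - emb s = emb t by rewrite -(rmorph1 emb) -rmorphB -st addrC addKr.
Qed.

(* Minkowski functional of the balanced core of a convex neighbourhood. *)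
Lemma exists_gauge U : nbhs (0 : E) U -> exists p : E -> R,
  [/\ seminorm nrm p, forall x, p x < 1 -> U x &
      forall e, 0 < e -> nbhs (0 : E) [set x | p x <= e]].
Proof.
move=> /convex_neighbourhood[V [V0 VU Vconv]].
have [emb [nE nemb eE]] := sf_embedding hK.
have emb_neq0 s : 0 < s -> emb s != 0 by move=> s0; rewrite fmorph_eq0 lt0r_neq0.
(* [t] lies in [G x] when x belongs to t times the balanced core of [V], the vectors that all
   scalars of modulus at most 1 keep in [V]. *)
pose G x := [set t : R | 0 < t /\ forall c, nrm c * t <= 1 -> V (c *: x)].
have Gne x : G x !=set0.
  have [d [d0 [W Wx hW]]] := small_scalars x V0.
  exists d^-1; split; first by rewrite invr_gt0.
  move=> c; rewrite ler_pdivrMr // mul1r => hc.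
  by apply: hW hc _; exact: nbhs_singleton.
have Glb x : lbound (G x) 0 by move=> t [t0 _]; exact: ltW.
have Ginf x : has_inf (G x) by split => //; exists 0.
pose p x := inf (G x).
have ple x t : G x t -> p x <= t by move=> h; apply: ge_inf => //; case: (Ginf x).
have pge x a : (forall t, G x t -> a <= t) -> a <= p x.
  by move=> h; apply: lb_le_inf => // t; exact: h.
have Gscale a x t : a != 0 -> G x t -> G (a *: x) (nrm a * t).
  move=> a0 [t0 h]; split; first by rewrite mulr_gt0 // (absval_gt0 hn).
  by move=> c hc; rewrite scalerA; apply: h; rewrite (absvalM hn) -mulrA.
have p0 x : 0 <= p x by apply: pge => t [/ltW].
have pZ1 a x : a != 0 -> p (a *: x) <= nrm a * p x.
  move=> a0; have na := absval_gt0 hn a0.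
  rewrite mulrC -ler_pdivrMr //; apply: pge => t /(Gscale a _ _ a0)/ple h.
  by rewrite ler_pdivrMr // mulrC.
exists p; split; [split=> [x y|a x]|move=> x hx|move=> e e0].
- suff key : forall s t, G x s -> G y t -> p (x + y) <= s + t.
    rewrite -lerBlDr; apply: (pge x) => s hs; rewrite lerBlDr -lerBlDl.
    by apply: (pge y) => t ht; rewrite lerBlDl; exact: key.
  move=> s' t' [s0 h1] [t0 h2]; apply: ple; split; first exact: addr_gt0.
  move=> c hc; pose S := s' + t'; have S0 : 0 < S by exact: addr_gt0.
  (* A convex combination, with weights s' / S and t' / S, of multiples of x and y that lie in
     [V]. *)
  have -> : c *: (x + y) = emb (s' / S) *: ((c * emb (S / s')) *: x)
      + emb (t' / S) *: ((c * emb (S / t')) *: y).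
    rewrite scalerDr !scalerA; congr (_ *: _ + _ *: _).
      by rewrite mulrCA -rmorphM mulrA divfK ?lt0r_neq0 // divff ?lt0r_neq0 // rmorph1 mulr1.
    by rewrite mulrCA -rmorphM mulrA divfK ?lt0r_neq0 // divff ?lt0r_neq0 // rmorph1 mulr1.
  apply: Vconv => //; [exact: divr_gt0|exact: divr_gt0|by rewrite -mulrDl divff ?lt0r_neq0| |].
    apply: h1; rewrite (absvalM hn) nemb gtr0_norm ?divr_gt0 //.
    by rewrite -mulrA divfK ?lt0r_neq0.
  apply: h2; rewrite (absvalM hn) nemb gtr0_norm ?divr_gt0 //.
  by rewrite -mulrA divfK ?lt0r_neq0.
- have [->|a0] := eqVneq a 0.
    rewrite scale0r (absval0 hn) mul0r; apply/eqP; rewrite eq_le p0 andbT.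
    apply/ler_addgt0Pr => e e0; rewrite add0r; apply: ple; split=> // c _.
    by rewrite scaler0; exact: nbhs_singleton.
  apply/eqP; rewrite eq_le pZ1 //=.
  have := pZ1 a^-1 (a *: x); rewrite invr_eq0 => /(_ a0).
  rewrite scalerA mulVf // scale1r (absvalV hn) mulrC => h.
  by rewrite mulrC -ler_pdivlMr ?(absval_gt0 hn).
- have [t [t0 ht] ht1] : exists2 t, G x t & t < 1.
    have [|t ht h] := @inf_adherent _ (G x) (1 - p x) _ (Ginf x); first by rewrite subr_gt0.
    by exists t => //; move: h; rewrite -/(p x) addrC subrK.
  by apply: VU; rewrite -[x]scale1r; apply: ht; rewrite (absval1 hn) mul1r ltW.
- have [d [d0 [W W0 hW]]] := small_scalars 0 V0.
  have ed0 : 0 < e * d by exact: mulr_gt0.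
  apply: filterS (nbhs0Z (emb_neq0 _ ed0) W0) => x [w Ww <-] /=.
  apply: ple; split=> // c hc; rewrite scalerA; apply: hW => //.
  rewrite (absvalM hn) nemb gtr0_norm // mulrA -[leRHS]mul1r.
  by apply: ler_wpM2r => //; exact: ltW.
Qed.

(** Gauges of the balls of radius 1 / (n + 1) about 0, summed up to k so that the sequence
    increases. The metric may fail to be translation invariant; only its balls about 0 enter. *)
Lemma seminorms_of_metrizable : metrizable R E -> exists p : nat -> E -> R,
  [/\ forall k, seminorm nrm (p k), forall k x, p k x <= p k.+1 x,
      forall x, x != 0 -> exists k, 0 < p k x,
      forall k e, 0 < e -> nbhs (0 : E) [set x | p k x <= e] &
      forall U, nbhs (0 : E) U -> exists k, forall x, p k x < 1 -> U x].
Proof.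
move=> [d [d0 dE dC dD] dnbhs].
have ball0 (n : nat) : nbhs (0 : E) [set y | d 0 y < n.+1%:R^-1].
  by rewrite dnbhs; exists n.+1%:R^-1 => //=; rewrite invr_gt0 ltr0n.
have [g hg] := choice (fun n => exists_gauge (ball0 n)).
have hgs n : seminorm nrm (g n) by case: (hg n).
have g0 n x : 0 <= g n x by exact: (semi_ge0 hn (hgs n)).
pose p k x := \sum_(i < k.+1) g i x.
have gp k x : g k x <= p k x.
  by rewrite /p big_ord_recr /= lerDr; apply: sumr_ge0.
have hp k : seminorm nrm (p k).
  split=> [x y|a x]; rewrite /p; last first.
    by rewrite mulr_sumr; apply: eq_bigr => i _; rewrite (hgs i).2.
  by rewrite -big_split; apply: ler_sum => i _; exact: (hgs i).1.
have harch (a : R) : 0 < a -> exists n : nat, n.+1%:R^-1 <= a.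
  move=> a0; have [n [n0 hn']] := small_nat 1 a0; exists n; apply: le_trans hn'.
  by rewrite mul1r lef_pV2 ?posrE ?ltr0n // ler_nat.
exists p; split=> //.
- by move=> k x; rewrite /p [leRHS]big_ord_recr /= lerDl.
- move=> x x0; have dx : 0 < d 0 x.
    rewrite lt_neqAle d0 andbT; apply: contra x0 => /eqP/esym/dE <-; exact: eqxx.
  have [n hn'] := harch _ dx; exists n; rewrite ltNge; apply/negP => hle.
  have [_ h _] := hg n; have : d 0 x < n.+1%:R^-1.
    by apply: h; apply: le_lt_trans (gp n x) _; apply: le_lt_trans hle _; exact: ltr01.
  by rewrite ltNge hn'.
- move=> k e e0; pose a := e / k.+1%:R.
  have a0 : 0 < a by rewrite divr_gt0 ?ltr0n.
  have : nbhs (0 : E) [set x | forall i, (i < k.+1)%N -> g i x <= a].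
    elim: k.+1 => [|m IH]; first by apply: filterS filterT.
    have [_ _ /(_ a a0) h] := hg m; apply: filterS2 IH h => x h1 h2 i.
    by rewrite ltnS leq_eqVlt => /orP[/eqP ->|/h1].
  apply: filterS => x h /=; apply: (@le_trans _ _ (\sum_(i < k.+1) a)).
    by apply: ler_sum => i _; exact: h.
  by rewrite sumr_const card_ord -mulr_natr /a divfK // pnatr_eq0.
- move=> U; rewrite dnbhs => -[a /= a0 haU]; have [n hn'] := harch _ a0.
  exists n => x hx; apply: haU => /=; apply: lt_le_trans hn'.
  by have [_ h _] := hg n; apply: h; exact: le_lt_trans (gp n x) hx.
Qed.

End Gauge.

(** * Coordinates in a Hamel basis *)

Section HamelBasis.
Context {K : numFieldType} {E : lmodType K}.

Lemma hamel_coordinates : countably_infinite_dimensional E ->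
  exists (Phi : {linear {poly K} -> E}) (inv : E -> {poly K}), cancel Phi inv /\ cancel inv Phi.
Proof.
move=> [B [[indep span] Binf Bcount]].
have /card_set_bijP[ix [_ ixinj ixsurj]] := eq_card_nat Bcount Binf.
have hb i : exists v, B v /\ ix v = i by have [v Bv hv] := ixsurj i I; exists v.
have [b hb'] := choice hb.
have bB i : B (b i) by case: (hb' i).
have ixK i : ix (b i) = i by case: (hb' i).
have hix v : B v -> b (ix v) = v by move=> Bv; apply: ixinj; rewrite ?inE.
have binj : injective b by exact: can_inj ixK.
pose Phi := mk_linear (linear_by_basis b).
have Phi_inj c : Phi c = 0 -> c = 0.
  move=> h0; pose s := [seq b i | i <- iota 0 (size c)].
  pose F := seq_fset tt s.
  have us : uniq s by rewrite map_inj_uniq ?iota_uniq.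
  have FB : [set` F] `<=` B.
    by move=> v /=; rewrite seq_fsetE => /mapP[i _ ->].
  have sumE : \sum_(v <- F) c`_(ix v) *: v = 0.
    have pF : perm_eq F s.
      by apply: uniq_perm => // v; rewrite seq_fsetE.
    rewrite (perm_big _ pF).
    rewrite -[RHS]h0 /= big_map -{1}[size c]subn0 -/(index_iota 0 (size c)) big_mkord.
    by apply: eq_bigr => i _; rewrite ixK.
  apply/polyP => i; rewrite coef0; case: (ltnP i (size c)) => hi; last by rewrite nth_default.
  have := indep F (fun v => c`_(ix v)) FB sumE (b i); rewrite ixK; apply.
  by rewrite seq_fsetE; apply/mapP; exists i => //; rewrite mem_iota.
have Phi_surj x : exists c, Phi c = x.
  have [F [a [FB ->]]] := span x.
  exists (\sum_(v <- F) a v *: 'X^(ix v)); rewrite linear_sum.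
  rewrite !big_seq; apply: eq_bigr => v vF; rewrite linearZ linear_by_basis_Xn.
  by rewrite hix //; exact: FB.
have [inv hinv] := choice Phi_surj.
exists Phi, inv; split=> // c.
by apply/eqP; rewrite -subr_eq0; apply/eqP/Phi_inj; rewrite linearB hinv subrr.
Qed.

End HamelBasis.

(** * Closed invariant subsets of the operator obtained *)

Section Conclusion.
Context {R : realType} {K : numFieldType} {E : tvsType K}.
Variables (nrm : K -> R) (hK : scalar_field nrm).
Let hn := sf_absval hK.

Lemma minimal_continuous_operator : metrizable R E -> countably_infinite_dimensional E ->
  exists2 T : {linear E -> E}, continuous T &
    forall A : set E, closed_invariant T A -> [\/ A = set0, A = [set 0] | A = [set: E]].
Proof.
move=> hmetr hdim.
have [p [hp hmono hsep pnbhs psub]] := seminorms_of_metrizable hK hmetr.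
have [Phi [inv [PhiK invK]]] := hamel_coordinates hdim.
pose q k c := p k (Phi c).
have hq k : seminorm nrm (q k) by exact: (seminorm_comp Phi (hp k)).
have hqsep c : c != 0 -> exists k, 0 < q k c.
  move=> c0; apply: hsep; apply: contraNneq c0 => h.
  by rewrite -(PhiK c) h -(linear0 Phi) PhiK.
have hmin := minimal_operator_poly hK hq (fun k c => hmono k (Phi c)) hqsep.
have [T [hT hyp]] : has_minimal_operator p.
  apply: (minimal_operator_transport hn hq PhiK invK _ _ hmin) => k.
    by exists k, 1 => x; rewrite mul1r.
  by exists k, 1 => x; rewrite mul1r.
have local x U : nbhs x U -> exists k, forall z, p k z < 1 -> U (x + z).
  move=> hU; have : nbhs (0 : E) [set z | U (x + z)].
    have := nbhsB (- x) hU; rewrite addNr; apply: filterS => z [u Uu <-] /=.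
    by rewrite addNKr.
  by move=> /psub[k hk]; exists k.
exists T.
  move=> x U /local[k hk]; have [l [C [C0 _ hC]]] := qcontP hn hp hmono hT k.
  have e0 : 0 < 1 / (C + 1) by apply: divr_gt0; lra.
  apply: filterS (nbhsT x (pnbhs l _ e0)) => y [z hz <-] /=.
  rewrite linearD; apply: hk; apply: le_lt_trans (hC z) _.
  apply: (@le_lt_trans _ _ (C * (1 / (C + 1)))); first by rewrite ler_pM2l.
  by rewrite mulrA mulr1 ltr_pdivrMr; lra.
move=> A [Aclosed Ainv].
(* A nonzero point of [A] has a dense orbit, which invariance keeps inside [A]. *)
case: (pselect (exists2 x, A x & x != 0)) => [[x Ax x0]|none].
  apply: Or33; apply/seteqP; split=> // y _.
  apply: Aclosed => U /local[k hk].
  have [m hm] := hyp x x0 y k (1 / 2) ltac:(lra).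
  exists (iter m T x); split; last first.
    by rewrite -[iter m T x](subrKC y); apply: hk; apply: le_lt_trans hm _; lra.
  elim: m {hm} => //= m IH; apply: Ainv; by exists (iter m T x).
case: (pselect (A 0)) => A0.
  apply: Or32; apply/seteqP; split=> [x Ax|x -> //] /=.
  by apply/eqP; apply: contrapT => /negP x0; apply: none; exists x.
apply: Or31; apply/seteqP; split=> // x Ax /=.
by apply: none; exists x => //; apply: contra_not_neq A0 => <-.
Qed.

End Conclusion.

Lemma real_or_complex_scalar_field (R : realType) (K : numFieldType) :
  real_or_complex R K -> exists nrm : K -> R, scalar_field nrm.
Proof. by case; eexists; [exact: scalar_field_real|exact: scalar_field_complex]. Qed.

Theorem theorem1p5 (R : realType) (K : numFieldType) (hK : real_or_complex R K)
    (E : tvsType K)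
    (hmetr : metrizable R E)
    (hdim : countably_infinite_dimensional E) :
  ~ invariant_subset_property E /\
  exists2 T : {linear E -> E}, continuous T &
    forall A : set E, closed_invariant T A ->
      [\/ A = set0, A = [set 0] | A = [set: E]].
Proof.
have [nrm hnrm] := real_or_complex_scalar_field hK.
have [T Tcont hT] := minimal_continuous_operator hnrm hmetr hdim.
split; last by exists T.
move=> /(_ T Tcont)[A [hA A0 A1 A2]].
by case: (hT A hA).
Qed.
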